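(* Assume $V=L$. Let $X$ be an uncountable Polish space. Then there is a map $\psi$ from $\mathscr P(\omega)$ into the $\boldsymbol\Pi^1_1$ (coanalytic) subsets of $X$ such that for all $a,b\subseteq\omega$: (1) if $a\subseteq b$ then $\psi(a)\le_{\mathsf D_2(X)}\psi(b)$; (2) if $\psi(a)\le_{\mathsf{Bor}(X)}\psi(b)$ then $a\subseteq b$. In particular, $(\mathscr P(\omega),\subseteq)$ embeds into the $\mathcal F$-hierarchy on the $\boldsymbol\Pi^1_1$ subsets of $X$ for every reducibility $\mathcal F$ with $\mathsf D_2(X)\subseteq\mathcal F\subseteq\mathsf{Bor}(X)$, and hence the $\mathcal F$-hierarchy on $\boldsymbol\Pi^1_1$ subsets of $X$ is very bad.
   Context: $\mathsf D_2(X)$ is the set of $\boldsymbol\Delta^0_2$-functions $f\colon X\to X$ ($f^{-1}(A)\in\boldsymbol\Sigma^0_2$ for every $A\in\boldsymbol\Sigma^0_2$); $\mathsf{Bor}(X)$ is the set of Borel measurable maps $X\to X$. A reducibility is a set of self-maps of $X$ closed under composition containing the identity; $A\le_{\mathcal F}B$ iff $A=f^{-1}(B)$ for some $f\in\mathcal F$. The $\mathcal F$-hierarchy on a class $\Gamma$ is the quotient of $(\Gamma,\le_{\mathcal F})$; very bad means it contains both an infinite antichain and an infinite strictly descending chain. *)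

(* Defs.v *)
From HB Require Import structures.
From mathcomp Require Import all_boot all_order all_algebra.
From mathcomp Require Import all_classical all_reals all_analysis.
From mathcomp Require Import borel_hierarchy.

Set Implicit Arguments.
Unset Strict Implicit.
Unset Printing Implicit Defensive.

Import Order.TTheory GRing.Theory Num.Theory.
Local Open Scope classical_set_scope.
Local Open Scope ring_scope.

(** * The axiom of constructibility

    The universe of sets is the type of well-founded trees, taken up to
    bisimilarity.  Under choice every small type is in bijection with the
    elements of some such set, so the hypothesis [V_eq_L] below speaks of the
    same mathematical universe as the types that carry the Polish spaces. *)

Inductive ens : Type := Sup (T : Type) (f : T -> ens).

Definition idx (x : ens) : Type := match x with Sup T _ => T end.

Definition elt (x : ens) : idx x -> ens :=
  match x return idx x -> ens with Sup _ f => f end.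

Fixpoint ens_eq (x y : ens) : Prop :=
  match x, y with
  | Sup T f, Sup U g => (forall i, exists j, ens_eq (f i) (g j)) /\
                        (forall j, exists i, ens_eq (f i) (g j))
  end.

Definition ens_in (x y : ens) : Prop := exists j : idx y, ens_eq x (elt j).

Definition ens_trans (x : ens) : Prop :=
  forall y z, ens_in y x -> ens_in z y -> ens_in z x.

Definition ens_ordinal (x : ens) : Prop :=
  ens_trans x /\ forall y, ens_in y x -> ens_trans y.

(** First-order formulas of the language of set theory whose free variables
    are among [n] de Bruijn indices; the bound variable has index [ord0]. *)
Inductive fml : nat -> Type :=
  | FIn n of 'I_n & 'I_n : fml n
  | FEq n of 'I_n & 'I_n : fml n
  | FNot n of fml n : fml n
  | FAnd n of fml n & fml n : fml n
  | FEx n of fml n.+1 : fml n.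

Definition env_cons n (x : ens) (e : 'I_n -> ens) : 'I_n.+1 -> ens :=
  fun i => oapp e x (unlift ord0 i).

(** [sat D e phi] is satisfaction of [phi] in the structure (D, ∈). *)
Fixpoint sat (D : ens) n (e : 'I_n -> ens) (phi : fml n) : Prop :=
  match phi in fml m return ('I_m -> ens) -> Prop with
  | FIn _ i j => fun e => ens_in (e i) (e j)
  | FEq _ i j => fun e => ens_eq (e i) (e j)
  | FNot _ p => fun e => ~ sat D e p
  | FAnd _ p q => fun e => sat D e p /\ sat D e q
  | FEx _ p => fun e => exists x, ens_in x D /\ sat D (env_cons x e) p
  end e.

(** The set of all {x ∈ D | (D, ∈) ⊨ phi(x, p)}, for [phi] a formula and [p] a
    finite tuple of parameters from [D]. *)
Definition Def (D : ens) : ens :=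
  @Sup {n : nat & (fml n.+1 * ('I_n -> idx D))%type}
    (fun t => let: existT n (phi, p) := t in
       @Sup {i : idx D | sat D (env_cons (elt i) (fun k => elt (p k))) phi}
            (fun i => elt (sval i))).

(** L_α is the union of the Def(L_β) for β ∈ α.  Unwinding this recursion gives
    L_0 = ∅, L_(α+1) = Def(L_α), and L_λ the union of the L_β, β < λ, at
    limits. *)
Fixpoint L (a : ens) : ens :=
  match a with
  | Sup T f => @Sup {i : T & idx (Def (L (f i)))} (fun t => elt (projT2 t))
  end.

Definition constructible (x : ens) : Prop :=
  exists a, ens_ordinal a /\ ens_in x (L a).

Definition V_eq_L : Prop := forall x : ens, constructible x.

(** * Polish spaces and pointclasses *)

Definition is_metric (R : realType) (X : Type) (d : X -> X -> R) : Prop :=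
  [/\ forall x y, d x y = 0 <-> x = y,
      forall x y, d x y = d y x
    & forall x y z, d x z <= d x y + d y z].

Definition metric_induces_topology (R : realType) (X : topologicalType)
    (d : X -> X -> R) : Prop :=
  forall (x : X) (A : set X),
    nbhs x A <-> exists2 e : R, 0 < e & [set y | d x y < e] `<=` A.

Definition metric_complete (R : realType) (X : Type) (d : X -> X -> R) : Prop :=
  forall u : nat -> X,
    (forall e : R, 0 < e -> exists N, forall m n,
       (N <= m)%N -> (N <= n)%N -> d (u m) (u n) < e) ->
    exists l : X, forall e : R, 0 < e -> exists N, forall n,
      (N <= n)%N -> d (u n) l < e.

Definition polish (R : realType) (X : topologicalType) : Prop :=
  (exists2 D : set X, countable D & dense D) /\
  exists d : X -> X -> R,
    [/\ is_metric d, metric_induces_topology d & metric_complete d].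

(** Σ^1_1: continuous images of Polish spaces.  [R] only serves as the codomain
    of metrics. *)
Definition analytic (R : realType) (X : topologicalType) (A : set X) : Prop :=
  exists (Y : topologicalType) (f : Y -> X),
    [/\ polish R Y, continuous f & A = range f].

Definition coanalytic (R : realType) (X : topologicalType) : set (set X) :=
  [set A | analytic R (~` A)].
Arguments coanalytic R X : clear implicits.

Definition borel (X : topologicalType) : set (set X) := <<s @open X >>.

(** Σ^0_2 is the library's [Fsigma]. *)
Definition D2 (X : topologicalType) : set (X -> X) :=
  [set f | forall A : set X, Fsigma A -> Fsigma (f @^-1` A)].
Arguments D2 X : clear implicits.

Definition Bor (X : topologicalType) : set (X -> X) :=
  [set f | forall A : set X, borel A -> borel (f @^-1` A)].
Arguments Bor X : clear implicits.

(** * Reducibilities and their hierarchies *)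

Definition reducibility (X : Type) (F : set (X -> X)) : Prop :=
  F id /\ forall f g, F f -> F g -> F (f \o g).

Definition reduces (X : Type) (F : set (X -> X)) (A B : set X) : Prop :=
  exists2 f, F f & A = f @^-1` B.

(** The [F]-hierarchy on [Gamma] is the quotient of the preorder
    ([Gamma], [reduces F]): its points are the equivalence classes. *)
Definition degree (X : Type) (F : set (X -> X)) (Gamma : set (set X))
    (A : set X) : set (set X) :=
  [set B | [/\ Gamma B, reduces F A B & reduces F B A]].

Definition hierarchy (X : Type) (F : set (X -> X)) (Gamma : set (set X)) :
    set (set (set X)) :=
  degree F Gamma @` Gamma.

Definition degree_le (X : Type) (F : set (X -> X)) (a b : set (set X)) : Prop :=
  exists A B, [/\ a A, b B & reduces F A B].

Definition order_embeds (S T : Type) (leS : S -> S -> Prop)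
    (Q : set T) (leT : T -> T -> Prop) : Prop :=
  exists phi : S -> T,
    (forall s, Q (phi s)) /\ forall s t, leS s t <-> leT (phi s) (phi t).

Definition has_infinite_antichain (T : Type) (Q : set T)
    (le : T -> T -> Prop) : Prop :=
  exists A : set T, [/\ A `<=` Q, infinite_set A &
    forall x y, A x -> A y -> x <> y -> ~ le x y].

Definition has_infinite_descending_chain (T : Type) (Q : set T)
    (le : T -> T -> Prop) : Prop :=
  exists s : nat -> T, (forall n, Q (s n)) /\
    forall n, le (s n.+1) (s n) /\ ~ le (s n) (s n.+1).

Definition very_bad (X : Type) (F : set (X -> X)) (Gamma : set (set X)) : Prop :=
  has_infinite_antichain (hierarchy F Gamma) (degree_le F) /\
  has_infinite_descending_chain (hierarchy F Gamma) (degree_le F).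

(* Main.v *)
(** A code is a real that presents a weak order of the natural numbers together
    with the truth table of the constructible hierarchy along it; for a
    well-founded order this table is unique, so being a code of a countable stage
    is a coanalytic condition.  Condensation and V = L put every real into a
    countable stage.  Call a stage a closure point if it contains presentations of
    all smaller ordinals and decides every tree with parameters in it, with a
    branch in the stage or a rank below it.  C_n is the set of codes of closure
    points whose position among the closure points is a limit plus n.

    Suppose a Borel f reduces C_n to the union of the C_m with m in b, n not in b;
    its graph is Souslin.  Let α be a closure point in position limit plus n whose
    stage contains the trees below, and α* the next closure point.  A tree in
    stage α* finds a code of α and its f-image, whose order lies in that stage, so
    the image codes an ordinal α' < α*; positions exclude α' = α, hence α' < α.
    Stage α contains a presentation of α' and the tree searching for x, a
    code f(x) of α', and a descending sequence in the order of x.  This tree is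
    well-founded because f is a reduction, so its rank is below α; but a code of α
    yields a subtree of rank α.

    The sets C_n are placed on disjoint clopen pieces of a Cantor set in X, and
    psi(a) is the union of the C_n with n in a; collapsing the superfluous pieces
    to a point is a Δ^0_2 map. *)
Require Import Defs.
From HB Require Import structures.
From mathcomp Require Import all_boot all_order all_algebra.
From mathcomp Require Import all_classical all_reals all_analysis.
From mathcomp Require Import borel_hierarchy lra.

Set Implicit Arguments.
Unset Strict Implicit.
Unset Printing Implicit Defensive.

Import Order.TTheory GRing.Theory Num.Theory.
Local Open Scope classical_set_scope.

(** Closure points take the place of admissible ordinals: [Dec] builds in the bounding that the
    argument calls for. A well-founded order lying in a closure stage has rank below it, because the
    stage decides the tree of descending sequences of that order and finds no branch. A code of α
    need not lie in stage α*; but it yields a branch in V of a tree with parameters there, so that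
    tree has no rank and the stage must contain the image order of some code of α, possibly another
    one. Counting positions modulo limits gives infinitely many disjoint classes, each unbounded, so
    α can be taken above any given trees. Condensation is carried by names. A hull is only a
    sequence of ordinals; its elements are named by formulas over it, and the recursion for the
    truth of names has one solution on a well-founded order. The hull and the stage of its order
    type therefore share one table, and this identity is the collapse. *)

(** * Extensional sets and ordinals *)

Lemma ens_eq_refl x : ens_eq x x.
Proof. by elim: x => T f IH /=; split=> i; exists i. Qed.

Lemma ens_eq_sym x y : ens_eq x y -> ens_eq y x.
Proof.
elim: x y => T f IH [U g] /= [h1 h2]; split=> i.
  by have [j /IH ?] := h2 i; exists j.
by have [j /IH ?] := h1 i; exists j.
Qed.

Lemma ens_eq_trans y x z : ens_eq x y -> ens_eq y z -> ens_eq x z.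
Proof.
elim: x y z => T f IH [U g] [V k] /= [a1 a2] [b1 b2]; split=> i.
  have [j p] := a1 i; have [l q] := b1 j; exists l; exact: IH p q.
have [j p] := b2 i; have [l q] := a2 j; exists l; exact: IH q p.
Qed.

Lemma ens_in_elt x (i : idx x) : ens_in (elt i) x.
Proof. by exists i; exact: ens_eq_refl. Qed.

Lemma ens_in_eql x y z : ens_eq x y -> ens_in x z -> ens_in y z.
Proof.
by move=> xy [j xj]; exists j; exact: ens_eq_trans (ens_eq_sym xy) xj.
Qed.

Lemma ens_in_eqr x y z : ens_eq x y -> ens_in z x -> ens_in z y.
Proof.
case: x => T f; case: y => U g /= [h1 _] [i zi].
have [j ij] := h1 i; exists j; exact: ens_eq_trans zi ij.
Qed.

Lemma ens_ext x y : (forall z, ens_in z x <-> ens_in z y) -> ens_eq x y.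
Proof.
case: x => T f; case: y => U g h /=; split=> i.
  by have [] := (h (f i)).1 (ens_in_elt (x := Sup f) i) => j; exists j.
have [j /ens_eq_sym] := (h (g i)).2 (ens_in_elt (x := Sup g) i).
by exists j.
Qed.

Lemma ens_in_ind (P : ens -> Prop) :
  (forall x, (forall y, ens_in y x -> P y) -> P x) -> forall x, P x.
Proof.
move=> H x; suff: forall y, ens_eq y x -> P y by apply; exact: ens_eq_refl.
elim: x => T f IH y yx; apply: H => z /(ens_in_eqr yx) [i zi].
exact: IH zi.
Qed.

Lemma ens_in_irr x : ~ ens_in x x.
Proof. by elim/ens_in_ind: x => x IH xx; exact: (IH _ xx xx). Qed.

Lemma ens_in_asym x y : ens_in x y -> ~ ens_in y x.
Proof.
elim/ens_in_ind: x y => x IH y xy yx; exact: (IH y yx x yx xy).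
Qed.

Lemma ens_min (P : ens -> Prop) x :
  P x -> exists y, P y /\ forall z, ens_in z y -> ~ P z.
Proof.
elim/ens_in_ind: x => x IH Px.
have [[y [yx Py]]|no] := pselect (exists y, ens_in y x /\ P y).
  exact: IH yx Py.
by exists x; split=> // z zx Pz; apply: no; exists z.
Qed.

Lemma ord_in a b : ens_ordinal a -> ens_in b a -> ens_ordinal b.
Proof.
move=> [ta tea] ba; split; first exact: tea.
by move=> y yb; apply: tea; exact: ta ba yb.
Qed.

Lemma ord_trans a x y : ens_ordinal a -> ens_in x y -> ens_in y a -> ens_in x a.
Proof. by move=> [ta _] xy ya; exact: ta ya xy. Qed.

Lemma ord_eq a b : ens_eq a b -> ens_ordinal a -> ens_ordinal b.
Proof.
move=> ab oa; split.
  move=> y z /(ens_in_eqr (ens_eq_sym ab)) ya zy; apply: ens_in_eqr ab _.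
  exact: ord_trans zy ya.
by move=> y /(ens_in_eqr (ens_eq_sym ab)) /(ord_in oa) [].
Qed.

Lemma ord_trich a b : ens_ordinal a -> ens_ordinal b ->
  [\/ ens_in a b, ens_eq a b | ens_in b a].
Proof.
elim/ens_in_ind: a b => a IHa b oa.
elim/ens_in_ind: b => b IHb ob.
have [ab|nab] := pselect (ens_in a b); first by constructor 1.
have [ba|nba] := pselect (ens_in b a); first by constructor 3.
constructor 2; apply: ens_ext => z; split=> [za|zb].
  have [//|zb|bz] := IHa z za b (ord_in oa za) ob.
    by case: nba; exact: ens_in_eql zb za.
  by case: nba; exact: ord_trans bz za.
have [az|az|//] := IHb z zb (ord_in ob zb).
  by case: nab; exact: ord_trans az zb.
by case: nab; apply: ens_in_eql zb; exact: ens_eq_sym.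
Qed.

Definition ens0 : ens := @Sup void (fun v => match v with end).

Definition osucc (a : ens) : ens := @Sup (option (idx a)) (oapp (@elt a) a).

Lemma osuccE x a : ens_in x (osucc a) <-> ens_in x a \/ ens_eq x a.
Proof.
split=> [[[i|] xi]|[[i xi]|xa]]; [left|right|exists (Some i)|exists None] => //.
by exists i.
Qed.

Lemma osucc_ord a : ens_ordinal a -> ens_ordinal (osucc a).
Proof.
move=> oa; split=> [y z /osuccE [ya|ya] zy|y /osuccE [ya|ya]].
- by apply/osuccE; left; exact: ord_trans zy ya.
- by apply/osuccE; left; exact: ens_in_eqr ya zy.
- by have [] := ord_in oa ya.
- by have [] := ord_eq (ens_eq_sym ya) oa.
Qed.

Definition osup (I : Type) (f : I -> ens) : ens :=
  @Sup {n : I & idx (f n)} (fun p => elt (projT2 p)).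

Lemma osupE (I : Type) (f : I -> ens) x : ens_in x (osup f) <-> exists n, ens_in x (f n).
Proof.
split=> [[[n i] xi]|[n [i xi]]]; first by exists n; exists i.
by exists (existT _ n i).
Qed.

Lemma osup_ord (I : Type) (f : I -> ens) : (forall n, ens_ordinal (f n)) -> ens_ordinal (osup f).
Proof.
move=> o; split=> [y z /osupE [n yn] zy|y /osupE [n /(ord_in (o n)) []]//].
by apply/osupE; exists n; exact: ord_trans zy yn.
Qed.

(** * The constructible hierarchy through untyped formulas *)

Inductive uf :=
  | UIn of nat & nat
  | UEq of nat & nat
  | UNot of uf
  | UAnd of uf & uf
  | UEx of uf.

(** Environments are lists, so formulas form a countable type independent of the number of
    variables. An index past the end reads the empty set; [wsc] excludes such indices where [Def] is
    concerned. *)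
Fixpoint usat (D : ens) (e : seq ens) (p : uf) : Prop :=
  match p with
  | UIn i j => ens_in (nth ens0 e i) (nth ens0 e j)
  | UEq i j => ens_eq (nth ens0 e i) (nth ens0 e j)
  | UNot p => ~ usat D e p
  | UAnd p q => usat D e p /\ usat D e q
  | UEx p => exists x, ens_in x D /\ usat D (x :: e) p
  end.

Fixpoint wsc (n : nat) (p : uf) : bool :=
  match p with
  | UIn i j | UEq i j => (i < n)%N && (j < n)%N
  | UNot p => wsc n p
  | UAnd p q => wsc n p && wsc n q
  | UEx p => wsc n.+1 p
  end.

Lemma usat_eq D D' e e' p : ens_eq D D' ->
  (forall k, ens_eq (nth ens0 e k) (nth ens0 e' k)) ->
  usat D e p <-> usat D' e' p.
Proof.
move=> DD; elim: p e e' => [i j|i j|p IH|p IHp q IHq|p IH] e e' ee /=.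
- split=> h.
    exact: ens_in_eqr (ee j) (ens_in_eql (ee i) h).
  exact: ens_in_eqr (ens_eq_sym (ee j)) (ens_in_eql (ens_eq_sym (ee i)) h).
- split=> h.
    exact: ens_eq_trans (ens_eq_sym (ee i)) (ens_eq_trans h (ee j)).
  exact: ens_eq_trans (ee i) (ens_eq_trans h (ens_eq_sym (ee j))).
- by rewrite (IH _ _ ee).
- by rewrite (IHp _ _ ee) (IHq _ _ ee).
- have E x : usat D (x :: e) p <-> usat D' (x :: e') p.
    by apply: IH => -[|k] //=; exact: ens_eq_refl.
  split=> -[x [xD /E h]]; exists x; split=> //.
    exact: ens_in_eqr DD xD.
  exact: ens_in_eqr (ens_eq_sym DD) xD.
Qed.

Fixpoint forget n (p : fml n) : uf :=
  match p with
  | FIn _ i j => UIn i j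
  | FEq _ i j => UEq i j
  | FNot _ p => UNot (forget p)
  | FAnd _ p q => UAnd (forget p) (forget q)
  | FEx _ p => UEx (forget p)
  end.

Lemma sat_forget D n (e : 'I_n -> ens) l (p : fml n) :
  (forall i, e i = nth ens0 l i) -> sat D e p <-> usat D l (forget p).
Proof.
elim: p e l => {n} [n i j|n i j|n p IH|n p IHp q IHq|n p IH] e l el /=.
- by rewrite !el.
- by rewrite !el.
- by rewrite (IH _ _ el).
- by rewrite (IHp _ _ el) (IHq _ _ el).
- have E x : sat D (env_cons x e) p <-> usat D (x :: l) (forget p).
    apply: IH => i; rewrite /env_cons.
    by case: unliftP => [j ->|->] //=; rewrite el.
  by split=> -[x [xD /E h]]; exists x.
Qed.

Lemma wsc_forget n (p : fml n) : wsc n (forget p).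
Proof.
by elim: p => {n} [n i j|n i j|n p IH|n p IHp q IHq|n p IH] //=;
  rewrite ?ltn_ord ?IHp.
Qed.

Lemma forget_onto n p : wsc n p -> exists p' : fml n, forget p' = p.
Proof.
elim: p n => [i j|i j|p IH|p IHp q IHq|p IH] n /=.
- by case/andP=> hi hj; exists (FIn (Ordinal hi) (Ordinal hj)).
- by case/andP=> hi hj; exists (FEq (Ordinal hi) (Ordinal hj)).
- by case/IH=> p' <-; exists (FNot p').
- by case/andP=> /IHp [p' <-] /IHq [q' <-]; exists (FAnd p' q').
- by case/IH=> p' <-; exists (FEx p').
Qed.

Definition sep (D : ens) (p : uf) (ps : seq ens) : ens :=
  @Sup {i : idx D | usat D (elt i :: ps) p} (fun i => elt (sval i)).

Lemma sepE D p ps z : ens_in z (sep D p ps) <-> ens_in z D /\ usat D (z :: ps) p.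
Proof.
have E x : ens_eq z x -> usat D (z :: ps) p <-> usat D (x :: ps) p.
  move=> zx; apply: usat_eq; first exact: ens_eq_refl.
  by case=> [|k] //=; exact: ens_eq_refl.
split=> [[[i hi] /= zi]|[[i zi] h]].
  by split; [exists i|apply/(E _ zi)].
by move/(E _ zi): h => h; exists (exist _ i h).
Qed.

(** Trades dependent formulas and parameter tuples for untyped formulas with lists, the form in
    which names are built. *)
Lemma DefE D x : ens_in x (Def D) <->
  exists p ps, [/\ wsc (size ps).+1 p,
    forall k, (k < size ps)%N -> ens_in (nth ens0 ps k) D &
    ens_eq x (sep D p ps)].
Proof.
split=> [[[n [p e]] /= xe]|[p [ps [wp psD xs]]]].
  pose ps := [seq elt (e k) | k <- enum 'I_n].
  have nps (k : 'I_n) : nth ens0 ps k = elt (e k).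
    by rewrite (nth_map k) ?size_enum_ord // nth_ord_enum.
  exists (forget p), ps; split.
  - by rewrite size_map size_enum_ord; exact: wsc_forget.
  - move=> k; rewrite size_map size_enum_ord => kn.
    by rewrite (nps (Ordinal kn)); exact: ens_in_elt.
  - have E (i : idx D) : sat D (env_cons (elt i) (fun k => elt (e k))) p <->
        usat D (elt i :: ps) (forget p).
      apply: sat_forget => k; rewrite /env_cons.
      by case: unliftP => [j ->|->] //=; rewrite nps.
    apply: ens_eq_trans xe _ => /=.
    split=> -[i hi].
      by move/E: (hi) => hi'; exists (exist _ i hi'); exact: ens_eq_refl.
    by move/E: (hi) => hi'; exists (exist _ i hi'); exact: ens_eq_refl.
have [p' p'E] := forget_onto wp.
have /choice [e he] : forall k : 'I_(size ps), exists i : idx D,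
    ens_eq (nth ens0 ps k) (elt i).
  by move=> k; have [i hi] := psD k (ltn_ord k); exists i.
exists (existT _ (size ps) (p', e)) => /=.
apply: ens_eq_trans xs _.
pose ps' := [seq elt (e k) | k <- enum 'I_(size ps)].
have nps (k : 'I_(size ps)) : nth ens0 ps' k = elt (e k).
  by rewrite (nth_map k) ?size_enum_ord // nth_ord_enum.
have E (i : idx D) : sat D (env_cons (elt i) (fun k => elt (e k))) p' <->
    usat D (elt i :: ps) p.
  rewrite (sat_forget (l := elt i :: ps') D) ?p'E; last first.
    by move=> k; rewrite /env_cons; case: unliftP => [j ->|->] //=; rewrite nps.
  apply: usat_eq; first exact: ens_eq_refl.
  case=> [|k] /=; first exact: ens_eq_refl.
  have [kn|kn] := ltnP k (size ps); last first.
    have sps : size ps' = size ps by rewrite size_map size_enum_ord.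
    by rewrite !nth_default ?sps //; exact: ens_eq_refl.
  rewrite (nps (Ordinal kn)); apply: ens_eq_sym; exact: (he (Ordinal kn)).
split=> -[i hi].
  by move/E: (hi) => hi'; exists (exist _ i hi'); exact: ens_eq_refl.
by move/E: (hi) => hi'; exists (exist _ i hi'); exact: ens_eq_refl.
Qed.

Lemma sep_eq D D' p ps ps' : ens_eq D D' ->
  (forall k, ens_eq (nth ens0 ps k) (nth ens0 ps' k)) ->
  ens_eq (sep D p ps) (sep D' p ps').
Proof.
move=> DD pp; apply: ens_ext => z.
have E : usat D (z :: ps) p <-> usat D' (z :: ps') p.
  by apply: usat_eq DD _ => -[|k]; [exact: ens_eq_refl|exact: pp].
rewrite !sepE E; split=> -[h1 h2]; split=> //.
  exact: ens_in_eqr DD h1.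
exact: ens_in_eqr (ens_eq_sym DD) h1.
Qed.

Lemma Def_eq D D' : ens_eq D D' -> ens_eq (Def D) (Def D').
Proof.
have H A B x : ens_eq A B -> ens_in x (Def A) -> ens_in x (Def B).
  move=> AB /DefE [p [ps [w pA xs]]]; apply/DefE; exists p, ps; split=> //.
    by move=> k /pA; exact: ens_in_eqr.
  apply: ens_eq_trans xs _; apply: sep_eq => // k; exact: ens_eq_refl.
move=> DD; apply: ens_ext => x; split; apply: H => //; exact: ens_eq_sym.
Qed.

Lemma L_eq a b : ens_eq a b -> ens_eq (L a) (L b).
Proof.
elim: a b => T f IH [U g] [h1 h2]; apply: ens_ext => x; split.
  move=> [[i k] /= xk]; have [j /IH/Def_eq ij] := h1 i.
  have [l xl] : ens_in x (Def (L (g j))) by apply: (ens_in_eqr ij); exists k.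
  by exists (existT _ j l).
move=> [[j k] /= xk]; have [i /IH/Def_eq/ens_eq_sym ij] := h2 j.
have [l xl] : ens_in x (Def (L (f i))) by apply: (ens_in_eqr ij); exists k.
by exists (existT _ i l).
Qed.

Lemma LE a x : ens_in x (L a) <-> exists b, ens_in b a /\ ens_in x (Def (L b)).
Proof.
case: a => T f; split=> [[[i k] /= xk]|[b [[i bi] xb]]].
  by exists (f i); split; [exact: (ens_in_elt (x := Sup f))|exists k].
have [k xk] := ens_in_eqr (Def_eq (L_eq bi)) xb.
by exists (existT _ i k).
Qed.

Lemma L_mono a b : ens_ordinal b -> ens_in a b -> forall x, ens_in x (L a) -> ens_in x (L b).
Proof.
move=> ob ab x /LE [c [ca xc]]; apply/LE; exists c; split=> //.
exact: ord_trans ca ab.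
Qed.

Fixpoint uf_enc (p : uf) : GenTree.tree nat :=
  match p with
  | UIn i j => GenTree.Node 0 [:: GenTree.Leaf i; GenTree.Leaf j]
  | UEq i j => GenTree.Node 1 [:: GenTree.Leaf i; GenTree.Leaf j]
  | UNot p => GenTree.Node 2 [:: uf_enc p]
  | UAnd p q => GenTree.Node 3 [:: uf_enc p; uf_enc q]
  | UEx p => GenTree.Node 4 [:: uf_enc p]
  end.

Fixpoint uf_dec (t : GenTree.tree nat) : uf :=
  match t with
  | GenTree.Node 0 [:: GenTree.Leaf i; GenTree.Leaf j] => UIn i j
  | GenTree.Node 1 [:: GenTree.Leaf i; GenTree.Leaf j] => UEq i j
  | GenTree.Node 2 [:: p] => UNot (uf_dec p)
  | GenTree.Node 3 [:: p; q] => UAnd (uf_dec p) (uf_dec q)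
  | GenTree.Node 4 [:: p] => UEx (uf_dec p)
  | _ => UEq 0 0
  end.

Lemma uf_encK : cancel uf_enc uf_dec.
Proof. by elim=> //= [p ->|p -> q ->|p ->]. Qed.

HB.instance Definition _ := Countable.copy uf (can_type uf_encK).

(** The name [Nm i p ts] denotes the subset of L_i defined by [p] with the
    parameters named by [ts]. *)
Inductive nm (I : Type) := Nm of I & uf & seq (nm I).

Section NameTypes.
Variable I : Type.

Definition nix (t : nm I) := let: Nm i _ _ := t in i.
Definition nfm (t : nm I) := let: Nm _ p _ := t in p.
Definition npar (t : nm I) := let: Nm _ _ ts := t in ts.

Fixpoint Forall (P : nm I -> Prop) (ts : seq (nm I)) : Prop :=
  if ts is t :: ts' then P t /\ Forall P ts' else True.

(** [nm] is nested inside [seq], and the generated principle says nothing about the names in the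
    list; the inner induction supplies hypotheses for them. *)
Lemma nm_indF (P : nm I -> Prop) :
  (forall i p ts, Forall P ts -> P (Nm i p ts)) -> forall t, P t.
Proof.
move=> H; fix IH 1 => -[i p ts]; apply: H.
by elim: ts => [|t ts IHts]; [|split; [exact: IH|exact: IHts]].
Qed.

Variable lt : I -> I -> bool.

Fixpoint vld (i : I) (t : nm I) : bool :=
  match t with
  | Nm j p ts => [&& lt j i, wsc (size ts).+1 p & all (vld j) ts]
  end.

Fixpoint nval (h : I -> ens) (t : nm I) : ens :=
  match t with
  | Nm i p ts => sep (L (h i)) p [seq nval h u | u <- ts]
  end.

Lemma vldE i t : vld i t =
  [&& lt (nix t) i, wsc (size (npar t)).+1 (nfm t) & all (vld (nix t)) (npar t)].
Proof. by case: t. Qed.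

Lemma vld_lt i j t : lt (nix t) j -> vld i t -> vld j t.
Proof. by case: t => k p ts /= kj /and3P [_ -> ->]; rewrite kj. Qed.

Lemma valE h t x : ens_in x (nval h t) <->
  ens_in x (L (h (nix t))) /\ usat (L (h (nix t))) (x :: map (nval h) (npar t)) (nfm t).
Proof. by case: t => i p ts; rewrite /= sepE. Qed.

End NameTypes.

Fixpoint nmap (I J : Type) (f : I -> J) (t : nm I) : nm J :=
  match t with Nm i p ts => Nm (f i) p [seq nmap f u | u <- ts] end.

Lemma val_nmap (I J : Type) (f : I -> J) (h : J -> ens) t :
  nval h (nmap f t) = nval (h \o f) t.
Proof.
elim/nm_indF: t => i p ts IH /=; congr sep; rewrite -map_comp.
by elim: ts IH => //= t ts IHts [-> /IHts ->].
Qed.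

Lemma vld_nmap (I J : Type) (lt : J -> J -> bool) (f : I -> J) i t :
  vld lt (f i) (nmap f t) = vld (fun x y => lt (f x) (f y)) i t.
Proof.
elim/nm_indF: t i => j p ts IH i /=; rewrite size_map all_map.
congr [&& _, _ & _]; elim: ts IH => //= t ts IHts [IHt /IHts ->].
by rewrite IHt.
Qed.

Fixpoint nm_enc (t : nm nat) : GenTree.tree nat :=
  match t with
  | Nm i p ts => GenTree.Node (pickle (i, p)) [seq nm_enc u | u <- ts]
  end.

Fixpoint nm_dec (t : GenTree.tree nat) : nm nat :=
  match t with
  | GenTree.Node n ts =>
      let: (i, p) := odflt (0, UEq 0 0) (unpickle n) in
      Nm i p [seq nm_dec u | u <- ts]
  | GenTree.Leaf _ => Nm 0 (UEq 0 0) [::]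
  end.

Lemma nm_encK : cancel nm_enc nm_dec.
Proof.
elim/nm_indF=> i p ts IH; rewrite /= pickleK /=; congr Nm.
by rewrite -map_comp; elim: ts IH => //= t ts IHts [-> /IHts ->].
Qed.

HB.instance Definition _ := Countable.copy (nm nat) (can_type nm_encK).

(** * Truth tables along a weak order *)

Section Tables.
Variables (lt : nat -> nat -> bool).
Variables (eq : nm nat -> nm nat -> Prop) (sat : nat -> uf -> seq (nm nat) -> Prop).

Definition nm0 : nm nat := Nm 0 (UEq 0 0) [::].

(** Membership read off the defining formula, which makes sense only for names valid at the stage of
    [t]; [tmem] extends it to all names through [eq]. *)
Definition dmem (v t : nm nat) : Prop :=
  vld lt (nix t) v /\ sat (nix t) (nfm t) (v :: npar t).

Definition tmem (v t : nm nat) : Prop := exists v', dmem v' t /\ eq v' v.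

Definition eq_step (t u : nm nat) : Prop :=
  (forall v, dmem v t -> tmem v u) /\ (forall v, dmem v u -> tmem v t).

Definition sat_step (i : nat) (p : uf) (ts : seq (nm nat)) : Prop :=
  match p with
  | UIn k l => tmem (nth nm0 ts k) (nth nm0 ts l)
  | UEq k l => eq (nth nm0 ts k) (nth nm0 ts l)
  | UNot p => ~ sat i p ts
  | UAnd p q => sat i p ts /\ sat i q ts
  | UEx p => exists t, vld lt i t /\ sat i p (t :: ts)
  end.

(** A fixed-point equation: as a condition on the tables it involves only number quantifiers, so it
    is Borel, and over a well-founded order it has one solution on valid names. *)
Definition truth_table : Prop :=
  (forall i t u, vld lt i t -> vld lt i u -> (eq t u <-> eq_step t u)) /\
  (forall i p ts, wsc (size ts) p -> all (vld lt i) ts ->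
     (sat i p ts <-> sat_step i p ts)).

(** Zermelo numerals, n+1 = {n}, as the table sees them. *)
Fixpoint isnum (n : nat) (t : nm nat) : Prop :=
  if n is m.+1 then
    exists v, [/\ dmem v t, isnum m v & forall v', dmem v' t -> eq v' v]
  else forall v, ~ dmem v t.

Definition treal (t : nm nat) (n : nat) : Prop := exists v, dmem v t /\ isnum n v.

End Tables.

(** Ties are allowed because the enumerations of ordinals that codes come from may repeat values. *)
Definition weak_order (lt : nat -> nat -> bool) : Prop :=
  (forall i j k, lt i j -> lt j k -> lt i k) /\
  (forall i j k, lt i j -> lt i k || lt k j).

Section TableUniqueness.
Variables (lt : nat -> nat -> bool).
Hypotheses (lt_wo : weak_order lt) (lt_wf : well_founded (fun i j => lt i j)).
Variables (eq eq' : nm nat -> nm nat -> Prop).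
Variables (sat sat' : nat -> uf -> seq (nm nat) -> Prop).
Hypotheses (H : truth_table lt eq sat) (H' : truth_table lt eq' sat').

Lemma vld_mono i j t : lt i j -> vld lt i t -> vld lt j t.
Proof.
move=> ij vt; apply: vld_lt (vt); move: vt; rewrite vldE => /andP [ti _].
exact: (lt_wo.1 _ _ _ ti ij).
Qed.

(** Induction on the stage. Equality at [i] reduces by [eq_step] to memberships of names from lower
    stages; membership at [i] then follows from equality, and satisfaction follows by induction on
    the formula. *)
Lemma truth_table_unique i :
  (forall t u, vld lt i t -> vld lt i u -> (eq t u <-> eq' t u)) /\
  (forall p ts, wsc (size ts) p -> all (vld lt i) ts ->
     (sat i p ts <-> sat' i p ts)).
Proof.
elim/(well_founded_ind lt_wf): i => i IH.
have D v t : vld lt i t -> dmem lt sat v t <-> dmem lt sat' v t.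
  rewrite vldE => /and3P [ti wt vt].
  have E : vld lt (nix t) v ->
      (sat (nix t) (nfm t) (v :: npar t) <-> sat' (nix t) (nfm t) (v :: npar t)).
    by move=> vv; apply: (IH _ ti).2 => //=; rewrite vv.
  by split=> -[vv /(E vv) h]; split.
(* The elements of [t] are valid at [nix t] and [v] at [j1]; comparing these two indices gives a
   single stage below [i] where both are valid, and the induction hypothesis applies there. *)
have M j1 v t : lt j1 i -> vld lt j1 v -> vld lt i t ->
    tmem lt eq sat v t <-> tmem lt eq' sat' v t.
  move=> j1i vv vt; have ti : lt (nix t) i by move: vt; rewrite vldE => /andP [].
  have E v' : dmem lt sat v' t -> (eq v' v <-> eq' v' v).
    case=> vv' _; have [lt12|nlt] := boolP (lt j1 (nix t)).
      by apply: (IH _ ti).1 => //; exact: vld_mono lt12 vv.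
    apply: (IH _ j1i).1 => //; apply: vld_lt (vv').
    have : lt (nix v') (nix t) by move: vv'; rewrite vldE => /andP [].
    by move=> /(lt_wo.2 _ _ j1); rewrite (negbTE nlt) orbF.
  split=> -[v' [d e]]; exists v'; split.
  - exact/D.
  - exact/E.
  - exact/D.
  - by apply/E => //; exact/D.
have EQ t u : vld lt i t -> vld lt i u -> (eq t u <-> eq' t u).
  move=> vt vu; rewrite (H.1 i) // (H'.1 i) //.
  have ti : lt (nix t) i by move: vt; rewrite vldE => /andP [].
  have ui : lt (nix u) i by move: vu; rewrite vldE => /andP [].
  split=> -[h1 h2]; split=> v dv.
  - by apply/(M (nix t)) => //; [case: dv|apply: h1; exact/D].
  - by apply/(M (nix u)) => //; [case: dv|apply: h2; exact/D].
  - by apply/(M (nix t)) => //; [case: dv|apply: h1; exact/D].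
  - by apply/(M (nix u)) => //; [case: dv|apply: h2; exact/D].
(* As in [M], but [v] is valid only at [i] itself, where equality has just been settled. *)
have MM v t : vld lt i v -> vld lt i t ->
    tmem lt eq sat v t <-> tmem lt eq' sat' v t.
  move=> vv vt; have ti : lt (nix t) i by move: vt; rewrite vldE => /andP [].
  have E v' : dmem lt sat v' t -> (eq v' v <-> eq' v' v).
    by case=> vv' _; apply: EQ => //; exact: vld_mono ti vv'.
  split=> -[v' [d e]]; exists v'; split.
  - exact/D.
  - exact/E.
  - exact/D.
  - by apply/E => //; exact/D.
split=> // p; elim: p => [k l|k l|p IHp|p IHp q IHq|p IHp] ts wp vts;
  rewrite H.2 // H'.2 //=; move: wp => /=.
- by case/andP=> hk hl; apply: MM; apply: (all_nthP _ vts).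
- by case/andP=> hk hl; apply: EQ; apply: (all_nthP _ vts).
- by move=> wp; rewrite IHp.
- by case/andP=> wp wq; rewrite IHp // IHq.
- move=> wp; have E t : vld lt i t -> (sat i p (t :: ts) <-> sat' i p (t :: ts)).
    by move=> vt; apply: IHp => //=; rewrite vt.
  by split=> -[t [vt /(E t vt)]]; exists t.
Qed.

Lemma treal_unique i t n : vld lt i t -> treal lt eq sat t n <-> treal lt eq' sat' t n.
Proof.
have D v u j : vld lt j u -> dmem lt sat v u <-> dmem lt sat' v u.
  rewrite vldE => /and3P [ui wu vu].
  have E : vld lt (nix u) v ->
      (sat (nix u) (nfm u) (v :: npar u) <-> sat' (nix u) (nfm u) (v :: npar u)).
    by move=> vv; apply: (truth_table_unique _).2 => //=; rewrite vv.
  by split=> -[vv /(E vv) h]; split.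
have N m u j : vld lt j u -> isnum lt eq sat m u <-> isnum lt eq' sat' m u.
  elim: m u j => [|m IH] u j vu /=.
    by split=> h v /(D _ _ _ vu); exact: h.
  split=> -[v [dv nv ev]]; exists v.
    have vv : vld lt (nix u) v by case: dv.
    split; [exact/(D _ _ _ vu)|exact/(IH _ _ vv)|].
    move=> v' /(D _ _ _ vu) dv'; apply/(truth_table_unique (nix u)).1 => //.
      by case: dv'.
    exact: ev.
  have vv : vld lt (nix u) v by case: dv.
  split; [exact/(D _ _ _ vu)|exact/(IH _ _ vv)|].
  move=> v' /(D _ _ _ vu) dv'; apply/(truth_table_unique (nix u)).1 => //.
    by case: dv'.
  exact: ev.
move=> vt; split=> -[v [dv nv]]; exists v.
  by split; [exact/(D _ _ _ vt)|apply/(N _ _ (nix t)); case: dv].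
by split; [exact/(D _ _ _ vt)|apply/(N _ _ (nix t)); case: dv].
Qed.

End TableUniqueness.

(** * Values of names and Skolem closure *)

Fixpoint num (n : nat) : ens :=
  if n is m.+1 then @Sup unit (fun _ => num m) else ens0.

Lemma num0E x : ~ ens_in x (num 0).
Proof. by case=> -[]. Qed.

Lemma numSE n x : ens_in x (num n.+1) <-> ens_eq x (num n).
Proof. by split=> [[[] //]|h]; exists tt. Qed.

Lemma num_inj n m : ens_eq (num n) (num m) -> n = m.
Proof.
elim: n m => [|n IH] [|m] // e.
- have : ens_in (num m) (num 0).
    by apply: (ens_in_eqr (ens_eq_sym e)); apply/numSE; exact: ens_eq_refl.
  by move/num0E.
- have : ens_in (num n) (num 0).
    by apply: (ens_in_eqr e); apply/numSE; exact: ens_eq_refl.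
  by move/num0E.
- congr _.+1; apply: IH; apply/numSE; apply: (ens_in_eqr e).
  by apply/numSE; exact: ens_eq_refl.
Qed.

Definition hlt (I : Type) (h : I -> ens) (i j : I) : bool := `[< ens_in (h i) (h j) >].

Lemma val_in (I : Type) (h : I -> ens) i t : vld (hlt h) i t -> ens_in (nval h t) (L (h i)).
Proof.
elim/nm_indF: t i => j p ts IH i /= /and3P [/asboolP ji wp vts].
apply/LE; exists (h j); split=> //; apply/DefE; exists p, (map (nval h) ts); split.
- by rewrite size_map.
- move=> k; rewrite size_map; elim: ts IH k vts {wp} => //= t ts IHts [IHt IH].
  by move=> [|k] /andP [vt vts] kt /=; [exact: IHt|exact: IHts].
- exact: ens_eq_refl.
Qed.

Lemma val_onto (I : Type) (h : I -> ens) :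
  (forall i x, ens_in x (h i) -> exists j, ens_eq x (h j)) ->
  forall i x, ens_in x (L (h i)) -> exists t, vld (hlt h) i t /\ ens_eq x (nval h t).
Proof.
move=> hh i; move: {2}(h i) (ens_eq_refl (h i)) => y; elim/ens_in_ind: y i.
move=> y IH i iy x /LE [b [bi /DefE [p [ps [wp psb xs]]]]].
have [j bj] := hh i b bi.
have yb : ens_in b y by exact: ens_in_eqr bi.
have /choice [f hf] : forall k : 'I_(size ps), exists t,
    vld (hlt h) j t /\ ens_eq (nth ens0 ps k) (nval h t).
  move=> k; apply: (IH b yb j (ens_eq_sym bj)).
  exact: ens_in_eqr (L_eq bj) (psb k (ltn_ord k)).
pose ts := [seq f k | k <- enum 'I_(size ps)].
have sts : size ts = size ps by rewrite size_map size_enum_ord.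
exists (Nm j p ts); split.
  rewrite /= sts wp; apply/and3P; split=> //.
    by apply/asboolP; exact: ens_in_eql bj bi.
  by rewrite all_map; apply/allP => k _ /=; have [] := hf k.
apply: ens_eq_trans xs _; apply: sep_eq; first exact: L_eq.
move=> k; have [kn|kn] := ltnP k (size ps); last first.
  have -> : nth ens0 (map (nval h) ts) k = ens0 by rewrite nth_default // size_map sts.
  by rewrite nth_default //; exact: ens_eq_refl.
rewrite -map_comp (nth_map (Ordinal kn)) ?size_enum_ord //.
by rewrite (nth_ord_enum (Ordinal kn) (Ordinal kn)); have [] := hf (Ordinal kn).
Qed.

(** One key for each kind of witness: a constant, a solution of a formula with named parameters, a
    new name at the given stage for an already named set, and elements of one named set that refute
    its inclusion in another or its being a given singleton. *)
Definition key := ((nat + uf * seq (nm nat)) + nm nat * option (bool * nm nat))%type.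

(* The predicates for which a countable hull needs Skolem witnesses. *)
Definition kpred (X : nat -> ens) (h : nat -> ens) (i : nat) (k : key) (x : ens) : Prop :=
  match k with
  | inl (inl n) => ens_eq x (X n)
  | inl (inr (p, ts)) => usat (L (h i)) (x :: map (nval h) ts) p
  | inr (a, None) => ens_eq x (nval h a)
  | inr (a, Some (true, b)) => ens_in x (nval h a) /\ ~ ens_in x (nval h b)
  | inr (a, Some (false, b)) => ens_in x (nval h a) /\ ~ ens_eq x (nval h b)
  end.

Lemma kpred_eq X h i k x y : ens_eq x y -> kpred X h i k x -> kpred X h i k y.
Proof.
move=> xy; case: k => [[n|[p ts]]|[a [[[] b]|]]] /=.
- exact: ens_eq_trans (ens_eq_sym xy).
- suff E : usat (L (h i)) (x :: map (nval h) ts) p <->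
      usat (L (h i)) (y :: map (nval h) ts) p by move/E.
  by apply: usat_eq => [|[|k]] //=; exact: ens_eq_refl.
- case=> h1 h2; split; first exact: ens_in_eql xy h1.
  by move=> h3; apply: h2; exact: ens_in_eql (ens_eq_sym xy) h3.
- case=> h1 h2; split; first exact: ens_in_eql xy h1.
  by move=> h3; apply: h2; exact: ens_eq_trans xy h3.
- exact: ens_eq_trans (ens_eq_sym xy).
Qed.

Definition skolem (X h : nat -> ens) : Prop := forall i k,
  (exists x, ens_in x (L (h i)) /\ kpred X h i k x) ->
  exists t, vld (hlt h) i t /\ kpred X h i k (nval h t).

(** [skolem] sequences have two sources, full enumerations here and countable hulls in
    [skolem_hull]; the table facts below serve both. *)
Lemma skolem_onto X (h : nat -> ens) :
  (forall i x, ens_in x (h i) -> exists j, ens_eq x (h j)) -> skolem X h.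
Proof.
move=> hh i k [x [xi kx]]; have [t [vt xt]] := val_onto hh xi.
by exists t; split=> //; exact: kpred_eq xt kx.
Qed.

Definition heq (h : nat -> ens) t u := ens_eq (nval h t) (nval h u).
Definition hsat (h : nat -> ens) i p (ts : seq (nm nat)) :=
  usat (L (h i)) (map (nval h) ts) p.

Section Skolem.
Variables (X h : nat -> ens).
Hypotheses (sk : skolem X h) (XE : forall n, X n.+1 = num n).

Lemma hdmem v t : dmem (hlt h) (hsat h) v t <->
  vld (hlt h) (nix t) v /\ ens_in (nval h v) (nval h t).
Proof.
by split=> -[vv d]; split=> //; [apply/valE; split=> //; exact: val_in vv|];
  move/valE: d => [].
Qed.

Lemma htmem v t : ens_in (nval h v) (nval h t) <-> tmem (hlt h) (heq h) (hsat h) v t.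
Proof.
split=> [vt|[v' [/hdmem [_ d] e]]]; last exact: ens_in_eql e d.
have [v' [vv' e]] := @sk (nix t) (inr (v, None))
  (ex_intro _ _ (conj ((valE _ _ _).1 vt).1 (ens_eq_refl _))).
exists v'; split=> //; apply/hdmem; split=> //.
exact: ens_in_eql (ens_eq_sym e) vt.
Qed.

Lemma nth_val ts k : (k < size ts)%N -> nth ens0 (map (nval h) ts) k = nval h (nth nm0 ts k).
Proof. by move=> kt; rewrite (nth_map nm0). Qed.

(** The Tarski-Vaught criterion: quantifiers over the sets of a stage become quantifiers over names,
    and [skolem] names the witnesses, both for [UEx] and for failures of extensionality. *)
Lemma htable : truth_table (hlt h) (heq h) (hsat h).
Proof.
split=> [i t u vt vu|i p ts wp vts].
  split=> [e|[h1 h2]].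
    split=> v /hdmem [_ d]; apply/htmem; first exact: ens_in_eqr e d.
    exact: ens_in_eqr (ens_eq_sym e) d.
  have S a b : (forall v, dmem (hlt h) (hsat h) v a -> tmem (hlt h) (heq h) (hsat h) v b) ->
      forall x, ens_in x (nval h a) -> ens_in x (nval h b).
    move=> H x xa; apply: contrapT => nxb.
    have [v [vv [va nvb]]] := @sk (nix a) (inr (a, Some (true, b)))
      (ex_intro _ _ (conj ((valE _ _ _).1 xa).1 (conj xa nxb))).
    by apply: nvb; apply/htmem; apply: H; exact/hdmem.
  by apply: ens_ext => x; split; exact: S.
case: p wp => [k l|k l|p|p q|p] //=.
- by case/andP=> kt lt; rewrite /hsat /= !nth_val // htmem.
- by case/andP=> kt lt; rewrite /hsat /= !nth_val.
- move=> wp; split=> [ex|[t [vt ht]]]; last by exists (nval h t); split=> //; exact: val_in.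
  exact: (@sk i (inl (inr (p, ts))) ex).
Qed.

Lemma hisnum n t : isnum (hlt h) (heq h) (hsat h) n t <-> ens_eq (nval h t) (num n).
Proof.
elim: n t => [|n IH] t /=.
  split=> [no|e v /hdmem [_ vt]]; last by case: (num0E (ens_in_eqr e vt)).
  apply: ens_ext => x; split=> [xt|/num0E //]; exfalso.
  have [v [vv vt]] := @sk (nix t) (inl (inr (nfm t, npar t)))
    (ex_intro _ x ((valE _ _ _).1 xt)).
  exact: no v (conj vv vt).
split=> [[v [/hdmem [vv vt] /IH nv all_v]]|e].
  apply: ens_ext => x; rewrite numSE; split=> [xt|xn]; last first.
    exact: ens_in_eql (ens_eq_trans nv (ens_eq_sym xn)) vt.
  apply: contrapT => nxn.
  have [v' [vv' [vt' nv']]] := @sk (nix t) (inr (t, Some (false, v)))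
    (ex_intro _ x (conj ((valE _ _ _).1 xt).1
      (conj xt (fun e => nxn (ens_eq_trans e nv))))).
  by apply: nv'; apply: all_v; exact/hdmem.
have nt : ens_in (num n) (nval h t).
  by apply: (ens_in_eqr (ens_eq_sym e)); apply/numSE; exact: ens_eq_refl.
(* Constants for numerals are shifted by one: position 0 of [X] is kept for the set to be
   condensed. *)
have [v [vv vn]] := @sk (nix t) (inl (inl n.+1))
  (ex_intro _ (num n) (conj ((valE _ _ _).1 nt).1
    (eq_rect_r (ens_eq (num n)) (ens_eq_refl _) (XE n)))).
rewrite /= XE in vn.
exists v; split; [|exact/IH|].
  by apply/hdmem; split=> //; exact: ens_in_eql (ens_eq_sym vn) nt.
move=> v' /hdmem [_ /(ens_in_eqr e) /numSE e'].
exact: ens_eq_trans e' (ens_eq_sym vn).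
Qed.

Lemma htreal t n : treal (hlt h) (heq h) (hsat h) t n <-> ens_in (num n) (nval h t).
Proof.
split=> [[v [/hdmem [_ vt] /hisnum e]]|nt]; first exact: ens_in_eql e vt.
have [v [vv vn]] := @sk (nix t) (inl (inl n.+1))
  (ex_intro _ (num n) (conj ((valE _ _ _).1 nt).1
    (eq_rect_r (ens_eq (num n)) (ens_eq_refl _) (XE n)))).
rewrite /= XE in vn.
exists v; split; last exact/hisnum.
by apply/hdmem; split=> //; exact: ens_in_eql (ens_eq_sym vn) nt.
Qed.

End Skolem.

(** * Ranks of well-founded weak orders *)

Lemma hlt_weak_order (h : nat -> ens) :
  (forall i, ens_ordinal (h i)) -> weak_order (hlt h).
Proof.
move=> ho; split=> [i j k /asboolP ij /asboolP jk|i j k /asboolP ij].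
  by apply/asboolP; exact: ord_trans ij jk.
have [jk|jk|kj] := ord_trich (ho j) (ho k).
- by apply/orP; left; apply/asboolP; exact: ord_trans ij jk.
- by apply/orP; left; apply/asboolP; exact: ens_in_eqr jk ij.
- by apply/orP; right; exact/asboolP.
Qed.

Lemma hlt_wf (I : Type) (h : I -> ens) : well_founded (fun i j => hlt h i j).
Proof.
move=> i; move: {2}(h i) (ens_eq_refl (h i)) => y; elim/ens_in_ind: y i.
move=> y IH i iy; constructor=> j /asboolP ji.
by apply: (IH (h j)); [exact: ens_in_eqr ji|exact: ens_eq_refl].
Qed.

(** [o] is the Mostowski collapse of [lt]. *)
Definition ranks (lt : nat -> nat -> bool) (o : nat -> ens) : Prop :=
  forall i x, ens_in x (o i) <-> exists j, lt j i /\ ens_eq x (o j).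

Lemma ranks_ex (lt : nat -> nat -> bool) : well_founded (fun i j => lt i j) -> exists o, ranks lt o.
Proof.
move=> wf.
pose F i (rec : forall j, lt j i -> ens) : ens :=
  @Sup {j | lt j i} (fun j => rec (sval j) (svalP j)).
exists (Fix wf (fun _ => ens) F) => i x; rewrite Fix_eq; last first.
  by move=> k f g fg; congr F; apply: functional_extensionality_dep => j;
    apply: functional_extensionality_dep => p; exact: fg.
split=> [[[j ji] /= xj]|[j [ji xj]]]; first by exists j.
by exists (exist _ j ji).
Qed.

Section Ranks.
Variables (lt : nat -> nat -> bool) (o : nat -> ens).
Hypotheses (wo : weak_order lt) (wf : well_founded (fun i j => lt i j)) (ro : ranks lt o).

Lemma ranks_ord i : ens_ordinal (o i).
Proof.
have tr j : ens_trans (o j).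
  move=> y z /ro [k [kj yk]] /(ens_in_eqr yk) /ro [l [lk zl]].
  by apply/ro; exists l; split=> //; exact: (wo.1 _ _ _ lk kj).
split=> // y /ro [k [_ yk]] a b /(ens_in_eqr yk) ak ba.
by apply: (ens_in_eqr (ens_eq_sym yk)); exact: tr ak ba.
Qed.

Lemma ranks_lt i j : lt i j = hlt o i j.
Proof.
apply/idP/asboolP => [ij|/ro [k [kj ik]]].
  by apply/ro; exists i; split=> //; exact: ens_eq_refl.
have /orP [ki|//] := wo.2 _ _ i kj.
have : ens_in (o k) (o i) by apply/ro; exists k; split=> //; exact: ens_eq_refl.
by move/(ens_in_eql (ens_eq_sym ik))/ens_in_irr.
Qed.

Lemma ranks_hlt : lt = hlt o.
Proof. by apply/funext => i; apply/funext => j; exact: ranks_lt. Qed.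

Lemma ranks_onto i x : ens_in x (o i) -> exists j, ens_eq x (o j).
Proof. by case/ro=> j [_ xj]; exists j. Qed.

End Ranks.

(** * Reals of the constructible hierarchy *)

Definition Rl (a : ens) (r : nat -> bool) : Prop :=
  exists x, ens_in x (L a) /\ forall n, r n <-> ens_in (num n) x.

Lemma Rl_eq a b r : ens_eq a b -> Rl a r -> Rl b r.
Proof. by move=> ab [x [xa xr]]; exists x; split=> //; exact: ens_in_eqr (L_eq ab) xa. Qed.

Lemma Rl_mono a b r : ens_ordinal b -> ens_in a b -> Rl a r -> Rl b r.
Proof. by move=> ob ab [x [xa xr]]; exists x; split=> //; exact: L_mono xa. Qed.

Definition numconst n := if n is m.+1 then num m else ens0.

(** The names valued along [o] have a truth table by [htable], and every other table agrees with it
    by uniqueness. So any table, wherever it was computed, tells which reals belong to the stage. *)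
Lemma Rl_table (lt : nat -> nat -> bool) o eq sat i r : weak_order lt -> well_founded (fun i j => lt i j) ->
  ranks lt o -> truth_table lt eq sat ->
  Rl (o i) r <-> exists t, vld lt i t /\ forall n, r n <-> treal lt eq sat t n.
Proof.
move=> wo wf ro tab.
have sk := @skolem_onto numconst o (ranks_onto ro).
have tab' : truth_table lt (heq o) (hsat o).
  by rewrite (ranks_hlt wo ro); exact: (htable sk).
have E t n : vld lt i t -> treal lt eq sat t n <-> ens_in (num n) (nval o t).
  move=> vt; rewrite (treal_unique wo wf tab tab' n vt) (ranks_hlt wo ro).
  exact: (htreal sk (fun n => erefl)).
split=> [[x [xi xr]]|[t [vt tr]]].
  have [t [vt xt]] := val_onto (ranks_onto ro) xi.
  rewrite -(ranks_hlt wo ro) in vt.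
  exists t; split=> // n; rewrite xr E //; split; first exact: ens_in_eqr xt.
  exact: ens_in_eqr (ens_eq_sym xt).
exists (nval o t); split; last by move=> n; rewrite tr E.
by apply: val_in; rewrite -(ranks_hlt wo ro).
Qed.

(** * Condensation *)

Definition cord (a : ens) : Prop :=
  ens_ordinal a /\ exists g : nat -> ens, forall x, ens_in x a -> exists n, ens_eq x (g n).

(** Terms built from one constant and the operations [F n] are finite trees, hence countable;
    evaluating them gives a sequence closed under all operations. *)
Lemma closure_fun (A : Type) (a0 : A) (F : nat -> seq A -> A) (P : A -> Prop) :
  P a0 -> (forall n s, (forall k, P (nth a0 s k)) -> P (F n s)) ->
  exists h : nat -> A, [/\ h 0 = a0, forall n, P (h n) &
    forall n s, exists m, h m = F n (map h s)].
Proof.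
move=> P0 PF.
pose ev := fix ev (t : GenTree.tree nat) : A :=
  match t with GenTree.Leaf _ => a0 | GenTree.Node n ts => F n (map ev ts) end.
pose tr (m : nat) : GenTree.tree nat :=
  if m is k.+1 then odflt (GenTree.Leaf 0) (unpickle k) else GenTree.Leaf 0.
have Pev : forall t, P (ev t).
  fix IH 1 => -[n|n ts] /=; first exact: P0.
  apply: PF => k; elim: ts k => [|t ts IHts] [|k] /=; try exact: P0.
    exact: IH.
  exact: IHts.
exists (ev \o tr); split=> // [n|n s]; first exact: Pev.
exists (pickle (GenTree.Node n (map tr s))).+1.
by rewrite /= pickleK /= -map_comp.
Qed.

(** A strict bound on the indices in a name: it tells how long an initial segment of [h] a finitary
    operation must see in order to evaluate the name. *)
Fixpoint nbound (t : nm nat) : nat :=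
  match t with Nm i _ ts => maxn i.+1 (foldr maxn 0 [seq nbound u | u <- ts]) end.

Definition lbound (ts : seq (nm nat)) := foldr maxn 0 (map nbound ts).

Lemma val_agree (h h' : nat -> ens) N t : (nbound t <= N)%N ->
  (forall i, (i < N)%N -> h i = h' i) -> nval h t = nval h' t.
Proof.
move=> tN hh; elim/nm_indF: t tN => i p ts IH /=.
rewrite geq_max => /andP [iN tN]; rewrite hh //; congr sep.
elim: ts IH tN => //= t ts IHts [IHt /IHts IH]; rewrite geq_max => /andP [tN tsN].
by rewrite IHt // IH.
Qed.

Lemma map_val_agree (h h' : nat -> ens) N ts : (lbound ts <= N)%N ->
  (forall i, (i < N)%N -> h i = h' i) -> map (nval h) ts = map (nval h') ts.
Proof.
move=> tN hh; elim: ts tN => //= t ts IH; rewrite /lbound /= geq_max => /andP [tN tsN].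
by rewrite (val_agree tN hh) IH.
Qed.

Definition kbound (k : key) : nat :=
  match k with
  | inl (inl n) => 0
  | inl (inr (p, ts)) => lbound ts
  | inr (a, None) => nbound a
  | inr (a, Some (_, b)) => maxn (nbound a) (nbound b)
  end.

Lemma kpred_agree X (h h' : nat -> ens) N i k x : (i < N)%N -> (kbound k <= N)%N ->
  (forall i, (i < N)%N -> h i = h' i) -> kpred X h i k x = kpred X h' i k x.
Proof.
move=> iN kN hh; case: k kN => [[n|[p ts]]|[a [[[] b]|]]] //=.
- by move=> tN; rewrite hh // (map_val_agree tN hh).
- by rewrite geq_max => /andP [aN bN]; rewrite (val_agree aN hh) (val_agree bN hh).
- by rewrite geq_max => /andP [aN bN]; rewrite (val_agree aN hh) (val_agree bN hh).
- by move=> aN; rewrite (val_agree aN hh).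
Qed.

(** Lists of positions address every index inside a name, so a hull can absorb them one at a time. A
    position out of range leaves the name unchanged. *)
Fixpoint subname (I : Type) (t : nm I) (s : seq nat) : nm I :=
  if s is k :: s' then subname (nth t (npar t) k) s' else t.

Lemma subname_in a (t : nm ens) s : ens_ordinal a -> vld (hlt id) a t ->
  ens_in (nix (subname t s)) a.
Proof.
elim: s a t => [|k s IH] a t oa vt /=; first by move: vt; rewrite vldE => /andP [/asboolP].
have [kt|kt] := ltnP k (size (npar t)); last by rewrite nth_default //; exact: IH.
move: vt; rewrite vldE => /and3P [/asboolP ta _ vts].
apply: ord_trans (oa) _ (ta); apply: IH; first exact: ord_in ta.
exact: (all_nthP _ vts).
Qed.

Lemma nm_onto (I : Type) (h : nat -> I) (t : nm I) :
  (forall s, exists m, h m = nix (subname t s)) -> exists t', t = nmap h t'.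
Proof.
elim/nm_indF: t => i p ts IH ht.
have [m /= mi] := ht [::].
suff [ts' ->] : exists ts', ts = map (nmap h) ts' by exists (Nm m p ts'); rewrite /= mi.
have {ht} ht k s : (k < size ts)%N -> exists m, h m = nix (subname (nth (Nm i p ts) ts k) s).
  by move=> _; exact: (ht (k :: s)).
move: (Nm i p ts) ht => d; elim: ts IH => [|t ts IHts] /=; first by exists [::].
move=> [IHt IH] ht.
have [t' tE] := IHt (fun s => ht 0 s isT).
have [ts' tsE] := IHts IH (fun k s kt => ht k.+1 s kt).
by exists (t' :: ts'); rewrite tE tsE.
Qed.

(** Löwenheim-Skolem with ordinals as the only elements: witnesses are chosen as names, and the hull
    collects the ordinals that occur in them. *)
Lemma skolem_hull X a : ens_ordinal a ->
  exists h : nat -> ens, [/\ h 0 = a, forall i, ens_ordinal (h i) & skolem X h].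
Proof.
move=> oa.
pose Q i k l t := vld (hlt id) (nth a l i) t /\ kpred X (nth a l) i k (nval id t).
(* [W] is the Skolem function: the numerical parameters of a key are read in the finite list [l],
   its values are names indexed by sets, and a filler is taken when no witness exists. *)
have /choice [W HW] : forall u : nat * key * seq ens, exists t : nm ens,
    let: (i, k, l) := u in
    (exists t, Q i k l t) /\ Q i k l t \/ ~ (exists t, Q i k l t) /\ t = Nm a (UEq 0 0) [::].
  case=> [[i k] l]; have [[t Qt]|no] := pselect (exists t, Q i k l t).
    by exists t; left; split=> //; exists t.
  by exists (Nm a (UEq 0 0) [::]); right.
(* The number [n] packs a stage, a key and an address, so [F] returns one index of the witness at a
   time. *)
pose F n (l : seq ens) : ens :=
  if unpickle n is Some (i, k, s) then nix (subname (W (i, k, l)) s) else a.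
have PF n l : (forall k, nth a l k = a \/ ens_in (nth a l k) a) ->
    F n l = a \/ ens_in (F n l) a.
  move=> Pl; rewrite /F; case: (unpickle n) => [[[i k] s]|]; last by left.
  have [[_ [vW _]]|[_ ->]] := HW (i, k, l); last first.
    by left; elim: s => //= m s IH; rewrite nth_nil.
  have oi : ens_ordinal (nth a l i) by case: (Pl i) => [->|/(ord_in oa)].
  have := subname_in s oi vW; right.
  case: (Pl i) => [<- //|ia]; exact: ord_trans ia.
have [h [h0 hP hF]] := @closure_fun ens a F (fun x => x = a \/ ens_in x a)
  (or_introl erefl) PF.
exists h; split=> //.
  by move=> i; case: (hP i) => [->|/(ord_in oa)].
move=> i k [x [xi kx]].
pose N := maxn i.+1 (kbound k).
pose l := map h (iota 0 N).
have lh j : (j < N)%N -> nth a l j = h j.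
  by move=> jN; rewrite (nth_map 0) ?size_iota // nth_iota.
have iN : (i < N)%N by rewrite leq_max leqnn.
have kN : (kbound k <= N)%N by rewrite leq_max leqnn orbT.
have exQ : exists t, Q i k l t.
  (* Over [id] every set may serve as an index, so names exhaust the stage. *)
  have [t [vt xt]] := @val_onto ens id (fun _ y _ => ex_intro _ y (ens_eq_refl y)) (h i) x xi.
  exists t; split; rewrite ?lh // (kpred_agree X (nval id t) iN kN lh).
  exact: kpred_eq xt kx.
have [[_ [vW kW]]|[/(_ exQ) //]] := HW (i, k, l).
have [|t tE] := @nm_onto _ h (W (i, k, l)).
  move=> s; have [m hm] := hF (pickle (i, k, s)) (iota 0 N).
  by exists m; rewrite hm /F pickleK.
rewrite (kpred_agree X _ iN kN lh) lh // tE in vW kW.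
exists t; split.
  by move: vW; rewrite (vld_nmap (hlt id) h).
by move: kW; rewrite val_nmap.
Qed.

Lemma condensation (VL : V_eq_L) (r : nat -> bool) : exists a, cord a /\ Rl a r.
Proof.
pose x0 : ens := @Sup {n | r n} (fun n => num (sval n)).
have x0E n : r n <-> ens_in (num n) x0.
  split=> [rn|[[m rm] /= /num_inj -> //]].
  by exists (exist _ n rn); exact: ens_eq_refl.
have [a [oa x0a]] := VL x0.
pose X n := if n is m.+1 then num m else x0.
have [h [h0 ho sk]] := skolem_hull X oa.
have lt_wo := hlt_weak_order ho.
have lt_wf := @hlt_wf _ h.
have [ o ro] := ranks_ex lt_wf.
exists (o 0); split.
  split; first exact: (ranks_ord lt_wo ro).
  by exists o => x /(ranks_onto ro).
(* The table of the hull was computed in L_a, but it is a truth table on the order of the hull, so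
   it also describes the stage of the collapsed ordinal [o 0]. *)
apply/(Rl_table 0 r lt_wo lt_wf ro (htable sk)).
have [t [vt tx]] := @sk 0 (inl (inl 0)) (ex_intro _ x0 (conj (eq_rect_r (fun b => ens_in x0 (L b)) x0a h0) (ens_eq_refl _))).
exists t; split=> // n; rewrite (htreal sk) // x0E.
by split; apply: ens_in_eqr => //; exact: ens_eq_sym.
Qed.

(** * Souslin sets of reals *)

Notation real := (nat -> bool).

Definition agree (A : Type) (k : nat) (x y : nat -> A) := forall i, (i < k)%N -> x i = y i.

Lemma agreeW (A : Type) k l (x y : nat -> A) : (k <= l)%N -> agree l x y -> agree k x y.
Proof. by move=> kl xy i ik; apply: xy; exact: leq_trans kl. Qed.

Definition cont (A B : Type) (f : (nat -> A) -> (nat -> B)) :=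
  forall x k, exists l, forall y, agree l x y -> agree k (f x) (f y).

Lemma cont_comp (A B C : Type) (f : (nat -> B) -> (nat -> C)) (g : (nat -> A) -> (nat -> B)) :
  cont f -> cont g -> cont (f \o g).
Proof.
move=> cf cg x k; have [l hl] := cf (g x) k; have [m hm] := cg x l.
by exists m => y /hm /hl.
Qed.

Lemma nat_bound (f : nat -> nat) k : exists K, forall j, (j < k)%N -> (f j < K)%N.
Proof.
elim: k => [|k [K hK]]; first by exists 0.
exists (maxn K (f k).+1) => j; rewrite ltnS leq_eqVlt => /orP [/eqP ->|/hK h].
  by rewrite leq_max leqnn orbT.
by rewrite leq_max h.
Qed.

Lemma cont_reindex (A : Type) (f : nat -> nat) : cont (fun (x : nat -> A) n => x (f n)).
Proof.
by move=> x k; have [K hK] := nat_bound f k; exists K => y xy i /hK; exact: xy.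
Qed.

Definition closed2 (F : real -> (nat -> nat) -> Prop) : Prop := forall c w,
  (forall k, exists c' w', [/\ F c' w', agree k c c' & agree k w w']) -> F c w.

Definition Sou (A : real -> Prop) : Prop :=
  exists2 F, closed2 F & forall c, A c <-> exists w, F c w.

Lemma Sou_ext A B : (forall c, A c <-> B c) -> Sou A -> Sou B.
Proof. by move=> AB [F cF hF]; exists F => // c; rewrite -AB. Qed.

Lemma Sou_const (P : Prop) : Sou (fun=> P).
Proof.
exists (fun _ _ => P); first by move=> c w /(_ 0) [c' [w' []]].
by move=> c; split=> [p|[]] //; exists id.
Qed.

Lemma Sou_bit n b : Sou (fun c => c n = b).
Proof.
exists (fun c _ => c n = b); last by move=> c; split=> [p|[]] //; exists id.
by move=> c w /(_ n.+1) [c' [w' [<- /(_ n)-> //]]].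
Qed.

Lemma Sou_preim f A : cont f -> Sou A -> Sou (fun c => A (f c)).
Proof.
move=> cf [F cF hF]; exists (fun c w => F (f c) w) => // c w hk.
apply: cF => k; have [l hl] := cf c k.
have [c' [w' [Fc cc ww]]] := hk (maxn k l); exists (f c'), w'; split=> //.
  by apply: hl; exact: agreeW (leq_maxr k l) cc.
exact: agreeW (leq_maxl k l) ww.
Qed.

Lemma Sou_ex_nat (A : nat -> real -> Prop) :
  (forall n, Sou (A n)) -> Sou (fun c => exists n, A n c).
Proof.
move=> sA; have /choice [F hF] : forall n, exists F, closed2 F /\ forall c, A n c <-> exists w, F c w.
  by move=> n; have [F cF ?] := sA n; exists F.
exists (fun c w => F (w 0) c (fun k => w k.+1)).
  move=> c w hk; apply: (hF (w 0)).1 => k.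
  have [c' [w' [Fc cc ww]]] := hk k.+1; exists c', (fun k => w' k.+1); split.
  - by rewrite ww.
  - exact: agreeW (leqnSn k) cc.
  - by move=> i ik; apply: ww.
move=> c; split=> [[n /((hF n).2 c) [w Fw]]|[w Fw]].
  by exists (fun k => if k is l.+1 then w l else n).
by exists (w 0); apply/((hF _).2 c); exists (fun k => w k.+1).
Qed.

Lemma Sou_all_nat (A : nat -> real -> Prop) :
  (forall n, Sou (A n)) -> Sou (fun c => forall n, A n c).
Proof.
move=> sA; have /choice [F hF] : forall n, exists F, closed2 F /\ forall c, A n c <-> exists w, F c w.
  by move=> n; have [F cF ?] := sA n; exists F.
exists (fun c w => forall n, F n c (fun k => w (pickle (n, k)))).
  move=> c w hk n; apply: (hF n).1 => k.
  have [l hl] := cont_reindex (fun k => pickle (n, k)) w k.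
  have [c' [w' [Fc cc ww]]] := hk (maxn k l).
  exists c', (fun k => w' (pickle (n, k))); split; first exact: Fc.
    exact: agreeW (leq_maxl k l) cc.
  by apply: hl; exact: agreeW (leq_maxr k l) ww.
move=> c; split=> [h|[w Fw] n]; last by apply/((hF _).2 c); eexists; exact: Fw.
have /choice [w hw] : forall n, exists w, F n c w by move=> n; apply/((hF n).2 c).
exists (fun m => if unpickle m is Some (n, k) then w n k else 0) => n.
suff -> : (fun k => if unpickle (pickle (n, k)) is Some (n, k) then w n k else 0) = w n by [].
by apply/funext => k; rewrite pickleK.
Qed.

Lemma Sou_ex (K : countType) (A : K -> real -> Prop) :
  (forall x, Sou (A x)) -> Sou (fun c => exists x, A x c).
Proof.
move=> sA; apply: (@Sou_ext (fun c => exists n, if unpickle n is Some x then A x c else False)).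
  move=> c; split=> [[n]|[x Ax]]; first by case: (unpickle n) => // x Ax; exists x.
  by exists (pickle x); rewrite pickleK.
by apply: Sou_ex_nat => n; case: (unpickle n) => [x|]; [exact: sA|exact: Sou_const].
Qed.

Lemma Sou_all (K : countType) (A : K -> real -> Prop) :
  (forall x, Sou (A x)) -> Sou (fun c => forall x, A x c).
Proof.
move=> sA; apply: (@Sou_ext (fun c => forall n, if unpickle n is Some x then A x c else True)).
  move=> c; split=> [h x|h n]; last by case: (unpickle n).
  by have := h (pickle x); rewrite pickleK.
by apply: Sou_all_nat => n; case: (unpickle n) => [x|]; [exact: sA|exact: Sou_const].
Qed.

Lemma Sou_and A B : Sou A -> Sou B -> Sou (fun c => A c /\ B c).
Proof.
move=> sA sB; apply: (@Sou_ext (fun c => forall b : bool, if b then A c else B c)).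
  by move=> c; split=> [h|[a b] []] //; split; [exact: (h true)|exact: (h false)].
by apply: (@Sou_all bool) => -[].
Qed.

Lemma Sou_or A B : Sou A -> Sou B -> Sou (fun c => A c \/ B c).
Proof.
move=> sA sB; apply: (@Sou_ext (fun c => exists b : bool, if b then A c else B c)).
  by move=> c; split=> [[[]]|[h|h]]; [left|right|exists true|exists false].
by apply: (@Sou_ex bool) => -[].
Qed.

Definition pr (a b : real) : real := fun n => if odd n then b n./2 else a n./2.
Definition p1 (p : real) : real := fun n => p n.*2.
Definition p2 (p : real) : real := fun n => p n.*2.+1.

Lemma p1_pr a b : p1 (pr a b) = a.
Proof. by apply/funext => n; rewrite /p1 /pr odd_double doubleK. Qed.

Lemma p2_pr a b : p2 (pr a b) = b.
Proof. by apply/funext => n; rewrite /p2 /pr /= odd_double /= uphalf_double. Qed.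

Lemma cont_p1 : cont p1. Proof. exact: cont_reindex. Qed.
Lemma cont_p2 : cont p2. Proof. exact: (@cont_reindex bool (fun n => n.*2.+1)). Qed.

Lemma agree_pr k a b a' b' : agree k a a' -> agree k b b' -> agree k (pr a b) (pr a' b').
Proof.
move=> aa bb i ik; have ik2 : (i./2 < k)%N.
  apply: leq_ltn_trans ik; rewrite -{2}(half_bit_double i false) add0n.
  by rewrite half_leq // -addnn leq_addr.
by rewrite /pr; case: ifP => _; [exact: bb|exact: aa].
Qed.

Lemma Sou_exr A : Sou A -> Sou (fun a => exists r, A (pr a r)).
Proof.
move=> [F cF hF].
(* Each entry of [w] carries a bit of [r] as its parity and an entry of the old witness as its
   half. *)
exists (fun a w => F (pr a (fun n => odd (w n))) (fun n => (w n)./2)).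
  move=> a w hk; apply: cF => k; have [a' [w' [Fa aa ww]]] := hk k.
  eexists; eexists; split; first exact: Fa.
    by apply: agree_pr => // i ik; rewrite ww.
  by move=> i ik; rewrite ww.
move=> a; split=> [[r /hF [w Fw]]|[w Fw]]; last first.
  by exists (fun n => odd (w n)); apply/hF; eexists; exact: Fw.
exists (fun n => r n + (w n).*2)%N.
have -> : (fun n => odd (r n + (w n).*2)) = r.
  by apply/funext => n; rewrite oddD odd_double addbF oddb.
suff -> : (fun n => (r n + (w n).*2)./2) = w by [].
by apply/funext => n; rewrite half_bit_double.
Qed.

Lemma Sou_exr2 (A : real -> real -> Prop) :
  Sou (fun p => A (p1 p) (p2 p)) -> Sou (fun a => exists r, A a r).
Proof.
by move/Sou_exr; apply: Sou_ext => a; split=> -[r h]; exists r; move: h; rewrite p1_pr p2_pr.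
Qed.

(** Bi-Souslin sets stand in for Borel sets: they are stable under complement and countable
    operations, and either half can be fed into a projection. *)
Definition Del (A : real -> Prop) : Prop := Sou A /\ Sou (fun c => ~ A c).

Lemma Del_ext A B : (forall c, A c <-> B c) -> Del A -> Del B.
Proof.
by move=> AB [a b]; split; [exact: Sou_ext a|apply: Sou_ext b => c; rewrite AB].
Qed.

Lemma Del_const (P : Prop) : Del (fun=> P).
Proof. by split; exact: Sou_const. Qed.

Lemma Del_bit n : Del (fun c => c n).
Proof.
split; first exact: (Sou_bit n true).
by apply: Sou_ext (Sou_bit n false) => c; split=> [->//|/negP/negbTE].
Qed.

Lemma Del_not A : Del A -> Del (fun c => ~ A c).
Proof. by move=> [a b]; split=> //; apply: Sou_ext a => c; rewrite notK. Qed.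

Lemma Del_ex (K : countType) (A : K -> real -> Prop) :
  (forall x, Del (A x)) -> Del (fun c => exists x, A x c).
Proof.
move=> d; split; first by apply: Sou_ex => x; have [] := d x.
apply: (@Sou_ext (fun c => forall x, ~ A x c)).
  by move=> c; split=> [h [x /h]|h x Ax] //; apply: h; exists x.
by apply: Sou_all => x; have [] := d x.
Qed.

Lemma Del_all (K : countType) (A : K -> real -> Prop) :
  (forall x, Del (A x)) -> Del (fun c => forall x, A x c).
Proof.
move=> d; apply: (@Del_ext (fun c => ~ exists x, ~ A x c)).
  move=> c; split=> [h x|h [x]]; last by apply; exact: h.
  by apply: contrapT => nA; apply: h; exists x.
by apply: Del_not; apply: Del_ex => x; exact: Del_not.
Qed.

Lemma Del_and A B : Del A -> Del B -> Del (fun c => A c /\ B c).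
Proof.
move=> [a1 a2] [b1 b2]; split; first exact: Sou_and.
by apply: Sou_ext (Sou_or a2 b2) => c; rewrite not_andE.
Qed.

Lemma Del_or A B : Del A -> Del B -> Del (fun c => A c \/ B c).
Proof.
move=> [a1 a2] [b1 b2]; split; first exact: Sou_or.
by apply: Sou_ext (Sou_and a2 b2) => c; rewrite not_orE.
Qed.

Lemma Del_imp A B : Del A -> Del B -> Del (fun c => A c -> B c).
Proof.
move=> a b; apply: Del_ext (Del_or (Del_not a) b) => c.
by split=> [[]//|h]; have [/h|] := pselect (A c); [right|left].
Qed.

Lemma Del_iff A B : Del A -> Del B -> Del (fun c => A c <-> B c).
Proof. by move=> a b; apply: Del_and; exact: Del_imp. Qed.

Lemma Del_preim f A : cont f -> Del A -> Del (fun c => A (f c)).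
Proof. by move=> cf [a b]; split; [exact: Sou_preim a|exact: (Sou_preim cf b)]. Qed.

(** * A universal family of trees *)

Definition tree (q a : real) (s : seq (bool * nat)) : bool :=
  nilp s || q (pickle (s, mkseq a (size s))).

Definition branch (q a : real) (z : nat -> bool * nat) : Prop :=
  forall k, tree q a (mkseq z k).

(** [q] admits a node and a prefix of [a] when some point of the closed set [F] extends both;
    closedness turns a branch into a point. The first components of a branch display [r], the second
    ones its Souslin witness. *)
Lemma Sou_universal (A : real -> real -> Prop) : Sou (fun p => A (p1 p) (p2 p)) ->
  exists q, forall a r, A a r <-> exists2 z, branch q a z & forall n, (z n).1 = r n.
Proof.
move=> [F cF hF].
pose P (s : seq (bool * nat)) (b : seq bool) := exists a r w, F (pr a r) w /\
  forall i, (i < size s)%N -> [/\ a i = nth false b i, r i = (nth (false, 0) s i).1 &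
    w i = (nth (false, 0) s i).2].
exists (fun m => if unpickle m is Some (s, b) then `[< P s b >] else false) => a r.
split=> [Aar|[z bz zr]].
  have /hF [w Fw] : A (p1 (pr a r)) (p2 (pr a r)) by rewrite p1_pr p2_pr.
  exists (fun n => (r n, w n)) => // k; rewrite /tree pickleK; apply/orP; right; apply/asboolP.
  by exists a, r, w; split=> // i; rewrite size_mkseq => ik; rewrite !nth_mkseq.
have := (hF (pr a r)).2; rewrite p1_pr p2_pr; apply; exists (fun n => (z n).2).
apply: cF => k; have := bz k.+1; rewrite /tree pickleK => /asboolP [a' [r' [w' [Fw h]]]].
rewrite size_mkseq in h; exists (pr a' r'), w'; split=> //.
  apply: agree_pr => i /ltnW ik; have [a1 a2 _] := h i ik.
    by rewrite a1 nth_mkseq.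
  by rewrite a2 nth_mkseq // zr.
by move=> i /ltnW ik; have [_ _ ->] := h i ik; rewrite nth_mkseq.
Qed.

(** * Ranks of trees and of relations *)

Fixpoint rkb (T : seq (bool * nat) -> bool) (a : ens) (s : seq (bool * nat)) : Prop :=
  match a with
  | Sup J h => forall x, T (rcons s x) -> exists i, rkb T (h i) (rcons s x)
  end.

Lemma rkb_eq T a b s : ens_eq a b -> rkb T a s -> rkb T b s.
Proof.
elim: a b s => I h IH [J g] s /= [h1 _] H x /H [i hi].
by have [j ij] := h1 i; exists j; exact: IH ij hi.
Qed.

Lemma rkbE T a s : rkb T a s <->
  forall x, T (rcons s x) -> exists b, ens_in b a /\ rkb T b (rcons s x).
Proof.
case: a => I h; split=> /= H x /H.
  by case=> i hi; exists (h i); split=> //; exact: (ens_in_elt (x := Sup h)).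
by case=> b [[i bi] hb]; exists i; exact: rkb_eq bi hb.
Qed.

(** [isrk lt a k]: the rank of [k] in the relation [lt] is [a]. *)
Fixpoint isrk (lt : nat -> nat -> bool) (a : ens) (k : nat) : Prop :=
  match a with
  | Sup J h => (forall l, lt l k -> exists i, isrk lt (h i) l) /\
               (forall i, exists l, lt l k /\ isrk lt (h i) l)
  end.

Lemma isrk_eq lt a b k : ens_eq a b -> isrk lt a k -> isrk lt b k.
Proof.
elim: a b k => I h IH [J g] k /= [h1 h2] [H1 H2]; split=> [l /H1 [i hi]|j].
  by have [j ij] := h1 i; exists j; exact: IH ij hi.
have [i ij] := h2 j; have [l [lk hl]] := H2 i.
by exists l; split=> //; exact: IH ij hl.
Qed.

Lemma isrkE lt a k : isrk lt a k <->
  (forall l, lt l k -> exists b, ens_in b a /\ isrk lt b l) /\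
  (forall b, ens_in b a -> exists l, lt l k /\ isrk lt b l).
Proof.
case: a => I h; split=> /= -[H1 H2]; split.
- move=> l /H1 [i hi]; exists (h i); split=> //; exact: (ens_in_elt (x := Sup h)).
- move=> b [i bi]; have [l [lk hl]] := H2 i.
  by exists l; split=> //; exact: isrk_eq (ens_eq_sym bi) hl.
- by move=> l /H1 [b [[i bi] hb]]; exists i; exact: isrk_eq bi hb.
- by move=> i; exact: H2 (ens_in_elt (x := Sup h) i).
Qed.

Lemma isrk_acc lt a k : isrk lt a k -> Acc (fun i j => lt i j) k.
Proof.
elim/ens_in_ind: a k => a IH k /isrkE [a1 _]; constructor=> l /a1 [b [ba hb]].
exact: IH hb.
Qed.

Lemma isrk_ranks lt o k : ranks lt o -> isrk lt (o k) k.
Proof.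
move=> ro; move: {2}(o k) (ens_eq_refl (o k)) => y; elim/ens_in_ind: y k.
move=> y IH k ky; apply/isrkE; split=> [l lk|b /ro [l [lk bl]]].
  have lo : ens_in (o l) (o k) by apply/ro; exists l; split=> //; exact: ens_eq_refl.
  exists (o l); split=> //; apply: (IH (o l)); last exact: ens_eq_refl.
  exact: ens_in_eqr ky lo.
exists l; split=> //; apply: isrk_eq (ens_eq_sym bl) _.
apply: (IH (o l)); last exact: ens_eq_refl.
apply: (ens_in_eqr ky); apply/ro; exists l; split=> //; exact: ens_eq_refl.
Qed.

(** When [Q] is itself given by a real, equality of ranks becomes a Borel condition that mentions no
    ordinals. *)
Definition bisim (lt lt' : nat -> nat -> bool) (Q : nat -> nat -> Prop) : Prop :=
  forall i k, Q i k ->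
    (forall j, lt j i -> exists l, lt' l k /\ Q j l) /\
    (forall l, lt' l k -> exists j, lt j i /\ Q j l).

Lemma isrk_bisim lt lt' Q a i k : bisim lt lt' Q -> Q i k -> isrk lt' a k -> isrk lt a i.
Proof.
move=> bs; elim/ens_in_ind: a i k => a IH i k Qik /isrkE [a1 a2].
have [b1 b2] := bs i k Qik; apply/isrkE; split=> [j /b1 [l [lk Ql]]|b ba].
  by have [b [ba hb]] := a1 l lk; exists b; split=> //; exact: IH Ql hb.
have [l [lk hl]] := a2 b ba; have [j [ji Qj]] := b2 l lk.
by exists j; split=> //; exact: IH Qj hl.
Qed.

Lemma bisim_isrk lt lt' : bisim lt lt' (fun i k => exists a, isrk lt a i /\ isrk lt' a k).
Proof.
move=> i k [a [/isrkE [a1 a2] /isrkE [b1 b2]]]; split=> [j /a1|l /b1] [b [ba hb]].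
  by have [l [lk hl]] := b2 b ba; exists l; split=> //; exists b.
by have [j [ji hj]] := a2 b ba; exists j; split=> //; exists b.
Qed.

Definition rrel (r : real) (k l : nat) : bool := r (pickle (k, l)).

Fixpoint rkle (lt : nat -> nat -> bool) (a : ens) (k : nat) : Prop :=
  match a with
  | Sup J h => forall l, lt l k -> exists i, rkle lt (h i) l
  end.

Lemma rkle_eq lt a b k : ens_eq a b -> rkle lt a k -> rkle lt b k.
Proof.
elim: a b k => I h IH [J g] k /= [h1 _] H l /H [i hi].
by have [j ij] := h1 i; exists j; exact: IH ij hi.
Qed.

Lemma rkleE lt a k : rkle lt a k <->
  forall l, lt l k -> exists b, ens_in b a /\ rkle lt b l.
Proof.
case: a => I h; split=> /= H l /H.
  by case=> i hi; exists (h i); split=> //; exact: (ens_in_elt (x := Sup h)).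
by case=> b [[i bi] hb]; exists i; exact: rkle_eq bi hb.
Qed.

Lemma isrk_rkle lt a b k : isrk lt a k -> rkle lt b k -> ~ ens_in b a.
Proof.
elim/ens_in_ind: b a k => b IH a k /isrkE [_ a2] /rkleE hb ba.
have [l [lk bl]] := a2 b ba; have [c [cb cl]] := hb l lk.
exact: (IH c cb b l bl cl cb).
Qed.

(* The tree searches for [r] with [B a r] together with a descending sequence of [r]. *)
Lemma rank_tree (B : real -> real -> Prop) : Sou (fun p => B (p1 p) (p2 p)) ->
  exists q, (forall a z, branch q a z -> exists r d,
       [/\ B a r, d 0 = 0 & forall n, rrel r (d n.+1) (d n)]) /\
    forall a r, B a r -> forall x, rkb (tree q a) x [::] -> rkle (rrel r) x 0.
Proof.
move=> /Sou_universal [q0 q0E].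
(* The number in a node packs an entry of the Souslin witness for [B] and the next term of the
   descending sequence, which starts at 0. *)
pose dec (m : nat) : nat * nat := odflt (0, 0) (unpickle m).
pose sq (s : seq (bool * nat)) := [seq (x.1, (dec x.2).1) | x <- s].
pose D (s : seq (bool * nat)) i := if i is j.+1 then (dec (nth (false, 0) s j).2).2 else 0.
(* A descent is checked once the bit of [r] that decides it has appeared in the node; along a branch
   every check eventually takes place. *)
pose P (s : seq (bool * nat)) (b : seq bool) := q0 (pickle (sq s, b)) &&
  [forall i : 'I_(size s), let m := pickle (D s i.+1, D s i) in
     (m < size s)%N ==> (nth (false, 0) s m).1].
exists (fun m => if unpickle m is Some (s, b) then P s b else false).
split=> [a z bz|a r].
  pose z' n := ((z n).1, (dec (z n).2).1).
  pose d n := if n is m.+1 then (dec (z m).2).2 else 0.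
  have sqz k : sq (mkseq z k) = mkseq z' k by rewrite /sq /mkseq -map_comp.
  have bz' : branch q0 a z'.
    move=> [|k] //; have := bz k.+1; rewrite /tree pickleK /P => /andP [].
    by rewrite sqz !size_mkseq.
  exists (fun n => (z n).1), d; split=> //; first by apply/q0E; exists z'.
  move=> n; rewrite /rrel; set m := pickle _.
  have := bz (maxn n m).+1; rewrite /tree pickleK /P size_mkseq => /andP [_ /forallP].
  have nk : (n < (maxn n m).+1)%N by rewrite ltnS leq_maxl.
  have mk : (m < (maxn n m).+1)%N by rewrite ltnS leq_maxr.
  move=> /(_ (Ordinal nk)) /=; rewrite nth_mkseq //.
  have -> : D (mkseq z (maxn n m).+1) n = d n.
    by case: (n) nk => // j jk; rewrite /D nth_mkseq // ltnW.
  by rewrite -/m mk /= nth_mkseq.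
move=> /q0E [z bz zr].
pose N (d : seq nat) := [seq (r i, pickle ((z i).2, nth 0 d i)) | i <- iota 0 (size d)].
have NS d k : N (rcons d k) = rcons (N d) (r (size d), pickle ((z (size d)).2, k)).
  rewrite /N size_rcons -{1}addn1 iotaD map_cat /= add0n cats1 nth_rcons ltnn eqxx.
  congr rcons; apply/eq_in_map => i; rewrite mem_iota add0n => /andP [_ ik].
  by rewrite nth_rcons ik.
have sN d : size (N d) = size d by rewrite size_map size_iota.
have nN d i : (i < size d)%N -> nth (false, 0) (N d) i = (r i, pickle ((z i).2, nth 0 d i)).
  by move=> ik; rewrite (nth_map 0) ?size_iota // nth_iota.
have TN d : path (fun x y => rrel r y x) 0 d -> tree
    (fun m => if unpickle m is Some (s, b) then P s b else false) a (N d).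
  move=> /(pathP 0) pd; rewrite /tree pickleK; apply/orP.
  have [d0|dn] := posnP (size d); [left|right].
    by rewrite /nilp sN d0.
  rewrite /P sN; apply/andP; split.
    have := bz (size d); rewrite /tree size_mkseq /nilp size_mkseq eqn0Ngt dn /=.
    congr (is_true (q0 (pickle (_, _)))); rewrite /sq /N -map_comp.
    apply/eq_in_map => i; rewrite mem_iota add0n => /andP [_ ik].
    by rewrite /dec /= pickleK /= -zr; case: (z i).
  apply/forallP => i; apply/implyP.
  have ik : (i < size d)%N by exact: ltn_ord.
  have -> : D (N d) i.+1 = nth 0 d i by rewrite /D nN // /dec pickleK.
  have -> : D (N d) i = nth 0 (0 :: d) i.
    case: (nat_of_ord i) ik => // j jk; rewrite /D nN ?(ltnW jk) // /dec pickleK //.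
  by move=> mk; rewrite nN //=; exact: pd.
(* A fixed branch [z] for [B] turns each descending sequence [d] from 0 into a node [N d], whose
   rank bounds the rank of the last term of [d]. *)
suff H d x : path (fun x y => rrel r y x) 0 d -> rkb (tree
    (fun m => if unpickle m is Some (s, b) then P s b else false) a) x (N d) ->
    rkle (rrel r) x (last 0 d) by move=> x; exact: (H [::]).
elim/ens_in_ind: x d => x IH d pd /rkbE hx; apply/rkleE => l ll.
have pdl : path (fun x y => rrel r y x) 0 (rcons d l) by rewrite rcons_path pd.
have := TN _ pdl; rewrite NS => /hx [y [yx]]; rewrite -NS => hy.
by exists y; split=> //; have := IH y yx _ pdl hy; rewrite last_rcons.
Qed.

(** A branch is a sequence of pairs, whereas stages are only tested for reals. A subtree without
    leaves whose nodes all follow [r] is coded by a real, and it yields a branch by dependent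
    choice. *)
Definition pruned (r' : real) (T : seq (bool * nat) -> bool) (r : real) : Prop :=
  r' (pickle ([::] : seq (bool * nat))) /\
  forall s, r' (pickle s) -> [/\ T s, exists x, r' (pickle (rcons s x)) &
    forall i, (i < size s)%N -> (nth (false, 0) s i).1 = r i].

Lemma dep_choice (A : Type) (P : seq A -> Prop) :
  P [::] -> (forall s, P s -> exists x, P (rcons s x)) ->
  exists z : nat -> A, forall k, P (mkseq z k).
Proof.
move=> P0 PS; have [x0 _] := PS _ P0.
have /choice [f hf] : forall s, exists x, P s -> P (rcons s x).
  move=> s; have [/PS [x ?]|no] := pselect (P s); first by exists x.
  by exists x0.
pose sk := fix sk k := if k is l.+1 then rcons (sk l) (f (sk l)) else [::].
exists (fun k => f (sk k)) => k.
have -> : mkseq (fun k => f (sk k)) k = sk k.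
  by elim: k => // k IHk; rewrite mkseqS IHk.
by elim: k => //= k; exact: hf.
Qed.

Lemma pruned_branch r' q a r : pruned r' (tree q a) r ->
  exists2 z, branch q a z & forall n, (z n).1 = r n.
Proof.
move=> [p0 pS].
have [z hz] := dep_choice p0 (fun s hs => let: And3 _ e _ := pS s hs in e).
exists z; first by move=> k; have [] := pS _ (hz k).
move=> n; have [_ _ /(_ n)] := pS _ (hz n.+1).
by rewrite size_mkseq nth_mkseq //; apply.
Qed.

Lemma branch_pruned q a z : branch q a z ->
  exists r', pruned r' (tree q a) (fun n => (z n).1).
Proof.
move=> bz; exists (fun m => `[< exists k, m = pickle (mkseq z k) >]); split.
  by apply/asboolP; exists 0.
move=> s /asboolP [k /(pcan_inj pickleK) ->]; split; first exact: bz.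
  by exists (z k); apply/asboolP; exists k.+1; rewrite mkseqS.
by move=> i; rewrite size_mkseq => ik; rewrite nth_mkseq.
Qed.

(** * Countable ordinals *)

Lemma cord0 : cord ens0.
Proof.
split; last by exists (fun=> ens0) => x [[]].
by split=> [y z [[]]|y [[]]].
Qed.

Lemma cord_succ a : cord a -> cord (osucc a).
Proof.
move=> [oa [g hg]]; split; first exact: osucc_ord.
exists (fun n => if n is m.+1 then g m else a) => x /osuccE [/hg [n xn]|xa].
  by exists n.+1.
by exists 0.
Qed.

Lemma cord_sup (f : nat -> ens) : (forall n, cord (f n)) -> cord (osup f).
Proof.
move=> cf; split; first by apply: osup_ord => n; have [] := cf n.
have /choice [g hg] : forall n, exists g : nat -> ens,
    forall x, ens_in x (f n) -> exists m, ens_eq x (g m) by move=> n; have [] := cf n.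
exists (fun m => if unpickle m is Some (n, k) then g n k else ens0).
by move=> x /osupE [n /hg [k xk]]; exists (pickle (n, k)); rewrite pickleK.
Qed.

Lemma cord_in a b : cord a -> ens_in b a -> cord b.
Proof.
move=> [oa [g hg]] ba; split; first exact: ord_in ba.
by exists g => x xb; apply: hg; exact: ord_trans xb ba.
Qed.

Lemma cord_collect (P : nat -> ens -> Prop) :
  (forall n, exists a, cord a /\ P n a) ->
  (forall n a b, cord b -> ens_in a b -> P n a -> P n b) ->
  exists a, cord a /\ forall n, P n a.
Proof.
move=> /choice [f hf] mono; exists (osup (osucc \o f)).
have c : cord (osup (osucc \o f)).
  by apply: cord_sup => n; apply: cord_succ; have [] := hf n.
split=> // n; apply: mono c _ (hf n).2.
by apply/osupE; exists n; apply/osuccE; right; exact: ens_eq_refl.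
Qed.

(** Index 0 is reserved for the ordinal itself, so that a code presents its own stage at 0; idle
    indices repeat it. *)
Lemma cord_enum a : cord a -> exists h : nat -> ens,
  [/\ h 0 = a, forall i, ens_ordinal (h i), ranks (hlt h) h &
      forall i, h i = a \/ ens_in (h i) a].
Proof.
move=> [oa [g hg]].
pose h n := if n is m.+1 then if `[< ens_in (g m) a >] then g m else a else a.
have hP i : h i = a \/ ens_in (h i) a.
  case: i => [|m] /=; first by left.
  by case: ifPn => [/asboolP|]; [right|left].
have ho i : ens_ordinal (h i) by case: (hP i) => [->//|/(ord_in oa)].
exists h; split=> // i x; split=> [xi|[j [/asboolP ji xj]]]; last first.
  exact: ens_in_eql (ens_eq_sym xj) ji.
have xa : ens_in x a.
  by case: (hP i) => [<-//|ia]; exact: ord_trans xi ia.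
have [m xm] := hg x xa.
have hm : h m.+1 = g m by rewrite /h asboolT //; exact: ens_in_eql xm xa.
exists m.+1; rewrite hm; split=> //; apply/asboolP; rewrite hm.
exact: ens_in_eql xm xi.
Qed.

Lemma Rl_countable a : cord a ->
  exists f : nat -> real, forall r, Rl a r -> exists n, f n = r.
Proof.
move=> /cord_enum [h [h0 ho rh _]].
have wo_ := hlt_weak_order ho; have wf_ := @hlt_wf _ h.
have tab := htable (@skolem_onto numconst h (ranks_onto rh)).
exists (fun n m => if unpickle n is Some t
  then `[< treal (hlt h) (heq h) (hsat h) t m >] else false) => r.
rewrite -h0 => /(Rl_table 0 r wo_ wf_ rh tab) [t [_ rt]].
exists (pickle t); apply/funext => m; rewrite pickleK.
by apply/asboolP/idP => /rt.
Qed.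

(** If all successors of a node have countable rank bounds, so has the node, by a countable
    supremum. A root without one therefore starts a branch. *)
Lemma branch_or_rank q a : (exists z, branch q a z) \/
  exists x, cord x /\ rkb (tree q a) x [::].
Proof.
have [|no] := pselect (exists x, cord x /\ rkb (tree q a) x [::]); [by right|left].
pose bad s := tree q a s /\ ~ exists x, cord x /\ rkb (tree q a) x s.
suff [z hz] : exists z, forall k, bad (mkseq z k) by exists z => k; have [] := hz k.
apply: dep_choice => // s [Ts nos]; apply: contrapT => nox; apply: nos.
have /choice [f hf] : forall n, exists x, cord x /\
    if unpickle n is Some y then tree q a (rcons s y) ->
      rkb (tree q a) x (rcons s y) else True.
  move=> n; case: (unpickle n) => [y|]; last by exists ens0; split=> //; exact: cord0.
  have [Ty|nT] := boolP (tree q a (rcons s y)); last by exists ens0; split=> //; exact: cord0.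
  have [[x [cx hx]]|no'] := pselect (exists x, cord x /\ rkb (tree q a) x (rcons s y)).
    by exists x; split.
  by case: nox; exists y.
exists (osup (osucc \o f)); split.
  by apply: cord_sup => n; apply: cord_succ; have [] := hf n.
apply/rkbE => y Ty; exists (f (pickle y)); split.
  by apply/osupE; exists (pickle y); apply/osuccE; right; exact: ens_eq_refl.
by have [_] := hf (pickle y); rewrite pickleK; apply.
Qed.

(** * The closure points *)

(* Stage [a] decides the well-foundedness of all trees with parameters in stage [g]. *)
Definition Dec (g a : ens) : Prop :=
  (forall q p, Rl g q -> Rl g p ->
     (exists x, ens_in x a /\ rkb (tree q p) x [::]) \/
     exists r r', [/\ Rl a r, Rl a r' & pruned r' (tree q p) r]) /\
  (forall b, ens_in b g -> exists p, Rl a p /\ isrk (rrel p) b 0).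

Definition Eo (a : ens) : Prop := Dec a a.

(* [lab n a]: [a] is the (λ + n)-th closure point, for [λ] zero or a limit. *)
Fixpoint lab (n : nat) (a : ens) : Prop :=
  Eo a /\ match n with
  | 0 => forall y, ens_in y a -> Eo y -> exists z, [/\ ens_in z a, ens_in y z & Eo z]
  | m.+1 => exists y, [/\ ens_in y a, lab m y & forall z, ens_in z a -> ens_in y z -> ~ Eo z]
  end.

Lemma Eo_eq a b : ens_eq a b -> Eo a -> Eo b.
Proof.
move=> ab [e1 e2]; have ba := ens_eq_sym ab.
split=> [q p /(Rl_eq ba) qa /(Rl_eq ba) pa|x /(ens_in_eqr ba) /e2 [p [pa pk]]].
  have [[x [xa hx]]|[r [r' [ra ra' pr']]]] := e1 q p qa pa.
    by left; exists x; split=> //; exact: ens_in_eqr ab xa.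
  by right; exists r, r'; split=> //; exact: Rl_eq ab _.
by exists p; split=> //; exact: Rl_eq ab pa.
Qed.

Lemma lab_Eo n a : lab n a -> Eo a.
Proof. by case: n => [|n] []. Qed.

Lemma lab_eq n a b : ens_eq a b -> lab n a -> lab n b.
Proof.
move=> ab; have ba := ens_eq_sym ab.
case: n => [|n] /= [ea h]; (split; first exact: Eo_eq ea).
  move=> y /(ens_in_eqr ba) ya Ey; have [z [za yz Ez]] := h y ya Ey.
  by exists z; split=> //; exact: ens_in_eqr ab za.
have [y [ya ly h']] := h; exists y; split=> //; first exact: ens_in_eqr ab ya.
by move=> z /(ens_in_eqr ba); exact: h'.
Qed.

Lemma lab_inj n m a : ens_ordinal a -> lab n a -> lab m a -> n = m.
Proof.
have Z k b : lab 0 b -> ~ lab k.+1 b.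
  move=> [_ h0] [_ [y [yb /lab_Eo Ey h]]].
  by have [z [zb yz Ez]] := h0 y yb Ey; exact: h z zb yz Ez.
elim: n m a => [|n IH] [|m] a oa // la lb.
- by case: (Z _ _ la lb).
- by case: (Z _ _ lb la).
case: la => _ [y [ya ly hy]]; case: lb => _ [z [za lz hz]].
congr _.+1; have [yz|yz|zy] := ord_trich (ord_in oa ya) (ord_in oa za).
- by case: (hy z za yz (lab_Eo lz)).
- by apply: IH (ord_in oa ya) ly _; exact: lab_eq (ens_eq_sym yz) lz.
- by case: (hz y ya zy (lab_Eo ly)).
Qed.

Lemma Dec_mono g a b : ens_ordinal b -> ens_in a b -> Dec g a -> Dec g b.
Proof.
move=> ob ab [d1 d2]; split=> [q p qg pg|x /d2 [p [pa hp]]].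
  have [[x [xa hx]]|[r [r' [ra ra' pr']]]] := d1 q p qg pg.
    by left; exists x; split=> //; exact: ord_trans xa ab.
  by right; exists r, r'; split=> //; exact: Rl_mono ab _.
by exists p; split=> //; exact: Rl_mono pa.
Qed.

Lemma Rl_sup (f : nat -> ens) r : Rl (osup f) r -> exists n, Rl (f n) r.
Proof.
move=> [x [/LE [b [/osupE [n bn] xb]] xr]]; exists n, x; split=> //.
by apply/LE; exists b.
Qed.

(** Parameters in the limit stage already occur at some [f n], and [f n.+1] decides them. *)
Lemma Eo_limit (f : nat -> ens) : (forall n, ens_ordinal (f n)) ->
  (forall n, ens_in (f n) (f n.+1)) -> (forall n, Dec (f n) (f n.+1)) -> Eo (osup f).
Proof.
move=> of_ inc dec.
have os := osup_ord of_.
have mono i j r : (i <= j)%N -> Rl (f i) r -> Rl (f j) r.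
  elim: j => [|j IH]; first by rewrite leqn0 => /eqP ->.
  rewrite leq_eqVlt => /orP [/eqP -> //|/IH h /h].
  exact: Rl_mono (inc j).
have ins n : ens_in (f n) (osup f) by apply/osupE; exists n.+1.
split=> [q p /Rl_sup [i qi] /Rl_sup [j pj]|b /osupE [n bn]].
  have [d1 _] := Dec_mono os (ins _) (dec (maxn i j)).
  by apply: d1; [exact: mono (leq_maxl _ _) qi|exact: mono (leq_maxr _ _) pj].
by have [_ d2] := Dec_mono os (ins _) (dec n); exact: d2.
Qed.

Section Constructible.
Hypothesis VL : V_eq_L.

Lemma Rl_collect (f : nat -> real) : exists a, cord a /\ forall n, Rl a (f n).
Proof.
apply: (@cord_collect (fun n a => Rl a (f n))) => [n|n a b [ob _] ab].
  exact: condensation.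
exact: Rl_mono.
Qed.

(** A countable stage has countably many pairs of reals and countably many smaller ordinals. Each
    demand is met at some countable stage, because V = L puts branches and presentations there, and
    a supremum meets all of them. *)
Lemma Dec_ex g : cord g -> exists a, cord a /\ Dec g a.
Proof.
move=> cg; have [f hf] := Rl_countable cg.
pose P1 n a := if unpickle n is Some (i, j) then
  (exists x, ens_in x a /\ rkb (tree (f i) (f j)) x [::]) \/
  (exists r r', [/\ Rl a r, Rl a r' & pruned r' (tree (f i) (f j)) r]) else True.
have [a1 [ca1 ha1]] : exists a, cord a /\ forall n, P1 n a.
  apply: cord_collect => n; rewrite /P1; case: (unpickle n) => [[i j]|]; last first.
  - by [].
  - move=> a b [ob _] ab [[x [xa hx]]|[r [r' [ra ra' pr']]]].
      by left; exists x; split=> //; exact: ord_trans xa ab.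
    by right; exists r, r'; split=> //; exact: Rl_mono ab _.
  - by exists ens0; split=> //; exact: cord0.
  have [[z bz]|[x [cx hx]]] := branch_or_rank (f i) (f j).
    have [r' pr'] := branch_pruned bz.
    have [a [ca ha]] := Rl_collect (fun n => if n is 0 then (fun n => (z n).1) else r').
    exists a; split=> //; right; exists (fun n => (z n).1), r'; split=> //.
      exact: (ha 0).
    exact: (ha 1).
  exists (osucc x); split; first exact: cord_succ.
  by left; exists x; split=> //; apply/osuccE; right; exact: ens_eq_refl.
have [h hh] := cg.2.
pose P2 n a := ens_in (h n) g -> exists p, Rl a p /\ isrk (rrel p) (h n) 0.
have [a2 [ca2 ha2]] : exists a, cord a /\ forall n, P2 n a.
  apply: cord_collect => [n|n a b [ob _] ab H /H [p [pa hp]]]; last first.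
    by exists p; split=> //; exact: Rl_mono pa.
  have [ng|no] := pselect (ens_in (h n) g); last by exists ens0; split=> //; exact: cord0.
  have [e [e0 _ re _]] := cord_enum (cord_in cg ng).
  pose p : real := fun m => if unpickle m is Some (k, l) then hlt e k l else false.
  have rp : rrel p = hlt e.
    by apply/funext => k; apply/funext => l; rewrite /rrel /p pickleK.
  have [a [ca ha]] := condensation VL p; exists a; split=> // _; exists p; split=> //.
  by rewrite rp -e0; exact: isrk_ranks.
pose a := osup (fun n => if n is 0 then osucc a1 else osucc a2).
have ca : cord a by apply: cord_sup => -[|n]; exact: cord_succ.
exists a; split=> //; split=> [q p /hf [i <-] /hf [j <-]|b bg].
  have := ha1 (pickle (i, j)); rewrite /P1 pickleK.
  have a1a : ens_in a1 a.
    by apply/osupE; exists 0; apply/osuccE; right; exact: ens_eq_refl.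
  move=> [[x [xa hx]]|[r [r' [ra ra' pr']]]].
    by left; exists x; split=> //; exact: ord_trans ca.1 xa a1a.
  by right; exists r, r'; split=> //; exact: Rl_mono ca.1 a1a _.
have [n bn] := hh b bg.
have [p [pa hp]] := ha2 n (ens_in_eql bn bg).
exists p; split; last exact: isrk_eq (ens_eq_sym bn) hp.
apply: Rl_mono ca.1 _ pa.
by apply/osupE; exists 1; apply/osuccE; right; exact: ens_eq_refl.
Qed.

(** Interleaves deciding the previous stage with passing a point of [U]. A trivial [U] gives
    unboundedly many closure points, and [U] the closure points themselves gives those in limit
    position. *)
Lemma Eo_limit_ex (U : ens -> Prop) :
  (forall g, cord g -> exists a, [/\ cord a, ens_in g a & U a]) ->
  forall g, cord g -> exists a, [/\ cord a, ens_in g a, Eo a &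
    forall y, ens_in y a -> exists z, [/\ ens_in z a, ens_in y z & U z]].
Proof.
move=> unb g cg.
have /choice [s hs] : forall x, exists y, cord x -> [/\ cord y, ens_in x y, Dec x y & U y].
  move=> x; have [cx|no] := pselect (cord x); last by exists x.
  have [d [cd Dd]] := Dec_ex cx.
  pose u n := if n is 0 then osucc d else osucc x.
  have cu : cord (osup u) by apply: cord_sup => -[|n]; exact: cord_succ.
  have [y [cy dy Uy]] := unb _ cu.
  exists y => _; split=> //.
    apply: ord_trans (cy.1) _ dy; apply/osupE; exists 1; apply/osuccE; right.
    exact: ens_eq_refl.
  apply: Dec_mono cy.1 _ Dd; apply: ord_trans (cy.1) _ dy; apply/osupE; exists 0.
  by apply/osuccE; right; exact: ens_eq_refl.
pose f n := iter n s g.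
have cf n : cord (f n) by elim: n => //= n /hs [].
have inc n : ens_in (f n) (f n.+1) by have [] := hs _ (cf n).
exists (osup f); split.
- exact: cord_sup.
- by apply/osupE; exists 1; exact: inc 0.
- apply: Eo_limit => // n; first by have [] := cf n.
  by have [] := hs _ (cf n).
move=> y /osupE [n yn]; exists (f n.+1); split.
- by apply/osupE; exists n.+2.
- exact: ord_trans (cf _).1 yn (inc n).
- by have [] := hs _ (cf n).
Qed.

Lemma Eo_unbounded g : cord g -> exists a, [/\ cord a, ens_in g a & Eo a].
Proof.
move=> cg; have [|a [ca ga Ea _]] := @Eo_limit_ex (fun=> True) _ g cg; last by exists a.
move=> x cx; exists (osucc x); split=> //; first exact: cord_succ.
by apply/osuccE; right; exact: ens_eq_refl.
Qed.

Lemma Eo_next g : cord g -> exists a, [/\ cord a, ens_in g a, Eo a &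
  forall z, ens_in z a -> ens_in g z -> ~ Eo z].
Proof.
move=> /Eo_unbounded [a0 [ca0 ga0 Ea0]].
have [a [[ca ga Ea] hmin]] := @ens_min (fun x => [/\ cord x, ens_in g x & Eo x]) a0 (And3 ca0 ga0 Ea0).
exists a; split=> // z za gz Ez; apply: hmin (za) _; split=> //; exact: cord_in za.
Qed.

Lemma lab_unbounded n g : cord g -> exists a, [/\ cord a, ens_in g a & lab n a].
Proof.
elim: n g => [|n IH] g cg.
  have [a [ca ga Ea h]] := Eo_limit_ex Eo_unbounded cg.
  by exists a; split=> //=; split=> // y ya _; exact: h.
have [y [cy gy ly]] := IH g cg; have [a [ca ya Ea h]] := Eo_next cy.
exists a; split=> //; first exact: ord_trans ca.1 gy ya.
by split=> //; exists y.
Qed.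

End Constructible.

(** * Codes of stages *)

Definition ckey := ((nat * nat) + (nm nat * nm nat) + (nat * uf * seq (nm nat)) +
  (nm nat * nm nat * seq (bool * nat) * nat) + (nm nat * nat * nat))%type.

(* Even bits are reserved for the tag below. *)
Definition cbit (c : real) (k : ckey) : bool := c (pickle k).*2.+1.

Definition clt c i j : bool := cbit c (inl (inl (inl (inl (i, j))))).
Definition ceq c t u : Prop := cbit c (inl (inl (inl (inr (t, u))))).
Definition csat c i p ts : Prop := cbit c (inl (inl (inr (i, p, ts)))).
(** These two tables record rank bounds of nodes in named trees and exact ranks in named relations,
    so that being a closure point can be read off the bits of a code. *)
Definition crk c t u s i : Prop := cbit c (inl (inr (t, u, s, i))).
Definition cis c t k i : Prop := cbit c (inr (t, k, i)).

Definition creal c t : real := fun n => `[< treal (clt c) (ceq c) (csat c) t n >].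

(** Nothing lies above index 0. Hence well-foundedness below 0 already gives it everywhere, as
    [valid_wf] shows, and the coded ordinal is the rank of 0. *)
Definition valid (c : real) : Prop :=
  [/\ weak_order (clt c), forall i, ~ clt c 0 i,
      truth_table (clt c) (ceq c) (csat c),
      forall t u s i, crk c t u s i <->
        forall x, tree (creal c t) (creal c u) (rcons s x) ->
          exists j, clt c j i /\ crk c t u (rcons s x) j
    & forall t k i, cis c t k i <->
        (forall l, rrel (creal c t) l k -> exists j, clt c j i /\ cis c t l j) /\
        (forall j, clt c j i -> exists l, rrel (creal c t) l k /\ cis c t l j)].

Definition cE (c : real) (i : nat) : Prop :=
  (forall t u, vld (clt c) i t -> vld (clt c) i u ->
     (exists j, clt c j i /\ crk c t u [::] j) \/
     exists v v', [/\ vld (clt c) i v, vld (clt c) i v' &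
       pruned (creal c v') (tree (creal c t) (creal c u)) (creal c v)]) /\
  (forall j, clt c j i -> exists t, vld (clt c) i t /\ cis c t 0 j).

Fixpoint clab (c : real) (n : nat) (i : nat) : Prop :=
  cE c i /\ match n with
  | 0 => forall j, clt c j i -> cE c j -> exists k, [/\ clt c k i, clt c j k & cE c k]
  | m.+1 => exists j, [/\ clt c j i, clab c m j & forall k, clt c k i -> clt c j k -> ~ cE c k]
  end.

(** A clopen separation of the pieces that leaves the zero real outside all of them. *)
Definition tag (n : nat) (c : real) : Prop :=
  c n.*2 /\ forall k, (k < n)%N -> ~ c k.*2.

(** The Borel part of [Cset]. Search trees can only ask for this part; well-foundedness is recovered
    from a bisimulation with a presented ordinal. *)
Definition code (n : nat) (c : real) : Prop := [/\ tag n c, valid c & clab c n 0].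

Definition Cset (n : nat) (c : real) : Prop :=
  code n c /\ well_founded (fun i j => clt c i j).

(** * Soundness of well-founded codes *)

Section Soundness.
Variables (c : real) (o : nat -> ens).
Hypotheses (vc : valid c) (wf : well_founded (fun i j => clt c i j)) (ro : ranks (clt c) o).

Let wo_ : weak_order (clt c). Proof. by case: vc. Qed.
Let tab : truth_table (clt c) (ceq c) (csat c). Proof. by case: vc. Qed.

Lemma crkP t u s i : crk c t u s i <-> rkb (tree (creal c t) (creal c u)) (o i) s.
Proof.
case: vc => _ _ _ hrk _; elim/(well_founded_ind wf): i s => i IH s.
rewrite hrk rkbE; split=> H x /H [].
  move=> j [ji hj]; exists (o j); split; last exact/IH.
  by apply/ro; exists j; split=> //; exact: ens_eq_refl.
move=> b [/ro [j [ji bj]] hb]; exists j; split=> //; apply/IH => //.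
exact: rkb_eq bj hb.
Qed.

Lemma cisP t k i : cis c t k i <-> isrk (rrel (creal c t)) (o i) k.
Proof.
case: vc => _ _ _ _ his; elim/(well_founded_ind wf): i k => i IH k.
rewrite his isrkE; split=> -[H1 H2]; split.
- move=> l /H1 [j [ji hj]]; exists (o j); split; last exact/IH.
  by apply/ro; exists j; split=> //; exact: ens_eq_refl.
- move=> b /ro [j [ji bj]]; have [l [lk hl]] := H2 j ji; exists l; split=> //.
  by apply: isrk_eq (ens_eq_sym bj) _; exact/IH.
- move=> l /H1 [b [/ro [j [ji bj]] hb]]; exists j; split=> //; apply/IH => //.
  exact: isrk_eq bj hb.
- move=> j ji; have [|l [lk hl]] := H2 (o j).
    by apply/ro; exists j; split=> //; exact: ens_eq_refl.
  by exists l; split=> //; exact/IH.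
Qed.

Lemma cRlP i r : Rl (o i) r <-> exists t, vld (clt c) i t /\ creal c t = r.
Proof.
rewrite (Rl_table i r wo_ wf ro tab); split=> -[t [vt h]]; exists t; split=> //.
  by apply/funext => n; apply/asboolP/idP => /h.
by move=> n; rewrite -h; split=> /asboolP.
Qed.

Lemma cEP i : cE c i <-> Eo (o i).
Proof.
split=> -[e1 e2]; split.
- move=> q p /cRlP [t [vt <-]] /cRlP [u [vu <-]].
  have [[j [ji hj]]|[v [v' [vv vv' pv]]]] := e1 t u vt vu.
    left; exists (o j); split; last exact/crkP.
    by apply/ro; exists j; split=> //; exact: ens_eq_refl.
  by right; exists (creal c v), (creal c v'); split=> //; apply/cRlP; [exists v|exists v'].
- move=> b /ro [j [ji bj]]; have [t [vt ht]] := e2 j ji.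
  exists (creal c t); split; first by apply/cRlP; exists t.
  by apply: isrk_eq (ens_eq_sym bj) _; exact/cisP.
- move=> t u vt vu.
  have [|||] := e1 (creal c t) (creal c u).
  + by apply/cRlP; exists t.
  + by apply/cRlP; exists u.
  + move=> [x [/ro [j [ji xj]] hx]]; left; exists j; split=> //; apply/crkP.
    exact: rkb_eq xj hx.
  + move=> [r [r' [/cRlP [v [vv <-]] /cRlP [v' [vv' <-]] pv]]]; right.
    by exists v, v'.
- move=> j ji; have [|p [/cRlP [t [vt <-]] hp]] := e2 (o j).
    by apply/ro; exists j; split=> //; exact: ens_eq_refl.
  by exists t; split=> //; exact/cisP.
Qed.

Lemma clt_in i j : clt c i j <-> ens_in (o i) (o j).
Proof. by rewrite (ranks_lt wo_ ro); split=> /asboolP. Qed.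

Lemma clabP n i : clab c n i <-> lab n (o i).
Proof.
elim: n i => [|n IH] i /=; rewrite cEP; split=> -[Ei h]; split=> //.
- move=> y /ro [j [ji yj]] /(Eo_eq yj) /cEP Ey; have [k [ki jk Ek]] := h j ji Ey.
  exists (o k); split; [exact/clt_in| |exact/cEP].
  by apply: ens_in_eql (ens_eq_sym yj) _; exact/clt_in.
- move=> j /clt_in ji /cEP Ej; have [z [/ro [k [ki zk]] jz Ez]] := h (o j) ji Ej.
  exists k; split=> //; first by apply/clt_in; exact: ens_in_eqr zk jz.
  by apply/cEP; exact: Eo_eq zk Ez.
- have [j [ji lj hj]] := h; exists (o j); split; [exact/clt_in|exact/IH|].
  move=> z /ro [k [ki zk]] /(ens_in_eqr zk) /clt_in jk /(Eo_eq zk) /cEP.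
  exact: hj.
- have [y [/ro [j [ji yj]] ly hy]] := h; exists j; split=> //.
    by apply/IH; exact: lab_eq yj ly.
  move=> k /clt_in ki /clt_in jk /cEP; apply: hy ki _.
  exact: ens_in_eql (ens_eq_sym yj) jk.
Qed.

End Soundness.

Lemma asbool_prop (P : Prop) : (is_true `[< P >]) = P.
Proof. by apply/propext; split=> /asboolP. Qed.

Lemma code_ex n a : cord a -> lab n a -> exists c, Cset n c /\ isrk (clt c) a 0.
Proof.
move=> ca la; have [h [h0 ho rh hP]] := cord_enum ca.
have wo_ := hlt_weak_order ho; have wf_ := @hlt_wf _ h.
have tab := htable (@skolem_onto numconst h (ranks_onto rh)).
pose hr t : real := fun m => `[< treal (hlt h) (heq h) (hsat h) t m >].
pose truth (k : ckey) : bool := match k with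
  | inl (inl (inl (inl (i, j)))) => hlt h i j
  | inl (inl (inl (inr (t, u)))) => `[< heq h t u >]
  | inl (inl (inr (i, p, ts))) => `[< hsat h i p ts >]
  | inl (inr (t, u, s, i)) => `[< rkb (tree (hr t) (hr u)) (h i) s >]
  | inr (t, k, i) => `[< isrk (rrel (hr t)) (h i) k >]
  end.
(* The only even bit that is set carries the tag; the odd bits record the truth about the stages. *)
pose c : real := fun m =>
  if odd m then (if unpickle m./2 is Some k then truth k else false) else m./2 == n.
have cb k : cbit c k = truth k.
  by rewrite /cbit /c /= odd_double /= uphalf_double pickleK.
have cltE : clt c = hlt h.
  by apply/funext => i; apply/funext => j; rewrite /clt cb.
have ceqE : ceq c = heq h.
  by apply/funext => t; apply/funext => u; rewrite /ceq cb /truth asbool_prop.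
have csatE : csat c = hsat h.
  apply/funext => i; apply/funext => p; apply/funext => ts.
  by rewrite /csat cb /truth asbool_prop.
have crealE : creal c = hr.
  by apply/funext => t; apply/funext => m; rewrite /creal cltE ceqE csatE.
have vc : valid c.
  split.
  - by rewrite cltE.
  - rewrite cltE => i /asboolP; rewrite h0; case: (hP i) => [->|ia]; first exact: ens_in_irr.
    exact: ens_in_asym.
  - by rewrite cltE ceqE csatE.
  - move=> t u s i; rewrite crealE cltE /crk !cb /truth asbool_prop rkbE.
    split=> H x /H [].
      move=> b [/rh [j [ji bj]] hb]; exists j; split=> //.
      by rewrite cb /truth asbool_prop; exact: rkb_eq bj hb.
    move=> j [ji]; rewrite cb /truth asbool_prop => hj; exists (h j); split=> //.
    exact/asboolP.
  - move=> t k i; rewrite crealE cltE /cis !cb /truth asbool_prop isrkE.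
    split=> -[H1 H2]; split.
    + move=> l /H1 [b [/rh [j [ji bj]] hb]]; exists j; split=> //.
      by rewrite cb /truth asbool_prop; exact: isrk_eq bj hb.
    + move=> j /asboolP /H2 [l [lk hl]]; exists l; split=> //.
      by rewrite cb /truth asbool_prop.
    + move=> l /H1 [j [ji]]; rewrite cb /truth asbool_prop => hj; exists (h j); split=> //.
      exact/asboolP.
    + move=> b /rh [j [ji bj]]; have [l [lk]] := H2 j ji.
      rewrite cb /truth asbool_prop => hl; exists l; split=> //.
      exact: isrk_eq (ens_eq_sym bj) hl.
have rc : ranks (clt c) h by rewrite cltE.
have wfc : well_founded (fun i j => clt c i j) by rewrite cltE.
exists c; split; last by rewrite -h0; exact: isrk_ranks.
split=> //; split=> //; last by apply/(clabP vc wfc rc); rewrite h0.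
rewrite /tag /c !odd_double !doubleK eqxx; split=> // k kn.
by rewrite odd_double doubleK => /eqP kE; rewrite kE ltnn in kn.
Qed.

(** * Codes form a Borel set *)

Lemma Del_eq A B : (forall c, A c = B c) -> Del A -> Del B.
Proof. by move=> AB; apply: Del_ext => c; rewrite AB. Qed.

Lemma Del_and3 A B C : Del A -> Del B -> Del C -> Del (fun c => [/\ A c, B c & C c]).
Proof.
move=> a b d; apply: Del_ext (Del_and a (Del_and b d)) => c.
by split=> [[? []]|[]].
Qed.

Lemma Del_clt i j : Del (fun c => clt c i j). Proof. exact: Del_bit. Qed.
Lemma Del_ceq t u : Del (fun c => ceq c t u). Proof. exact: Del_bit. Qed.
Lemma Del_csat i p ts : Del (fun c => csat c i p ts). Proof. exact: Del_bit. Qed.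
Lemma Del_crk t u s i : Del (fun c => crk c t u s i). Proof. exact: Del_bit. Qed.
Lemma Del_cis t k i : Del (fun c => cis c t k i). Proof. exact: Del_bit. Qed.

(** A hook, redefined below each time a further atomic predicate has been placed in [Del]. *)
Ltac del_atom := fail.
Ltac del := repeat first [ assumption | lazymatch goal with
  | |- Del (fun _ => ?P) => exact: (Del_const P)
  | |- Del (fun c => is_true (clt c ?i ?j)) => exact: (Del_clt i j)
  | |- Del (fun c => ceq c ?t ?u) => exact: (Del_ceq t u)
  | |- Del (fun c => csat c ?i ?p ?ts) => exact: (Del_csat i p ts)
  | |- Del (fun c => crk c ?t ?u ?s ?i) => exact: (Del_crk t u s i)
  | |- Del (fun c => cis c ?t ?k ?i) => exact: (Del_cis t k i)
  | |- Del (fun c => and3 _ _ _) => apply: Del_and3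
  | |- Del (fun c => _ /\ _) => apply: Del_and
  | |- Del (fun c => _ \/ _) => apply: Del_or
  | |- Del (fun c => _ <-> _) => apply: Del_iff
  | |- Del (fun c => exists x, _) => apply: Del_ex => ?
  | |- Del (fun c => ~ _) => apply: Del_not
  | |- Del (fun c => forall x, _) => first [apply: Del_all => ? | apply: Del_imp]
  end | del_atom ].

Lemma Del_vld i t : Del (fun c => vld (clt c) i t).
Proof.
elim/nm_indF: t i => j p ts IH i.
apply: (@Del_ext (fun c => [/\ clt c j i, wsc (size ts).+1 p & all (vld (clt c) j) ts])).
  by move=> c /=; split=> /and3P.
del; elim: ts IH => [|t ts IHts] /=; first by move=> _; exact: Del_const.
move=> [IHt /IHts h]; apply: (@Del_ext (fun c => vld (clt c) j t /\ all (vld (clt c) j) ts)).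
  by move=> c; split=> /andP.
by apply: Del_and.
Qed.

Ltac del_atom ::= lazymatch goal with
  | |- Del (fun c => is_true (vld (clt c) ?i ?t)) => exact: (Del_vld i t)
  end.

Lemma Del_dmem v t : Del (fun c => dmem (clt c) (csat c) v t).
Proof. by apply: Del_and; [exact: Del_vld|del]. Qed.

Ltac del_atom ::= lazymatch goal with
  | |- Del (fun c => is_true (vld (clt c) ?i ?t)) => exact: (Del_vld i t)
  | |- Del (fun c => dmem (clt c) (csat c) ?v ?t) => exact: (Del_dmem v t)
  end.

Lemma Del_tmem v t : Del (fun c => tmem (clt c) (ceq c) (csat c) v t).
Proof. by apply: Del_ex => u; apply: Del_and; [exact: Del_dmem|del]. Qed.

Ltac del_atom ::= lazymatch goal with
  | |- Del (fun c => is_true (vld (clt c) ?i ?t)) => exact: (Del_vld i t)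
  | |- Del (fun c => dmem (clt c) (csat c) ?v ?t) => exact: (Del_dmem v t)
  | |- Del (fun c => tmem (clt c) (ceq c) (csat c) ?v ?t) => exact: (Del_tmem v t)
  end.

Lemma Del_isnum n t : Del (fun c => isnum (clt c) (ceq c) (csat c) n t).
Proof.
elim: n t => [|n IH] t /=; first by del.
by apply: Del_ex => v; apply: Del_and3 => //; [exact: Del_dmem|del].
Qed.

Lemma Del_creal t n : Del (fun c => creal c t n).
Proof.
apply: (@Del_eq (fun c => treal (clt c) (ceq c) (csat c) t n)).
  by move=> c; rewrite /creal asbool_prop.
by apply: Del_ex => v; apply: Del_and; [exact: Del_dmem|exact: Del_isnum].
Qed.

Ltac del_atom ::= lazymatch goal with
  | |- Del (fun c => is_true (vld (clt c) ?i ?t)) => exact: (Del_vld i t)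
  | |- Del (fun c => dmem (clt c) (csat c) ?v ?t) => exact: (Del_dmem v t)
  | |- Del (fun c => tmem (clt c) (ceq c) (csat c) ?v ?t) => exact: (Del_tmem v t)
  | |- Del (fun c => is_true (creal c ?t ?n)) => exact: (Del_creal t n)
  | |- Del (fun c => is_true (rrel (creal c ?t) ?k ?l)) => exact: (Del_creal t (pickle (k, l)))
  end.

Lemma mkseq_eq (f : real) n b : mkseq f n = b <->
  size b = n /\ forall i, (i < n)%N -> (f i <-> nth false b i).
Proof.
split=> [<-|[sb h]]; first by rewrite size_mkseq; split=> // i ik; rewrite nth_mkseq.
apply: (@eq_from_nth _ false); rewrite size_mkseq // => i ik.
by rewrite nth_mkseq //; apply/idP/idP => /h; exact.
Qed.

Lemma Del_tree t u s : Del (fun c => tree (creal c t) (creal c u) s).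
Proof.
apply: (@Del_ext (fun c => nilp s \/ exists b : seq bool,
  (size b = size s /\ forall i, (i < size s)%N -> (creal c u i <-> nth false b i)) /\
  creal c t (pickle (s, b)))).
  move=> c; rewrite /tree; split=> [[-> //|[b [/mkseq_eq -> ->]]]|/orP [|h]].
  - by rewrite orbT.
  - by left.
  - by right; exists (mkseq (creal c u) (size s)); split=> //; exact/mkseq_eq.
by del.
Qed.

Ltac del_atom ::= lazymatch goal with
  | |- Del (fun c => is_true (vld (clt c) ?i ?t)) => exact: (Del_vld i t)
  | |- Del (fun c => dmem (clt c) (csat c) ?v ?t) => exact: (Del_dmem v t)
  | |- Del (fun c => tmem (clt c) (ceq c) (csat c) ?v ?t) => exact: (Del_tmem v t)
  | |- Del (fun c => is_true (creal c ?t ?n)) => exact: (Del_creal t n)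
  | |- Del (fun c => is_true (rrel (creal c ?t) ?k ?l)) => exact: (Del_creal t (pickle (k, l)))
  | |- Del (fun c => is_true (tree (creal c ?t) (creal c ?u) ?s)) => exact: (Del_tree t u s)
  end.

Lemma Del_pruned v' t u v :
  Del (fun c => pruned (creal c v') (tree (creal c t) (creal c u)) (creal c v)).
Proof.
apply: Del_and; first exact: Del_creal.
apply: Del_all => s; apply: Del_imp; first exact: Del_creal.
apply: Del_and3; first exact: Del_tree.
  by del.
apply: Del_all => i.
apply: (@Del_ext (fun c => (i < size s)%N -> ((nth (false, 0) s i).1 <-> creal c v i))).
  by move=> c; split=> h /h; [move=> e; apply/idP/idP => /e|move=> ->].
by del.
Qed.

Lemma Del_weak_order : Del (fun c => weak_order (clt c)).
Proof.
apply: Del_and; first by del.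
apply: Del_all => i; apply: Del_all => j; apply: Del_all => k.
apply: (@Del_ext (fun c => clt c i j -> clt c i k \/ clt c k j)).
  by move=> c; split=> h /h /orP.
by del.
Qed.

Lemma Del_table : Del (fun c => truth_table (clt c) (ceq c) (csat c)).
Proof.
apply: Del_and.
  apply: Del_all => i; apply: Del_all => t; apply: Del_all => u.
  apply: Del_imp; first exact: Del_vld; apply: Del_imp; first exact: Del_vld.
  apply: Del_iff; first by del.
  by apply: Del_and; apply: Del_all => v; apply: Del_imp;
    [exact: Del_dmem|exact: Del_tmem|exact: Del_dmem|exact: Del_tmem].
apply: Del_all => i; apply: Del_all => p; apply: Del_all => ts.
apply: Del_imp; first exact: Del_const.
apply: Del_imp.
  elim: ts => [|t ts IH] /=; first exact: Del_const.
  apply: (@Del_ext (fun c => vld (clt c) i t /\ all (vld (clt c) i) ts)).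
    by move=> c; split=> /andP.
  by apply: Del_and => //; exact: Del_vld.
apply: Del_iff; first by del.
by case: p => [k l|k l|p|p q|p] /=; del.
Qed.

Lemma Del_valid : Del valid.
Proof.
apply: (@Del_ext (fun c => weak_order (clt c) /\ (forall i, ~ clt c 0 i) /\
   [/\ truth_table (clt c) (ceq c) (csat c),
      forall t u s i, crk c t u s i <->
        forall x, tree (creal c t) (creal c u) (rcons s x) ->
          exists j, clt c j i /\ crk c t u (rcons s x) j
    & forall t k i, cis c t k i <->
        (forall l, rrel (creal c t) l k -> exists j, clt c j i /\ cis c t l j) /\
        (forall j, clt c j i -> exists l, rrel (creal c t) l k /\ cis c t l j)])).
  by move=> c; split=> [[? [? []]]|[]].
apply: Del_and; first exact: Del_weak_order.
apply: Del_and; first by del.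
apply: Del_and3; first exact: Del_table.
  by del.
by del.
Qed.

Lemma Del_cE i : Del (fun c => cE c i).
Proof.
apply: Del_and.
  apply: Del_all => t; apply: Del_all => u.
  apply: Del_imp; first exact: Del_vld; apply: Del_imp; first exact: Del_vld.
  apply: Del_or; first by del.
  apply: Del_ex => v; apply: Del_ex => v'.
  by apply: Del_and3; [exact: Del_vld|exact: Del_vld|exact: Del_pruned].
by del.
Qed.

Lemma Del_clab n i : Del (fun c => clab c n i).
Proof.
by elim: n i => [|n IH] i /=; (apply: Del_and; first exact: Del_cE); del;
  first [exact: Del_cE | exact: IH].
Qed.

Lemma Del_tag n : Del (tag n).
Proof. by apply: Del_and; [exact: Del_bit|del; exact: Del_bit]. Qed.

Lemma Del_code n : Del (code n).
Proof.
by apply: Del_and3; [exact: Del_tag|exact: Del_valid|exact: Del_clab].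
Qed.

(** * Well-foundedness and the complexity of the code sets *)

Lemma wf_descending (lt : nat -> nat -> bool) (d : nat -> nat) :
  well_founded (fun i j => lt i j) -> ~ forall n, lt (d n.+1) (d n).
Proof.
move=> wf hd; suff : forall k n, d n = k -> False by move/(_ (d 0) 0 erefl).
by elim/(well_founded_ind wf) => k IH n dn; apply: (IH (d n.+1)); rewrite -?dn.
Qed.

Lemma not_wf_descending (lt : nat -> nat -> bool) :
  ~ well_founded (fun i j => lt i j) -> exists d : nat -> nat, forall n, lt (d n.+1) (d n).
Proof.
move=> nwf; have [k nk] : exists k, ~ Acc (fun i j => lt i j) k by exact/existsNP.
pose P s := path (fun x y => lt y x) k s /\ ~ Acc (fun i j => lt i j) (last k s).
have P0 : P [::] by [].
have PS s : P s -> exists x, P (rcons s x).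
  move=> [ps ns]; apply: contrapT => no; apply: ns; constructor=> y yl.
  apply: contrapT => ny; apply: no; exists y; rewrite /P rcons_path last_rcons.
  by split=> //; rewrite ps.
have [z hz] := dep_choice P0 PS.
exists (fun n => if n is m.+1 then z m else k) => n.
have [/(pathP 0) p _] := hz n.+1; have := p n; rewrite size_mkseq nth_mkseq //.
case: n p => [|n] p /(_ (ltnSn _)) //; rewrite -[nth 0 (_ :: _) n.+1]/(nth 0 (mkseq z n.+2) n).
by rewrite nth_mkseq.
Qed.

(** [code] is bi-Souslin, so only ill-foundedness needs a witness, and a descending sequence is one
    directly. *)
Lemma Sou_compl_Cset n : Sou (fun c => ~ Cset n c).
Proof.
apply: (@Sou_ext (fun c => ~ code n c \/
    exists d : nat -> nat, forall k, clt c (d k.+1) (d k))).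
  move=> c; split=> [[nc [//]|[d hd] [_ wf]]|nC].
    exact: wf_descending wf hd.
  have [cc|] := pselect (code n c); [right|by left].
  by apply: not_wf_descending => wf; apply: nC.
apply: Sou_or; first by have [] := Del_code n.
exists (fun c w => forall k, clt c (w k.+1) (w k)) => // c w hk k.
set m := (pickle (inl (inl (inl (inl (w k.+1, w k)))) : ckey)).*2.+1.
have [c' [w' [h cc ww]]] := hk (maxn m k.+1).+1.
have mk1 : (k < (maxn m k.+1).+1)%N by rewrite ltnS leq_max (ltnW (ltnSn _)) orbT.
have mk2 : (k.+1 < (maxn m k.+1).+1)%N by rewrite ltnS leq_max leqnn orbT.
have := h k; rewrite -(ww _ mk1) -(ww _ mk2) /clt /cbit -/m.
by rewrite -cc // ltnS leq_maxl.
Qed.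

Lemma branch_no_rank q a z x : branch q a z -> ~ rkb (tree q a) x [::].
Proof.
move=> bz; suff H n : ~ rkb (tree q a) x (mkseq z n) by exact: (H 0).
elim/ens_in_ind: x n => x IH n /rkbE /(_ (z n)); rewrite -mkseqS.
by case=> [|y [yx hy]]; [exact: bz|exact: IH yx _ hy].
Qed.

Lemma valid_wf c a : valid c -> isrk (clt c) a 0 -> well_founded (fun i j => clt c i j).
Proof.
move=> [wo_ top _ _ _] /isrk_acc acc0 i; constructor=> j ji.
have /orP [j0|/top //] := wo_.2 _ _ 0 ji.
by case: acc0 => /(_ j j0).
Qed.

Lemma cont_pr (f g : real -> real) : cont f -> cont g -> cont (fun x => pr (f x) (g x)).
Proof.
move=> cf cg x k; have [l hl] := cf x k; have [m hm] := cg x k.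
exists (maxn l m) => y xy; apply: agree_pr.
  by apply: hl; exact: agreeW (leq_maxl l m) xy.
by apply: hm; exact: agreeW (leq_maxr l m) xy.
Qed.

Lemma Sou_pre2 (A : real -> real -> Prop) f g : Sou (fun p => A (p1 p) (p2 p)) ->
  cont f -> cont g -> Sou (fun x => A (f x) (g x)).
Proof.
move=> sA cf cg; apply: Sou_ext (Sou_preim (cont_pr cf cg) sA) => x.
by rewrite p1_pr p2_pr.
Qed.

Lemma Del_bisim f g h : cont f -> cont g -> cont h ->
  Del (fun x => bisim (clt (f x)) (rrel (g x)) (rrel (h x)) /\ rrel (h x) 0 0).
Proof.
move=> cf cg ch.
have Df i j : Del (fun x => clt (f x) i j) by exact: (Del_preim cf (Del_clt i j)).
have Dg i j : Del (fun x => rrel (g x) i j) by exact: (Del_preim cg (Del_bit _)).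
have Dh i j : Del (fun x => rrel (h x) i j) by exact: (Del_preim ch (Del_bit _)).
apply: Del_and; last exact: Dh.
apply: Del_all => i; apply: Del_all => k; apply: Del_imp; first exact: Dh.
by apply: Del_and; apply: Del_all => j; apply: Del_imp => //; apply: Del_ex => l;
  apply: Del_and.
Qed.

Lemma Del_same f g : cont f -> cont g ->
  Del (fun x => forall k l, rrel (f x) k l <-> clt (g x) k l).
Proof.
move=> cf cg; apply: Del_all => k; apply: Del_all => l.
by apply: Del_iff; [exact: (Del_preim cf (Del_bit _))|exact: (Del_preim cg (Del_clt k l))].
Qed.

(** * The diagonal argument *)

Section Core.
Hypothesis VL : V_eq_L.
(** [G] is the graph of the reduction read on reals; it may be partial, since images may leave the
    Cantor set. *)
Variables (n : nat) (b : set nat) (G : real -> real -> Prop).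
Hypotheses (sG : Sou (fun p => G (p1 p) (p2 p))).
Hypotheses (Gfun : forall z y y', G z y -> G z y' -> y = y').
Hypotheses (bn : ~ b n).
Hypotheses (Gred : forall z, tag n z ->
  (Cset n z <-> exists y, G z y /\ exists m, b m /\ Cset m y)).

(* [c] codes the ordinal of [a], and [r] is the order of the image of [c]. *)
Let image_order (a r : real) : Prop := exists u, let c := p1 u in let y := p1 (p2 u) in
  let Q := p2 (p2 u) in
  [/\ code n c, bisim (clt c) (rrel a) (rrel Q) /\ rrel Q 0 0, G c y &
      forall k l, rrel r k l <-> clt y k l].

(* [r] is the order of some [x] whose image codes the ordinal of [a]. *)
Let source_order (a r : real) : Prop := exists u, let x := p1 u in let y := p1 (p2 u) in
  let Q := p2 (p2 u) in
  [/\ tag n x, exists m, b m /\ code m y,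
      bisim (clt y) (rrel a) (rrel Q) /\ rrel Q 0 0, G x y &
      forall k l, rrel r k l <-> clt x k l].

Let Sou_image_order : Sou (fun p => image_order (p1 p) (p2 p)).
Proof.
apply: (@Sou_exr2 (fun p u => let c := p1 u in let y := p1 (p2 u) in
  let Q := p2 (p2 u) in
  [/\ code n c, bisim (clt c) (rrel (p1 p)) (rrel Q) /\ rrel Q 0 0, G c y &
      forall k l, rrel (p2 p) k l <-> clt y k l])).
have c1 := cont_p1; have c2 := cont_p2.
have cc := cont_comp c1 c2; have cy := cont_comp c1 (cont_comp c2 c2).
have cQ := cont_comp c2 (cont_comp c2 c2).
apply: Sou_ext (Sou_and (Del_preim cc (Del_code n)).1 (Sou_and
  (Del_bisim cc (cont_comp c1 c1) cQ).1 (Sou_and (Sou_pre2 sG cc cy)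
  (Del_same (cont_comp c2 c1) cy).1))) => p.
by split=> [[? [? []]]|[]].
Qed.

Let Sou_source_order : Sou (fun p => source_order (p1 p) (p2 p)).
Proof.
apply: (@Sou_exr2 (fun p u => let x := p1 u in let y := p1 (p2 u) in
  let Q := p2 (p2 u) in
  [/\ tag n x, exists m, b m /\ code m y,
      bisim (clt y) (rrel (p1 p)) (rrel Q) /\ rrel Q 0 0, G x y &
      forall k l, rrel (p2 p) k l <-> clt x k l])).
have c1 := cont_p1; have c2 := cont_p2.
have cc := cont_comp c1 c2; have cy := cont_comp c1 (cont_comp c2 c2).
have cQ := cont_comp c2 (cont_comp c2 c2).
have D : Del (fun y => exists m, b m /\ code m y).
  by apply: Del_ex => m; apply: Del_and; [exact: Del_const|exact: Del_code].
apply: Sou_ext (Sou_and (Del_preim cc (Del_tag n)).1 (Sou_and (Del_preim cy D).1 (Sou_and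
  (Del_bisim cy (cont_comp c1 c1) cQ).1 (Sou_and (Sou_pre2 sG cc cy)
  (Del_same (cont_comp c2 c1) cc).1)))) => p.
by split=> [[? [? [? []]]]|[]].
Qed.

Let relreal (Q : nat -> nat -> Prop) : real := fun m =>
  if unpickle m is Some (k, l) then `[< Q k l >] else false.

Let relrealE Q k l : rrel (relreal Q) k l <-> Q k l.
Proof. by rewrite /rrel /relreal pickleK; split=> /asboolP. Qed.

Let bisim_ex lt a x : isrk lt x 0 -> isrk (rrel a) x 0 ->
  exists Q, bisim lt (rrel a) (rrel Q) /\ rrel Q 0 0.
Proof.
move=> lx ax; exists (relreal (fun i k => exists x, isrk lt x i /\ isrk (rrel a) x k)).
split; last by apply/relrealE; exists x.
move=> i k /relrealE /bisim_isrk [h1 h2]; split=> [j /h1|l /h2] [l' [h3 h4]];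
  by exists l'; split=> //; exact/relrealE.
Qed.

Lemma no_reduction : False.
Proof.
have [q2 q2E] := Sou_universal Sou_image_order.
(* With the identity as relation, [q3] over an order searches for a descending sequence in that very
   order. *)
have [|q3 [q3b q3r]] := @rank_tree (fun a r => forall m, a m <-> r m).
  suff : Del (fun p => forall m, p1 p m <-> p2 p m) by case.
  by apply: Del_all => m; apply: Del_iff; exact: Del_bit.
have [q4 [q4b q4r]] := rank_tree Sou_source_order.
have [g [cg hg]] := Rl_collect VL (fun i => if i is 0 then q2 else if i is 1 then q3 else q4).
have [a [ca ga la]] := lab_unbounded VL n cg.
have [a' [ca' aa' Ea' next]] := Eo_next VL ca.
have ga' : ens_in g a' by exact: ord_trans ca'.1 ga aa'.
have [c0 [Cc0 c0a]] := code_ex ca la.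
have [p [pa' pa]] := Ea'.2 a aa'.
have [y0 [Gy0 _]] := (Gred (let: conj (And3 t _ _) _ := Cc0 in t)).1 Cc0.
have [Q0 Q0b] := bisim_ex c0a pa.
(* [c0] and its image give a branch over [p], so this tree has no rank bound and stage [a'] must
   contain the image order [r] of some code [c] of α. *)
have /q2E [z0 bz0 _] : image_order p (relreal (fun k l => clt y0 k l)).
  exists (pr c0 (pr y0 Q0)); rewrite /= !p1_pr !p2_pr !p1_pr; split=> //.
  by have [] := Cc0.
have [[x [_ hx]]|[r [r' [ra' _ pr']]]] := Ea'.1 q2 p (Rl_mono ca'.1 ga' (hg 0)) pa'.
  exact: branch_no_rank bz0 hx.
have [z bz zr] := pruned_branch pr'.
have [u [codec bis Gcy rE]] : image_order p r by apply/q2E; exists z.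
set c := p1 u in codec bis Gcy; set y := p1 (p2 u) in Gcy rE; set Q := p2 (p2 u) in bis.
have ac : isrk (clt c) a 0 by exact: isrk_bisim bis.1 bis.2 pa.
have wfc : well_founded (fun i j => clt c i j).
  by case: codec => _ vc _; exact: valid_wf vc ac.
have tagc : tag n c by case: codec.
have [y' [Gy' [m [bm Cy]]]] := (Gred tagc).1 (conj codec wfc).
rewrite -(Gfun Gcy Gy') in Cy.
have [[_ vy ly] wfy] := Cy.
have rrE : rrel r = clt y.
  by apply/funext => k; apply/funext => l; apply/idP/idP => /rE.
have [ o ro] := ranks_ex wfy.
have oy := ranks_ord (let: And5 w _ _ _ _ := vy in w) ro 0.
move/(clabP vy wfy ro): ly => ly.
(* [r] lies in stage [a'] and is well-founded, so the tree of its descending sequences has a rank in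
   [a'], which bounds the ordinal of [y]. *)
have ya' : ens_in (o 0) a'.
  have [[x [xa' hx]]|[s [s' [_ _ ps]]]] := Ea'.1 q3 r (Rl_mono ca'.1 ga' (hg 1)) ra'.
    have /(isrk_rkle (isrk_ranks 0 ro)) nx : rkle (clt y) x 0.
      by rewrite -rrE; exact: q3r hx.
    have [xo|xo|ox] := ord_trich (ord_in ca'.1 xa') oy.
    - by case: nx.
    - exact: ens_in_eql xo xa'.
    - exact: ord_trans ca'.1 ox xa'.
  have [z1 /q3b [s1 [d [rs _ hd]]] _] := pruned_branch ps.
  exfalso; apply: (wf_descending (d := d) wfy) => k; rewrite -rrE.
  by apply/rs; exact: hd.
have [ya|ya|ay] := ord_trich oy ca.1.
- have Ea := lab_Eo la; have [p' [pa1 pa2]] := Ea.2 _ ya.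
  have [Q' Q'b] := bisim_ex (isrk_ranks 0 ro) pa2.
  (* A rank [x] below α would bound the order of [c], which is among the sources searched and has
     rank α. *)
  have [[x [xa hx]]|[s [s' [_ _ ps]]]] := Ea.1 q4 p' (Rl_mono ca.1 ga (hg 2)) pa1.
    suff /q4r /(_ x hx) h : source_order p' (relreal (fun k l => clt c k l)).
      have E : rrel (relreal (fun k l => clt c k l)) = clt c.
        apply/funext => k; apply/funext => l; apply/idP/idP; first by move/relrealE.
        by move=> h'; apply/relrealE.
      by rewrite E in h; exact: isrk_rkle ac h xa.
    exists (pr c (pr y Q')); rewrite /= !p1_pr !p2_pr !p1_pr; split=> //.
    by exists m; split=> //; case: Cy.
  (* A branch gives an ill-founded real of tag [n]. Its image is bisimilar to the ordinal presented
     by [p'], hence well-founded, so [Gred] makes the source a genuine code. *)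
  have [z1 /q4b [s1 [d [[v [tx [m' [bm' cy']] bis' Gxy sE]] _ hd]]] _] := pruned_branch ps.
  have wfy' : well_founded (fun i j => clt (p1 (p2 v)) i j).
    by case: (cy') => _ vy' _; apply: valid_wf vy' (isrk_bisim bis'.1 bis'.2 pa2).
  have [_ wfx] : Cset n (p1 v).
    by apply/(Gred tx); exists (p1 (p2 v)); split=> //; exists m'.
  by apply: (wf_descending (d := d) wfx) => k; apply/sE; exact: hd.
- by apply: bn; rewrite (lab_inj oy (lab_eq (ens_eq_sym ya) la) ly).
- exact: next ya' ay (lab_Eo ly).
Qed.

End Core.

Local Open Scope ring_scope.

(** * A Cantor scheme in an uncountable Polish space *)

Definition eps (R : realType) (k : nat) : R := (k.+1%:R)^-1.
Arguments eps {R} k : simpl never.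

Lemma eps_lt (R : realType) (e : R) : 0 < e -> exists k, eps k < e.
Proof.
move=> e0; exists (Num.bound e^-1).
rewrite /eps -[ltRHS]invrK ltf_pV2 ?posrE ?invr_gt0 // ?ltr0n //.
apply: lt_trans (archi_boundP _) _; first by rewrite invr_ge0 ltW.
by rewrite ltr_nat.
Qed.

Lemma eps_gt0 (R : realType) k : 0 < eps k :> R.
Proof. by rewrite invr_gt0 ltr0n. Qed.

Lemma eps_le (R : realType) j k : (j <= k)%N -> eps k <= eps j :> R.
Proof. by move=> jk; rewrite lef_pV2 ?posrE ?ltr0n // ler_nat. Qed.

Section Metric.
Variables (R : realType) (X : topologicalType) (d : X -> X -> R).
Hypotheses (dm : is_metric d) (dt : metric_induces_topology d).

Lemma met_refl x : d x x = 0.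
Proof. by case: dm => h _ _; exact/h. Qed.

Lemma met_sym x y : d x y = d y x.
Proof. by case: dm. Qed.

Lemma met_tri y x z : d x z <= d x y + d y z.
Proof. by case: dm. Qed.

Lemma met_ge0 x y : 0 <= d x y.
Proof. have := met_tri y x x; rewrite met_refl (met_sym y x); lra. Qed.

Lemma met_eq x y : (forall k, d x y <= eps k) -> x = y.
Proof.
move=> h; case: dm => d0 _ _; apply/d0; apply/eqP; rewrite eq_le met_ge0 andbT.
rewrite leNgt; apply/negP => /eps_lt [k hk].
by have := h k; rewrite leNgt hk.
Qed.

Lemma met_nbhs x (e : R) : 0 < e -> nbhs x [set y | d x y < e].
Proof. by move=> e0; apply/dt; exists e. Qed.

Lemma met_closed (A : set X) : closed A <->
  forall x, (forall e, 0 < e -> exists y, A y /\ d x y < e) -> A x.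
Proof.
split=> [cA x h|h x cx].
  apply: cA => B /dt [e e0 eB]; have [y [Ay xy]] := h e e0.
  by exists y; split=> //; exact: eB.
apply: h => e e0; have [y [Ay xy]] := cx _ (met_nbhs x e0).
by exists y.
Qed.

Lemma met_open (A : set X) : open A <-> forall x, A x -> exists2 e, 0 < e & [set y | d x y < e] `<=` A.
Proof.
rewrite openE; split=> [h x /h /dt //|h x /h ?].
by rewrite /interior; exact/dt.
Qed.

Lemma closed_ball x (e : R) : closed [set y | d x y <= e].
Proof.
apply/met_closed => y h /=; rewrite leNgt; apply/negP => lt_e.
have [|z [/= xz yz]] := h (d x y - e); first by rewrite subr_gt0.
have := met_tri z x y; rewrite (met_sym z y); lra.
Qed.

Lemma open_ball x (e : R) : open [set y | d x y < e].
Proof.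
apply/met_open => y /= xy; exists (e - d x y); first by rewrite subr_gt0.
by move=> z /=; have := met_tri y x z; lra.
Qed.

Lemma open_Fsigma_met (A : set X) : open A -> Fsigma A.
Proof.
move=> /met_open oA.
exists (fun k => [set x | forall y, d x y < eps k -> A y]).
  move=> k; apply/met_closed => x h y xy.
  have [|z [hz xz]] := h (eps k - d x y); first by rewrite subr_gt0.
  by apply: hz; have := met_tri x z y; rewrite (met_sym z x); lra.
apply/seteqP; split=> x.
  move=> /oA [e e0 eA]; have [k ke] := eps_lt e0; exists k => // y xy.
  by apply: eA => /=; lra.
by move=> [k _ hk]; apply: hk; rewrite met_refl eps_gt0.
Qed.

Variable D : set X.
Hypotheses (cD : countable D) (dD : dense D).

Lemma met_dense x (e : R) : 0 < e -> exists2 u, D u & d x u < e.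
Proof.
move=> e0; have [|u [xu Du]] := dD _ (open_ball x e); first by exists x; rewrite /= met_refl.
by exists u.
Qed.

(** Cantor-Bendixson: [N] gathers the countable traces of [A] on countably many basic balls, and any
    point of [A] with a countable neighbourhood in [A] falls into it. *)
Lemma condensation_points (A : set X) : ~ countable A ->
  exists N : set X, countable N /\
    forall x, A x -> ~ N x -> forall e, 0 < e -> ~ countable (A `&` [set y | d x y <= e]).
Proof.
move=> ncA.
pose P u k := A `&` [set y | d u y < eps k].
pose N := \bigcup_(u in D) \bigcup_k [set y | countable (P u k) /\ P u k y].
exists N; split.
  apply: bigcup_countable => // u _; apply: bigcup_countable => // k _.
  have [cP|nP] := pselect (countable (P u k)).
    by apply: sub_countable cP; apply: subset_card_le => y [].
  by rewrite (_ : [set y | _] = set0) //; apply/seteqP; split=> // y [].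
move=> x Ax nNx e e0 cA; have e20 : 0 < e / 2 by rewrite divr_gt0.
have [k ke] := eps_lt e20; have [u Du xu] := met_dense x (eps_gt0 R k).
apply: nNx; exists u => //; exists k => //; split; last by split=> //=; rewrite met_sym.
apply: sub_countable cA; apply: subset_card_le => y [Ay /= uy]; split=> //=.
by have := met_tri u x y; lra.
Qed.

Lemma uncountable_split (A : set X) (e : R) : 0 < e -> closed A -> ~ countable A ->
  exists A0 A1 : set X,
  [/\ [/\ closed A0, ~ countable A0 & A0 `<=` A], [/\ closed A1, ~ countable A1 & A1 `<=` A],
      A0 `&` A1 = set0, forall x y, A0 x -> A0 y -> d x y <= e &
      forall x y, A1 x -> A1 y -> d x y <= e].
Proof.
move=> e0 clA ncA; have [N [cN hN]] := condensation_points ncA.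
have pt (M : set X) : countable M -> exists x, A x /\ ~ M x.
  move=> cM; apply: contrapT => no; apply: ncA; apply: sub_countable cM.
  by apply: subset_card_le => x Ax; apply: contrapT => nM; apply: no; exists x.
have [a [Aa na]] := pt N cN.
have [|b [Ab nb]] := pt (N `|` [set a]).
  rewrite -bigcup2E; apply: bigcup_countable => // -[|[|n]] _ /=.
  - exact: cN.
  - exact: countable1.
  - exact: countable0.
have ab : 0 < d a b.
  rewrite lt_neqAle met_ge0 andbT eq_sym; apply/eqP; case: dm => h _ _ /h ab.
  by apply: nb; right.
(* Diameters are at most 2r, below [e], and centres at distance at least 3r keep the closed balls
   disjoint. *)
pose r := Num.min e (d a b) / 3.
have r0 : 0 < r by rewrite divr_gt0 // lt_min e0 ab.
have re : r * 3 <= e by rewrite /r divfK // ge_min lexx.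
have rab : r * 3 <= d a b by rewrite /r divfK // ge_min lexx orbT.
have nb' : ~ N b by move=> Nb; apply: nb; left.
have dia c x y : d c x <= r -> d c y <= r -> d x y <= e.
  by move=> cx cy; have := met_tri c x y; rewrite (met_sym x c); lra.
exists (A `&` [set y | d a y <= r]), (A `&` [set y | d b y <= r]); split.
- by split; [apply: closedI => //; exact: closed_ball|exact: hN|move=> ? []].
- by split; [apply: closedI => //; exact: closed_ball|exact: hN|move=> ? []].
- apply/seteqP; split=> // x [[_ /= ax] [_ /= bx]].
  by have := met_tri x a b; rewrite (met_sym x b); lra.
- by move=> x y [_ /= ax] [_ /= ay]; exact: dia ax ay.
- by move=> x y [_ /= ax] [_ /= ay]; exact: dia ax ay.
Qed.

Hypothesis dc : metric_complete d.
Hypothesis ncX : ~ countable [set: X].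

Let S := {A : set X | closed A /\ ~ countable A}.

Let split_fun : exists f : S -> nat -> bool -> S, forall (A : S) k b,
  [/\ sval (f A k b) `<=` sval A,
      forall x, sval (f A k b) x -> ~ sval (f A k (~~ b)) x &
      forall x y, sval (f A k b) x -> sval (f A k b) y -> d x y <= eps k].
Proof.
have /choice [f hf] : forall u : S * nat, exists g : bool -> S, forall b,
  [/\ sval (g b) `<=` sval u.1,
      forall x, sval (g b) x -> ~ sval (g (~~ b)) x &
      forall x y, sval (g b) x -> sval (g b) y -> d x y <= eps u.2].
  move=> [[A [clA ncA]] k] /=.
  have [A0 [A1 [[c0 n0 s0] [c1 n1 s1] dis d0 d1]]] := uncountable_split (eps_gt0 R k) clA ncA.
  have dis' x : A0 x -> ~ A1 x by move=> h0 h1; suff : set0 x by []; rewrite -dis.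
  exists (fun b => if b then exist _ A1 (conj c1 n1) else exist _ A0 (conj c0 n0)).
  by case; split=> //= x h1 h0; exact: dis' h0 h1.
by exists (fun A k => f (A, k)) => A k b; exact: (hf (A, k)).
Qed.

(** [W c k] is the piece of the scheme indexed by the first [k] bits of [c]. *)
Lemma cantor_scheme : exists (W : real -> nat -> set X) (e : real -> X),
  [/\ forall c k, closed (W c k) /\ W c k.+1 `<=` W c k,
      forall k c c', agree k c c' -> W c k = W c' k,
      forall c c' k x, W c k x -> W c' k x -> agree k c c',
      forall c x, x = e c <-> forall k, W c k x &
      forall c (t : R), 0 < t -> exists k, forall c', agree k c c' -> d (e c) (e c') < t].
Proof.
have [f hf] := split_fun.
pose S0 : S := exist _ setT (conj closedT ncX).
pose V (c : real) := fix V k : S := if k is l.+1 then f (V l) l (c l) else S0.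
pose W c k : set X := sval (V c k).
have Wag k c c' : agree k c c' -> V c k = V c' k.
  elim: k => //= k IH cc; rewrite IH; last exact: agreeW (leqnSn k) cc.
  by rewrite cc.
have Wsub c k l : (k <= l)%N -> W c l `<=` W c k.
  elim: l => [|l IH]; first by rewrite leqn0 => /eqP ->.
  rewrite leq_eqVlt => /orP [/eqP -> //|/IH h] x Wx; apply: h.
  by have [h _ _] := hf (V c l) l (c l); exact: h.
have Wdis c c' k x : W c k x -> W c' k x -> agree k c c'.
  elim: k => [|k IH] // Wc Wc'.
  have ag := IH (Wsub c _ _ (leqnSn k) _ Wc) (Wsub c' _ _ (leqnSn k) _ Wc').
  move=> i; rewrite ltnS leq_eqVlt => /orP [/eqP ->|]; last exact: ag.
  apply: contrapT => ne; have [_ h _] := hf (V c k) k (c k).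
  apply: (h x Wc); move: Wc'; rewrite /W /= -(Wag k c c' ag).
  by have -> : c' k = ~~ c k by case: (c k) (c' k) ne => [] [].
(* Level 0 is the whole space, so the diameter bounds start one level later. *)
have Wdia c k x y : W c k.+1 x -> W c k.+1 y -> d x y <= eps k.
  by have [_ _ h] := hf (V c k) k (c k); exact: h.
have Wcl c k : closed (W c k) by have [] := svalP (V c k).
have Wne c k : exists x, W c k x.
  apply: contrapT => no; have [_] := svalP (V c k); apply.
  suff -> : sval (V c k) = set0 by [].
  by apply/seteqP; split=> // x Wx; apply: no; exists x.
have Wlim c : exists x, forall k, W c k x.
  have [u hu] := choice (Wne c).
  have [|l hl] := dc (u := u).
    move=> e e0; have [k ke] := eps_lt e0; exists k.+1 => m n mk nk.
    apply: le_lt_trans ke; apply: (Wdia c).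
      exact: Wsub mk _ (hu m).
    exact: Wsub nk _ (hu n).
  exists l => k; apply: (met_closed (W c k)).1 => // e e0.
  have [N hN] := hl e e0; exists (u (maxn N k)); split.
    exact: Wsub (leq_maxr N k) _ (hu _).
  by rewrite met_sym; apply: hN; exact: leq_maxl.
have [e he] := choice Wlim.
exists W, e; split=> //.
- by move=> c k; split=> //; exact: Wsub (leqnSn k).
- by move=> k c c' cc; rewrite /W (Wag k c c' cc).
- move=> c x; split=> [-> //|hx]; apply: met_eq => k; exact: (Wdia c).
- move=> c t t0; have [k ke] := eps_lt t0; exists k.+1 => c' cc.
  apply: le_lt_trans ke; apply: (Wdia c) => //.
  by rewrite /W (Wag _ _ _ cc); exact: he.
Qed.

End Metric.

(** * Closed subsets of X × ω^ω as Polish spaces *)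

Definition mtop (R : realType) (T : Type) (d : T -> T -> R) (dm : is_metric d) : Type := T.

Section MetricTopology.
Variables (R : realType) (T : Type) (d : T -> T -> R) (dm : is_metric d).
Local Notation Y := (mtop dm).

HB.instance Definition _ := gen_eqMixin Y.
HB.instance Definition _ := gen_choiceMixin Y.

Definition mnbhs (x : Y) : set_system Y :=
  [set A | exists2 e : R, 0 < e & [set y : Y | d x y < e] `<=` A].

HB.instance Definition _ := hasNbhs.Build Y mnbhs.

Let d0 x : d x x = 0. Proof. by case: dm => h _ _; exact/h. Qed.
Let dtri y x z : d x z <= d x y + d y z. Proof. by case: dm. Qed.

Lemma mnbhs_filter (x : Y) : ProperFilter (nbhs x).
Proof.
apply: Build_ProperFilter_ex.
  by move=> A [e e0 eA]; exists x; apply: eA => /=; rewrite d0.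
split.
- by exists 1.
- move=> A B [e e0 eA] [f f0 fB]; exists (Num.min e f); first by rewrite lt_min e0.
  by move=> y /=; rewrite lt_min => /andP [h1 h2]; split; [exact: eA|exact: fB].
- by move=> A B AB [e e0 eA]; exists e => // y /eA /AB.
Qed.

Lemma mnbhs_singleton (x : Y) (A : set Y) : nbhs x A -> A x.
Proof. by move=> [e e0 eA]; apply: eA => /=; rewrite d0. Qed.

Lemma mnbhs_nbhs (x : Y) (A : set Y) : nbhs x A -> nbhs x (nbhs^~ A).
Proof.
move=> [e e0 eA]; exists e => // y /= xy; exists (e - d x y); first by rewrite subr_gt0.
by move=> z /= yz; apply: eA => /=; have := dtri y x z; lra.
Qed.

HB.instance Definition _ :=
  Nbhs_isNbhsTopological.Build Y mnbhs_filter mnbhs_singleton mnbhs_nbhs.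

Lemma mtop_induces : metric_induces_topology (X := Y) d.
Proof. by []. Qed.

End MetricTopology.

Section Baire.
Variable R : realType.

Definition first_eps (P : nat -> bool) : R :=
  if pselect (exists n, P n) is left h then eps (ex_minn h) else 0.

Definition seqd (w w' : nat -> nat) : R := first_eps (fun n => w n != w' n).

(** A first difference at place n means distance [eps n], so distance below [eps k] forces agreement
    through place k itself. *)
Lemma seqd_agree w w' k : seqd w w' < eps k <-> agree k.+1 w w'.
Proof.
rewrite /seqd /first_eps; case: pselect => [h|no]; last first.
  split=> [_ i _|_]; last exact: eps_gt0.
  by apply/eqP; apply: contrapT => /negP ne; apply: no; exists i.
case: ex_minnP => n ne hmin; split=> [lt_nk i ik|ag].
  apply/eqP; apply: contrapT => /negP nei; have ni := hmin i nei.
  have /(eps_le R) : (n <= k)%N by rewrite -ltnS (leq_ltn_trans ni).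
  by rewrite leNgt lt_nk.
have kn : (k < n)%N.
  by rewrite ltnNge; apply/negP => nk; move/eqP: ne; apply; apply: ag.
by rewrite ltf_pV2 ?posrE ?ltr0n // ltr_nat ltnS.
Qed.

Lemma seqd_refl w : seqd w w = 0.
Proof. by rewrite /seqd /first_eps; case: pselect => // h; exfalso; case: h => n; rewrite eqxx. Qed.

Lemma seqd_ge0 w w' : 0 <= seqd w w'.
Proof. by rewrite /seqd /first_eps; case: pselect => // h; exact: ltW (eps_gt0 R _). Qed.

Lemma seqd_eq0 w w' : seqd w w' = 0 -> w = w'.
Proof.
move=> h; apply/funext => n; have /seqd_agree : seqd w w' < eps n by rewrite h eps_gt0.
by apply.
Qed.

Lemma seqd_sym w w' : seqd w w' = seqd w' w.
Proof.
by congr first_eps; apply/funext => n; rewrite eq_sym.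
Qed.

Lemma seqd_tri v u w : seqd u w <= seqd u v + seqd v w.
Proof.
rewrite {1}/seqd /first_eps; case: pselect => [h|no]; last by rewrite addr_ge0 // seqd_ge0.
case: ex_minnP => n ne _; rewrite leNgt; apply/negP => lt_n.
have /seqd_agree /(_ n (ltnSn n)) e1 : seqd u v < eps n.
  by have := seqd_ge0 v w; lra.
have /seqd_agree /(_ n (ltnSn n)) e2 : seqd v w < eps n.
  by have := seqd_ge0 u v; lra.
by rewrite e1 e2 eqxx in ne.
Qed.

End Baire.

Section ClosedProjection.
Variables (R : realType) (X : topologicalType) (d : X -> X -> R).
Hypotheses (dm : is_metric d) (dt : metric_induces_topology d) (dc : metric_complete d).
Variables (D : set X) (cD : countable D) (dD : dense D).
Variable G : X -> (nat -> nat) -> Prop.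
Hypothesis clG : forall x w,
  (forall k, exists x' w', [/\ G x' w', d x x' < eps k & agree k w w']) -> G x w.

Let T := {p : X * (nat -> nat) | G p.1 p.2}.
Let dT (p q : T) : R := d (sval p).1 (sval q).1 + seqd R (sval p).2 (sval q).2.

Let dT_metric : is_metric dT.
Proof.
split.
- move=> [[x w] g] [[y v] g'] /=; split=> [h|[xy wv]]; last first.
    by rewrite /dT /= xy wv (met_refl dm) seqd_refl addr0.
  have h1 : d x y = 0 by have := met_ge0 dm x y; have := seqd_ge0 R w v; rewrite /dT /= in h; lra.
  have h2 : seqd R w v = 0 by rewrite /dT /= h1 add0r in h.
  have xy : x = y by case: dm => h' _ _; exact/h'.
  have wv := seqd_eq0 h2; subst y v; congr exist; exact: Prop_irrelevance.
- by move=> p q; rewrite /dT (met_sym dm) seqd_sym.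
- move=> p q r; rewrite /dT; have := met_tri dm (sval q).1 (sval p).1 (sval r).1.
  by have := seqd_tri R (sval q).2 (sval p).2 (sval r).2; lra.
Qed.

Let Y : topologicalType := mtop dT_metric.

Let Y_polish : polish R Y.
Proof.
split; last first.
  exists dT; split; [exact: dT_metric|exact: (@mtop_induces R T dT dT_metric)|].
  move=> u hu.
  have [|x hx] := dc (u := fun n => (sval (u n)).1).
    move=> e e0; have [N hN] := hu e e0; exists N => m n mN nN.
    have := hN m n mN nN; have := seqd_ge0 R (sval (u m)).2 (sval (u n)).2.
    by rewrite /dT; lra.
  have /choice [N hN] : forall k, exists N, forall m n, (N <= m)%N -> (N <= n)%N ->
      agree k.+1 (sval (u m)).2 (sval (u n)).2.
    move=> k; have [N hN] := hu _ (eps_gt0 R k); exists N => m n mN nN.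
    apply/(seqd_agree R); have := hN m n mN nN.
    by have := met_ge0 dm (sval (u m)).1 (sval (u n)).1; rewrite /dT; lra.
  (* A diagonal limit: coordinate [k] no longer changes from [N k] on. *)
  pose w k := (sval (u (N k))).2 k.
  have hw k n : (forall i, (i <= k)%N -> (N i <= n)%N) -> agree k.+1 (sval (u n)).2 w.
    by move=> h i ik; apply: (hN i) => //; exact: h.
  have Nbig k : exists M, forall i, (i <= k)%N -> (N i <= M)%N.
    by have [M hM] := nat_bound N k.+1; exists M => i ik; apply: ltnW; exact: hM.
  have Gxw : G x w.
    apply: clG => k; have [M hM] := Nbig k; have [M' hM'] := hx _ (eps_gt0 R k).
    have g := svalP (u (maxn M M')).
    exists (sval (u (maxn M M'))).1, (sval (u (maxn M M'))).2; split=> //.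
      by rewrite (met_sym dm); apply: hM'; exact: leq_maxr.
    move=> i ik; rewrite -(hw k (maxn M M')) //; last exact: ltnW.
    by move=> j /hM jM; exact: leq_trans jM (leq_maxl _ _).
  exists (exist _ (x, w) Gxw) => e e0; have e20 : 0 < e / 2 by rewrite divr_gt0.
  have [k ke] := eps_lt e20; have [M hM] := Nbig k; have [M' hM'] := hx _ e20.
  exists (maxn M M') => n; rewrite geq_max => /andP [Mn M'n]; rewrite /dT /=.
  have := hM' n M'n; have /(seqd_agree R) : agree k.+1 (sval (u n)).2 w.
    by apply: hw => i /hM iM; exact: leq_trans iM Mn.
  by lra.
(* A dense set of the product may miss the closed subset, so one point is picked from each basic box
   that meets it. *)
pose P (v : X) (k : nat) (s : seq nat) (p : Y) :=
  d v (sval p).1 < eps k /\ mkseq (sval p).2 (size s) = s.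
have /choice [f hf] : forall u : X * nat * seq nat, exists A : set Y,
    countable A /\ ((exists p, P u.1.1 u.1.2 u.2 p) -> exists2 p, A p & P u.1.1 u.1.2 u.2 p).
  move=> u; have [[p hp]|no] := pselect (exists p, P u.1.1 u.1.2 u.2 p).
    by exists [set p]; split=> [|_]; [exact: countable1|exists p].
  by exists set0; split=> [|/no //]; exact: countable0.
exists (\bigcup_(u in D `*` [set: nat] `*` [set: seq nat]) f u).
  apply: bigcup_countable => [|u _]; last by have [] := hf u.
  by apply: countableX => //; exact: countableX.
move=> O [p Op]; rewrite openE => /(_ p Op) [e e0 eO].
have e40 : 0 < e / 4 by rewrite divr_gt0.
have [k ke] := eps_lt e40; have [v Dv pv] := met_dense dm dt dD (sval p).1 (eps_gt0 R k).
pose s := mkseq (sval p).2 k.+1.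
have [_ []] := hf (v, k, s).
  by exists p; split; [rewrite /= (met_sym dm)|rewrite size_mkseq].
move=> q Aq [/= vq]; rewrite [X in mkseq _ X](size_mkseq (sval p).2 k.+1) => sq; exists q; split; last by exists (v, k, s).
apply: eO => /=; rewrite /dT.
have /(seqd_agree R) : agree k.+1 (sval p).2 (sval q).2.
  move=> i ik; have := congr1 (fun l => nth 0%N l i) sq.
  by rewrite /s !nth_mkseq.
by have := met_tri dm v (sval p).1 (sval q).1; lra.
Qed.

Lemma analytic_projection : analytic R [set x | exists w, G x w].
Proof.
exists Y, (fun p : Y => (sval p).1); split; first exact: Y_polish.
  move=> p A /dt [e e0 eA]; exists e => // q /= pq; apply: eA => /=.
  by have := seqd_ge0 R (sval p).2 (sval q).2; rewrite /dT in pq; lra.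
apply/seteqP; split=> [x [w g]|x [[[y w] g] _ <-]]; last by exists w.
by exists (exist _ (x, w) g).
Qed.

End ClosedProjection.

(** * Operations on F-sigma sets *)

Lemma Fsigma_bigcup (X : topologicalType) (A : nat -> set X) :
  (forall n, Fsigma (A n)) -> Fsigma (\bigcup_n A n).
Proof.
move=> sA; have /choice [F hF] : forall n, exists F : nat -> set X,
    (forall i, closed (F i)) /\ A n = \bigcup_i F i.
  by move=> n; have [F ? ?] := sA n; exists F.
exists (fun m => if unpickle m is Some (n, k) then F n k else set0).
  move=> m; case: (unpickle m) => [[n k]|]; last exact: closed0.
  by have [h _] := hF n; exact: h.
apply/seteqP; split=> x.
  move=> [n _]; have [_ ->] := hF n => -[k _ xk].
  by exists (pickle (n, k)) => //; rewrite pickleK.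
move=> [m _]; case: (unpickle m) => [[n k] xk|//]; exists n => //.
by have [_ ->] := hF n; exists k.
Qed.

Lemma FsigmaU (X : topologicalType) (A B : set X) : Fsigma A -> Fsigma B -> Fsigma (A `|` B).
Proof.
move=> sA sB; have -> : A `|` B = \bigcup_n (if n is 0%N then A else B).
  apply/seteqP; split=> x; first by move=> [Ax|Bx]; [exists 0%N|exists 1%N].
  by move=> [[|n] _]; [left|right].
by apply: Fsigma_bigcup => -[|n].
Qed.

Lemma FsigmaI (X : topologicalType) (A B : set X) : Fsigma A -> Fsigma B -> Fsigma (A `&` B).
Proof.
move=> [F cF ->] [H cH ->].
have -> : \bigcup_i F i `&` \bigcup_i H i = \bigcup_i \bigcup_j (F i `&` H j).
  apply/seteqP; split=> x.
    by move=> [[i _ Fi] [j _ Hj]]; exists i => //; exists j.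
  by move=> [i _ [j _ [Fi Hj]]]; split; [exists i|exists j].
apply: Fsigma_bigcup => i; apply: Fsigma_bigcup => j.
by apply: closed_Fsigma; exact: closedI.
Qed.

Lemma tag_inj m n c : tag m c -> tag n c -> m = n.
Proof.
move=> [cm hm] [cn hn]; case: (ltngtP m n) => // h.
  by case: (hn m h).
by case: (hm n h).
Qed.

Lemma no_tag m : ~ tag m (fun=> false).
Proof. by case. Qed.

(** * The sets [psi a] inside the Polish space *)

Section Embedding.
Variables (R : realType) (X : topologicalType) (d : X -> X -> R).
Hypotheses (dm : is_metric d) (dt : metric_induces_topology d) (dc : metric_complete d).
Variables (D : set X) (cD : countable D) (dD : dense D).
Variables (W : real -> nat -> set X) (e : real -> X).
Hypotheses (Wcl : forall c k, closed (W c k) /\ W c k.+1 `<=` W c k)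
  (Wag : forall k c c', agree k c c' -> W c k = W c' k)
  (Wdis : forall c c' k x, W c k x -> W c' k x -> agree k c c')
  (eE : forall c x, x = e c <-> forall k, W c k x)
  (econt : forall c (t : R), 0 < t ->
     exists k, forall c', agree k c c' -> d (e c) (e c') < t).

Lemma e_inj c c' : e c = e c' -> c = c'.
Proof.
move=> h; apply/funext => n.
have h1 := (eE c (e c)).1 erefl n.+1; have h2 := (eE c' (e c)).1 h n.+1.
exact: (Wdis h1 h2).
Qed.

Lemma W_mono c k l : (k <= l)%N -> W c l `<=` W c k.
Proof.
elim: l => [|l IH]; first by rewrite leqn0 => /eqP ->.
rewrite leq_eqVlt => /orP [/eqP -> //|/IH h] x Wx; apply: h.
exact: (Wcl c l).2.
Qed.

(** Compactness of the Cantor set, level by level: level [k] has finitely many pieces, so the pieces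
    meeting [F] have a closed union, and the intersection of these unions is the image. *)
Lemma closed_image (F : real -> Prop) :
  (forall c, (forall k, exists c', F c' /\ agree k c c') -> F c) ->
  closed [set x | exists c, F c /\ x = e c].
Proof.
move=> clF.
pose P k : set (k.-tuple bool) := [set t | exists c, F c /\ agree k c (nth false t)].
have -> : [set x | exists c, F c /\ x = e c] =
    \bigcap_k \bigcup_(t in P k) W (nth false t) k.
  apply/seteqP; split=> x.
    move=> [c [Fc /eE xW]] k _; have ag : agree k c (nth false [tuple c i | i < k]).
      by move=> i ik; rewrite -[i]/(nat_of_ord (Ordinal ik)) -tnth_nth tnth_mktuple.
    by exists [tuple c i | i < k]; [exists c|rewrite -(Wag ag)].
  move=> h.
  have /choice [u hu] : forall k, exists c, F c /\ W c k x.
    move=> k; have [t [c [Fc ag]] Wx] := h k I; exists c.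
    by rewrite (Wag ag).
  (* Disjointness of the pieces makes the sequences [u k] cohere, so their bits assemble into one
     real. *)
  pose c i := u i.+1 i.
  have ag k : agree k c (u k).
    move=> i ik; have h1 := (hu i.+1).2; have h2 := W_mono ik (hu k).2.
    exact: (Wdis h1 h2).
  exists c; split; first by apply: clF => k; exists (u k); split=> //; have [] := hu k.
  by apply/eE => k; rewrite (Wag (ag k)); have [] := hu k.
apply: closed_bigI => k _; apply: closed_bigcup => [|t _]; first exact: finite_finset.
exact: (Wcl _ _).1.
Qed.

Lemma Del_borel (f : real -> X) (A : set X) :
  (forall c (t : R), 0 < t -> exists k, forall c', agree k c c' -> d (f c) (f c') < t) ->
  borel A -> Del (fun c => A (f c)).
Proof.
move=> cf bA; apply: (bA [set B : set X | Del (fun c => B (f c))]); split.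
  split.
  - exact: Del_const.
  - move=> B dB; apply: Del_ext (Del_not dB) => c.
    by split=> [nB|[_ nB]]; [split|].
  - move=> B dB; apply: (@Del_ext (fun c => exists n, B n (f c))).
      by move=> c; split=> [[n Bn]|[n _ Bn]]; exists n.
    by apply: Del_ex => n; exact: dB.
move=> U /(met_open dt) oU.
apply: (@Del_ext (fun c => exists s : seq bool,
  (forall c', mkseq c' (size s) = s -> U (f c')) /\
  (size s = size s /\ forall i, (i < size s)%N -> (c i <-> nth false s i)))).
  move=> c; split=> [[s [h /mkseq_eq hs]]|Uc]; first exact: h.
  have [t t0 tU] := oU _ Uc; have [k hk] := cf c t t0.
  exists (mkseq c k); rewrite size_mkseq; split.
    move=> c' cc; apply: tU; apply: hk => i ik.
    by have := congr1 (fun l => nth false l i) cc; rewrite !nth_mkseq.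
  by split=> // i ik; rewrite nth_mkseq.
apply: Del_ex => s; apply: Del_and; first exact: Del_const.
apply: Del_and; first exact: Del_const.
apply: Del_all => i; apply: Del_imp; first exact: Del_const.
by apply: Del_iff; [exact: Del_bit|exact: Del_const].
Qed.

Definition psi (a : set nat) : set X :=
  [set x | exists c, (exists m, a m /\ Cset m c) /\ x = e c].

Lemma psi_e a c : psi a (e c) <-> exists m, a m /\ Cset m c.
Proof.
by split=> [[c' [h /e_inj ->]]|h] //; exists c.
Qed.

Lemma Sou_psi a : Sou (fun c => ~ exists m, a m /\ Cset m c).
Proof.
apply: (@Sou_ext (fun c => forall m, a m -> ~ Cset m c)).
  by move=> c; split=> [h [m [am]]|h m am Cm]; [exact: h|apply: h; exists m].
apply: Sou_all => m; have [am|nam] := pselect (a m).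
  by apply: Sou_ext (Sou_compl_Cset m) => c; split=> [|h]; [|exact: h].
by apply: Sou_ext (Sou_const True) => c.
Qed.

Lemma coanalytic_psi a : coanalytic R X (psi a).
Proof.
rewrite /coanalytic /=; have [F clF hF] := Sou_psi a.
have clK := closed_image (F := fun=> True) (fun _ _ => I).
have [H clH HE] := open_Fsigma_met dm dt (closed_openC clK).
pose cw (w : nat -> nat) : real := fun n => odd (w n.+1).
pose vw (w : nat -> nat) : nat -> nat := fun n => (w n.+1)./2.
(* The entry [w 0] tells the cases apart. Off the Cantor set, [w 1] selects a closed part of its
   open complement; on it, parities give the real and halves its Souslin witness. *)
pose G x w := (w 0%N = 0%N /\ H (w 1%N) x) \/
  (w 0%N <> 0%N /\ x = e (cw w) /\ F (cw w) (vw w)).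
have cwA k w w' : agree k.+1 w w' -> agree k (cw w) (cw w').
  by move=> ag i ik; rewrite /cw ag.
have vwA k w w' : agree k.+1 w w' -> agree k (vw w) (vw w').
  by move=> ag i ik; rewrite /vw ag.
have -> : ~` psi a = [set x | exists w, G x w].
  apply/seteqP; split=> x.
    move=> npsi; have [[c [_ xc]]|nK] := pselect (exists c, True /\ x = e c); last first.
      have : (~` [set x | exists c, True /\ x = e c]) x by [].
      rewrite HE => -[n _ Hn].
      by exists (fun k => if k is 1%N then n else 0%N); left.
    have /hF [w Fw] : ~ exists m, a m /\ Cset m c by move=> /psi_e; rewrite -xc.
    exists (fun k => if k is l.+1 then (c l + (w l).*2)%N else 1%N); right; split=> //.
    have -> : cw (fun k => if k is l.+1 then (c l + (w l).*2)%N else 1%N) = c.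
      by apply/funext => n; rewrite /cw oddD odd_double addbF oddb.
    split=> //; suff -> : vw (fun k => if k is l.+1 then (c l + (w l).*2)%N else 1%N) = w by [].
    by apply/funext => n; rewrite /vw half_bit_double.
  move=> [w [[_ Hx]|[w0 [-> Fw]]]]; last by move/psi_e; apply/hF; exists (vw w).
  move=> [c [_ xc]]; suff : (~` [set x | exists c, True /\ x = e c]) x by apply; exists c.
  by rewrite HE; exists (w 1%N).
apply: (analytic_projection dm dt dc cD dD) => x w h.
have [w0|w0] := pselect (w 0%N = 0%N).
  left; split=> //; apply: (met_closed dt (H (w 1%N))).1 => // t t0; have [k kt] := eps_lt t0.
  (* Two places of agreement fix both the flag and the index of the closed part. *)
  have [x' [w' [[[w0' Hx']|[w0' _]] xx ag]]] := h (maxn k 2).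
    exists x'; split; first by rewrite ag // leq_max orbT.
    by apply: lt_le_trans xx _; apply: le_trans (eps_le R (leq_maxl k 2)) (ltW kt).
  by case: w0'; rewrite -ag // leq_max orbT.
(* [cw] and [vw] drop the flag, so one more place of agreement is kept. *)
have hk k : exists x' w', [/\ x' = e (cw w'), F (cw w') (vw w'), d x x' < eps k & agree k.+1 w w'].
  have [x' [w' [[[w0' Hx']|[w0' [xe Fw]]] xx ag]]] := h k.+1.
    by case: w0; rewrite ag.
  exists x', w'; split=> //; exact: lt_le_trans xx (eps_le R (leqnSn k)).
right; split=> //; split.
  apply: (met_eq dm) => k; have t0 : 0 < eps k / 2 :> R by rewrite divr_gt0 // eps_gt0.
  have [l hl] := econt (cw w) t0; have [m hm] := eps_lt t0.
  have [x' [w' [xe _ xx ag]]] := hk (maxn l m).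
  have : d (e (cw w)) x' < eps k / 2.
    by rewrite xe; apply: hl; apply: agreeW (leq_maxl l m) _; exact: cwA.
  have := lt_le_trans xx (eps_le R (leq_maxr l m)).
  have := met_tri dm x' x (e (cw w)); rewrite (met_sym dm x' (e _)).
  by move=> h1 h2 h3; apply: ltW; lra.
apply: clF => k; have [x' [w' [_ Fw _ ag]]] := hk k.
by exists (cw w'), (vw w'); split; [|exact: cwA|exact: vwA].
Qed.

Lemma D2_psi (a b : set nat) : a `<=` b -> reduces (D2 X) (psi a) (psi b).
Proof.
(* The pieces indexed by [b] but not by [a] make up [Z]. The zero real has no tag, so its image [pt]
   lies in no [psi] set and can absorb [Z]. *)
move=> ab; pose J m := b m /\ ~ a m; pose pt := e (fun=> false).
pose Z : set X := [set x | exists c, (exists m, J m /\ tag m c) /\ x = e c].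
have sZ : Fsigma Z.
  have -> : Z = \bigcup_m [set x | exists c, (J m /\ tag m c) /\ x = e c].
    apply/seteqP; split=> x.
      by move=> [c [[m h] xc]]; exists m => //; exists c.
    by move=> [m _ [c [h xc]]]; exists c; split=> //; exists m.
  apply: Fsigma_bigcup => m; apply: closed_Fsigma; apply: closed_image => c h.
  have [c' [[Jm [t1 t2]] ag]] := h m.*2.+1; split=> //; split; first by rewrite ag.
  by move=> k km; rewrite ag; [exact: t2|rewrite ltnS leq_double ltnW].
have sZC : Fsigma (~` Z).
  (* Infinitely many pieces may accumulate at tagless reals. Adding all of these to [Z] gives a
     closed set, so the complement of [Z] is the union of an open set and a closed one. *)
  pose T c := (exists m, J m /\ tag m c) \/ forall k, ~ c k.*2.
  have clT : closed [set x | exists c, T c /\ x = e c].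
    apply: closed_image => c h; have [no|] := pselect (forall k, ~ c k.*2); first by right.
    move=> /existsNP [k /contrapT ck]; left.
    have exk : exists k, c k.*2 by exists k.
    case: (ex_minnP exk) => m cm hmin.
    have tm : tag m c by split=> // l lm cl; have := hmin l cl; rewrite leqNgt lm.
    have [c' [Tc' ag]] := h m.*2.+1; exists m; split=> //.
    have tm' : tag m c'.
      split; first by rewrite -ag.
      by move=> l lm; rewrite -ag; [exact: tm.2|rewrite ltnS leq_double ltnW].
    case: Tc' => [[m' [Jm' /tag_inj/(_ tm') <- //]]|no].
    by case: (no m); case: tm'.
  have clN : closed [set x | exists c : real, (forall k, ~ c k.*2) /\ x = e c].
    apply: closed_image => c h k; have [c' [no ag]] := h k.*2.+1.
    by rewrite ag.
  have -> : ~` Z = ~` [set x | exists c, T c /\ x = e c] `|`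
      [set x | exists c : real, (forall k, ~ c k.*2) /\ x = e c].
    apply/seteqP; split=> x.
      move=> nZ; have [[c [[h|h] xc]]|nT] := pselect (exists c, T c /\ x = e c).
      - by case: nZ; exists c.
      - by right; exists c.
      - by left.
    move=> [nT|[c [no xc]]] [c' [[m [Jm tm]] xc']].
      by apply: nT; exists c'; split=> //; left; exists m.
    have cc : c = c' by apply: e_inj; rewrite -xc -xc'.
    by apply: (no m); rewrite cc; case: tm.
  apply: FsigmaU; last exact: closed_Fsigma.
  by apply: (open_Fsigma_met dm dt); exact: closed_openC.
pose g x := if pselect (Z x) then pt else x.
have gZ x : Z x -> g x = pt by rewrite /g; case: pselect.
have gN x : ~ Z x -> g x = x by rewrite /g; case: pselect.
exists g.
  move=> A sA; have [Apt|nApt] := pselect (A pt).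
    have -> : g @^-1` A = (A `&` ~` Z) `|` Z.
      apply/seteqP; split=> x /=.
        by have [Zx|nZ] := pselect (Z x); [right|rewrite gN //; left].
      by move=> [[Ax nZ]|Zx]; [rewrite gN|rewrite gZ].
    by apply: FsigmaU => //; exact: FsigmaI.
  have -> : g @^-1` A = A `&` ~` Z.
    apply/seteqP; split=> x /=; last by move=> [Ax nZ]; rewrite gN.
    by have [Zx|nZ] := pselect (Z x); [rewrite gZ|rewrite gN].
  exact: FsigmaI.
have npt c : ~ psi c pt.
  by move=> /psi_e [m [_ [[tm _ _] _]]]; exact: no_tag tm.
apply/seteqP; split=> x /=.
  move=> [c [[m [am Cm]] xc]].
  have nZ : ~ Z x.
    move=> [c' [[m' [[_ nam'] tm']] xc']].
    have cc : c = c' by apply: e_inj; rewrite -xc -xc'.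
    have [[tm _ _] _] := Cm; rewrite cc in tm.
    by apply: nam'; rewrite (tag_inj tm' tm).
  by rewrite gN //; exists c; split=> //; exists m; split=> //; exact: ab.
have [Zx|nZ] := pselect (Z x); first by rewrite gZ // => /npt.
rewrite gN // => -[c [[m [bm Cm]] xc]].
exists c; split=> //; exists m; split=> //; apply: contrapT => nam.
by apply: nZ; exists c; split=> //; exists m; split=> //; case: Cm => -[].
Qed.

Lemma Bor_psi (VL : V_eq_L) (a b : set nat) : reduces (Bor X) (psi a) (psi b) -> a `<=` b.
Proof.
move=> [f bf fE] n an; apply: contrapT => nbn.
apply: (@no_reduction VL n b (fun z y => f (e z) = e y)) nbn _.
(* Being equal to [e y] means lying in [W y k] for every [k], and [W y k] depends on [k] bits of
   [y]; so only countably many closed sets and their Borel preimages occur. *)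
- apply: (@Sou_ext (fun p => forall k, exists s : seq bool,
    (size s = k /\ forall i, (i < k)%N -> (p2 p i <-> nth false s i)) /\
    W (nth false s) k (f (e (p1 p))))).
    move=> p; split=> [h|/eE h k].
      apply/eE => k; have [s [/mkseq_eq hs Ws]] := h k.
      by rewrite (@Wag k _ (nth false s)) // => i ik; rewrite -hs nth_mkseq.
    exists (mkseq (p2 p) k); split; first exact/mkseq_eq.
    by rewrite -(@Wag k (p2 p)) // => i ik; rewrite nth_mkseq.
  apply: Sou_all => k; apply: Sou_ex => s; apply: Sou_and.
    suff : Del (fun p => size s = k /\ forall i, (i < k)%N -> (p2 p i <-> nth false s i)).
      by case.
    apply: Del_and; first exact: Del_const.
    apply: Del_all => i; apply: Del_imp; first exact: Del_const.
    by apply: Del_iff; [exact: Del_bit|exact: Del_const].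
  apply: (Sou_preim (A := fun c => W (nth false s) k (f (e c))) cont_p1).
  have bW : borel (f @^-1` W (nth false s) k).
    apply: bf; rewrite -[W _ _]setCK -setTD; apply: sigma_algebraCD.
    by apply: sub_gen_smallest; apply: closed_openC; exact: (Wcl _ _).1.
  by have [] := Del_borel econt bW.
- by move=> z y y' -> /e_inj.
(* Tags are exclusive and [n] is in [a], so among reals of tag [n] membership in [psi a] amounts to
   [Cset n]. *)
- move=> z tz.
  have E : psi a (e z) <-> psi b (f (e z)) by rewrite fE.
  split=> [Cz|[y [fy h]]].
    have /E [y [h fy]] : psi a (e z) by apply/psi_e; exists n.
    by exists y.
  have /psi_e [m [am Cm]] : psi a (e z) by apply/E; rewrite fy; exact/psi_e.
  by have [[tm _ _] _] := Cm; rewrite (tag_inj tz tm).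
Qed.

End Embedding.

(** * Embedding the power set into the hierarchies *)

Section Hierarchy.
Variables (X : Type) (F : set (X -> X)) (Gamma : set (set X)) (psi : set nat -> set X).
Hypotheses (redF : reducibility F) (psiG : forall a, Gamma (psi a)).
Hypothesis psiE : forall a b : set nat, a `<=` b <-> reduces F (psi a) (psi b).

Lemma reduces_refl A : reduces F A A.
Proof. by exists id => //; exact: redF.1. Qed.

Lemma reduces_trans B A C : reduces F A B -> reduces F B C -> reduces F A C.
Proof.
move=> [f Ff ->] [g Fg ->]; exists (g \o f) => //; exact: redF.2.
Qed.

Let phi a := degree F Gamma (psi a).

Let phi_in a : hierarchy F Gamma (phi a).
Proof. by exists (psi a). Qed.

Let phi_le a b : a `<=` b <-> degree_le F (phi a) (phi b).
Proof.
rewrite psiE; split=> [h|[A [B [[_ aA _] [_ _ Bb] AB]]]].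
  by exists (psi a), (psi b); split=> //; split=> //; exact: reduces_refl.
exact: reduces_trans aA (reduces_trans AB Bb).
Qed.

Lemma power_set_embeds :
  order_embeds (fun a b : set nat => a `<=` b) (hierarchy F Gamma) (degree_le F).
Proof. by exists phi. Qed.

Lemma power_set_very_bad : very_bad F Gamma.
Proof.
split.
  have single n m : degree_le F (phi [set n]) (phi [set m]) -> n = m.
    by move=> /phi_le /(_ n erefl).
  exists (range (fun n => phi [set n])); split.
  - by move=> _ [n _ <-]; exact: phi_in.
  - have inj : {in [set: nat] &, injective (fun n => phi [set n])}.
      move=> n m _ _ e; apply: single; rewrite e; exact/phi_le.
    by rewrite (eq_finite_set (inj_card_eq inj)); exact: infinite_nat.
  - move=> _ _ [n _ <-] [m _ <-] ne /single nm; apply: ne.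
    by rewrite nm.
exists (fun n => phi [set k | (n <= k)%N]); split=> [n|n]; first exact: phi_in.
split; first by apply/phi_le => k /= /ltnW.
by move=> /phi_le /(_ n (leqnn n)) /=; rewrite ltnn.
Qed.

End Hierarchy.

Local Close Scope ring_scope.

Theorem theorem6p11 (R : realType) (X : topologicalType)
    (VL : V_eq_L) (X_polish : polish R X)
    (X_uncountable : ~ countable [set: X]) :
  (exists psi : set nat -> set X,
     (forall a, coanalytic R X (psi a)) /\
     forall a b : set nat,
       (a `<=` b -> reduces (D2 X) (psi a) (psi b)) /\
       (reduces (Bor X) (psi a) (psi b) -> a `<=` b)) /\
  (forall F : set (X -> X),
     reducibility F -> D2 X `<=` F -> F `<=` Bor X ->
     order_embeds (fun a b : set nat => a `<=` b)
       (hierarchy F (coanalytic R X)) (degree_le F) /\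
     very_bad F (coanalytic R X)).
Proof.
have [[D cD dD] [d [dm dt dc]]] := X_polish.
have [W [e [Wcl Wag Wdis eE econt]]] := cantor_scheme dm dt cD dD dc X_uncountable.
have psi1 a : coanalytic R X (psi e a).
  exact: (coanalytic_psi dm dt dc cD dD Wcl Wag Wdis eE econt).
have psi2 a b : a `<=` b -> reduces (D2 X) (psi e a) (psi e b).
  exact: (D2_psi dm dt Wcl Wag Wdis eE).
have psi3 a b : reduces (Bor X) (psi e a) (psi e b) -> a `<=` b.
  exact: (Bor_psi dt Wcl Wag Wdis eE econt VL).
split; first by exists (psi e); split=> // a b; split; [exact: psi2|exact: psi3].
move=> F redF subF supF.
have psiE a b : a `<=` b <-> reduces F (psi e a) (psi e b).
  split=> [/psi2 [f Df fE]|[f Ff fE]]; first by exists f => //; exact: subF.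
  by apply: psi3; exists f => //; exact: supF.
by split; [exact: power_set_embeds psi1 psiE|exact: power_set_very_bad psi1 psiE].
Qed.
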